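(* Let $2<s\le3$ and let $Y_t$, $t\ge0$, be given $s$-integrable, univariate random variables satisfying $$Y_t\overset{\mathrm d}{=}\sum_{r=1}^KY^{(r)}_{T_r^{(t)}}+b_t,\qquad t\ge\tau_0$$ (with the conventions of the context). Assume that $\sup_{u\le t}\mathbb E|Y_u|^s<\infty$ for every $t$, and that the mean and variance of $Y_t$ satisfy, as $t\to\infty$, $$\mathbb E Y_t=f(t)+o(g^{1/2}(t)),\qquad\operatorname{Var}(Y_t)=g(t)+o(g(t)),$$ with functions $f:[0,\infty)\to\mathbb R$, $g:[0,\infty)\to[0,\infty)$ such that $$\sup_{u\le t}|f(u)|<\infty\ \text{for every }t>0,\qquad\lim_{t\to\infty}g(t)=\infty,\qquad\sup_{u\le t}g(u)=O(g(t))$$ (thus, for some constant $C\ge1$, $g(u)\le Cg(t)$ when $0\le u\le t$). If, as $t\to\infty$, $$\left(\sqrt{\frac{g(T_1^{(t)})}{g(t)}},\dots,\sqrt{\frac{g(T_K^{(t)})}{g(t)}}\right)\overset{\ell_s}{\longrightarrow}(A_1^*,\dots,A_K^* ),$$ $$\frac1{g^{1/2}(t)}\left(b_t-f(t)+\sum_{r=1}^Kf(T_r^{(t)})\right)\overset{\ell_s}{\longrightarrow}0$$ for some random variables $A_1^*,\dots,A_K^*$, and furthermore $$\sum_{r=1}^K(A_r^* )^2=1\ \text{(a.s.)},\qquad\mathbb P\Bigl(\bigcup_{r=1}^K\{A_r^*=1\}\Bigr)<1,$$ then $$\frac{Y_t-f(t)}{g^{1/2}(t)}\overset{\mathrm d}{\to}\mathcal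 N(0,1)\qquad\text{as }t\to\infty.$$
   Context: Setting of the recurrence: $K$ is a positive integer, $\tau_0\ge0$; $T^{(t)}=(T_1^{(t)},\dots,T_K^{(t)})$ is a vector of random indices $T_r^{(t)}\in[0,t]$ and $b_t$ is a real random variable; the families $(Y_t^{(1)})_t,\dots,(Y_t^{(K)})_t$ and $(b_t,T^{(t)})_t$ are independent; and for each $t\ge0$ and each $r$, $Y_t^{(r)}$ has the same distribution as $Y_t$. All $Y_t$, $b_t$, $T^{(t)}$ are defined on some probability space and are measurable functions of $(t,\omega)$. (The joint distribution of $Y_t$ for different $t$ is irrelevant.) For $s\ge1$ and probability measures $\mu,\nu$ on $\mathbb R^k$ with finite absolute moment of order $s$, $\ell_s(\mu,\nu)$ is the infimum of $(\mathbb E|X-Y|^s)^{1/s}$ over all couplings of $X\overset{\mathrm d}{=}\mu$, $Y\overset{\mathrm d}{=}\nu$; $\overset{\ell_s}{\longrightarrow}$ denotes convergence of laws in $\ell_s$.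
   Formalization: Independence of the families is taken with their measurability in (t,ω): each family is jointly measurable for its own sigma-algebra, these being independent. With independence of the coordinates alone the claim fails, since Y^(r) may be altered at random times hit by T_r. *)

(* Defs.v *)
From HB Require Import structures.
From mathcomp Require Import all_boot all_order all_algebra.
From mathcomp Require Import all_classical all_reals all_analysis.
Set Implicit Arguments.
Unset Strict Implicit.
Unset Printing Implicit Defensive.
Import Order.TTheory GRing.Theory Num.Theory.
Import numFieldNormedType.Exports.
Local Open Scope classical_set_scope.
Local Open Scope ring_scope.
Local Open Scope ereal_scope.

(* Makes o_(t \near +oo) available. *)
Canonical pinfty_nbhs_filter_on (R : realType) :=
  FilterType (pinfty_nbhs R) _.

Definition enorm (R : realType) (k : nat) (x : k.-tuple R) : R :=
  Num.sqrt (\sum_(i < k) tnth x i ^+ 2)%R.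

Definition tsub (R : realType) (k : nat) (x y : k.-tuple R) : k.-tuple R :=
  [tuple (tnth x i - tnth y i)%R | i < k].

(* Meant for measurable maps X : T1 -> T and Y : T2 -> T, possibly defined on
   different probability spaces. *)
Definition eq_dist (R : realType) (d1 d2 d : measure_display)
    (T1 : measurableType d1) (T2 : measurableType d2) (T : measurableType d)
    (P1 : probability T1 R) (X : T1 -> T)
    (P2 : probability T2 R) (Y : T2 -> T) : Prop :=
  forall B : set T, measurable B -> pushforward P1 X B = pushforward P2 Y B.

(* The distance between the laws of V and W, as an element of [0, +oo]. *)
Definition ell_dist (R : realType) (k : nat) (s : R) (d1 d2 : measure_display)
    (T1 : measurableType d1) (P1 : probability T1 R) (V : T1 -> k.-tuple R)
    (T2 : measurableType d2) (P2 : probability T2 R) (W : T2 -> k.-tuple R) :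
    \bar R :=
  ereal_inf [set e | exists (d : measure_display) (T : measurableType d)
      (P : probability T R) (X Y : {mfun T >-> k.-tuple R}),
      [/\ eq_dist P X P1 V, eq_dist P Y P2 W &
          e = Lnorm P s%:E (fun w => (enorm (tsub (X w) (Y w)))%:E)]].

Definition ell_integrable (R : realType) (k : nat) (s : R) (d : measure_display)
    (T : measurableType d) (P : probability T R) (V : T -> k.-tuple R) : Prop :=
  measurable_fun setT V /\ 'E_P[fun w => (enorm (V w) `^ s)%R] < +oo.

(* Convergence in l_s, as t -> +oo through the reals, of the laws of the V t to
   the law of W.  The distance only exists between laws with a finite absolute
   moment of order s, which in particular must be laws of random vectors; for
   the V t this is asked for large t only. *)
Definition ell_cvg (R : realType) (k : nat) (s : R) (d1 d2 : measure_display)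
    (T1 : measurableType d1) (P1 : probability T1 R)
    (V : R -> T1 -> k.-tuple R)
    (T2 : measurableType d2) (P2 : probability T2 R) (W : T2 -> k.-tuple R) :
    Prop :=
  [/\ \forall t \near +oo%R, ell_integrable s P1 (V t),
      ell_integrable s P2 W &
      ell_dist s P1 (V t) P2 W @[t --> +oo%R] --> (0 : \bar R)].

(* Weak convergence of the laws of the X t to nu, as t -> +oo through the
   reals. *)
Definition cvg_in_dist (R : realType) (d : measure_display)
    (T : measurableType d) (P : probability T R) (X : R -> T -> R)
    (nu : probability (measurableTypeR R) R) : Prop :=
  forall h : R -> R, continuous h ->
    (exists M : R, forall x, (`|h x| <= M)%R) ->
    'E_P[fun w => h (X t w)] @[t --> +oo%R] --> \int[nu]_x (h x)%:E.

Definition independent_sigmas (R : realType) (d : measure_display)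
    (T : measurableType d) (P : probability T R) (I : finType)
    (F : I -> set_system T) : Prop :=
  forall (J : {set I}) (E : I -> set T),
    (forall i, i \in J -> F i (E i)) ->
    P (\bigcap_(i in [set` J]) E i) = \prod_(i in J) P (E i).

(* joint measurability in (t, w), for t ranging over [0, +oo[ *)
Definition measurable_family (R : realType) (d d' : measure_display)
    (T : measurableType d) (U : measurableType d') (X : R -> T -> U) : Prop :=
  measurable_fun ([set t : R | (0 <= t)%R] `*` [set: T])
    (fun p : measurableTypeR R * T => X p.1 p.2).

(* Independence of the K + 1 jointly measurable families (Y_t^(r))_t, r < K,
   and (b_t, T^(t))_t: they are jointly measurable with respect to independent
   sigma-algebras G (Some r) and G None.  Independence of the sigma-algebras
   generated by the coordinates alone would say nothing about Y^(r) evaluated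
   at a random time: Y_t = 1{t = U}, with U uniform on [0, 1], generates a
   P-trivial sigma-algebra, hence is independent of U in that sense, and yet
   Y_U = 1. *)
Definition independent_families (R : realType) (K : nat) (d : measure_display)
    (Om : measurableType d) (P : probability Om R)
    (Y : 'I_K -> R -> Om -> R) (b : R -> Om -> R) (T : 'I_K -> R -> Om -> R) :
    Prop :=
  exists G : option 'I_K -> set_system Om,
    [/\ forall i, sigma_algebra setT (G i) /\ G i `<=` measurable,
        independent_sigmas P G,
        forall r, measurable_family (T := g_sigma_algebraType (G (Some r))) (Y r),
        measurable_family (T := g_sigma_algebraType (G None)) b &
        forall r, measurable_family (T := g_sigma_algebraType (G None)) (T r)].

(* Main.v *)
(* Let d_t be a Zolotarev type distance of order s between the law of the
   centered Y_t and N(0, Var Y_t). Conditionally on (b_t, T^(t)), the summands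
   of the recursion, once centered, can be replaced one after the other by
   independent normal variables with the same variances, at a cost of at most
   sum_r E d_(T_r^(t)). There remains a normal mixture with random mean (the
   centered toll) and random variance; it lies within o(g(t)^(s/2)) of
   N(0, Var Y_t), because the terms of order one and two of a Taylor expansion
   are determined by the mean and the variance, which agree. As
   E sum_r (g(T_r^(t)) / g(t))^(s/2) has the limit E sum_r (A_r^* )^s < 1, the
   resulting inequality is a contraction and yields d_t = o(g(t)^(s/2)).
   Piecewise cubic test functions turn this into weak convergence. *)
Require Import Defs.
From HB Require Import structures.
From mathcomp Require Import all_boot all_order all_algebra.
From mathcomp Require Import all_classical all_reals all_analysis.
From mathcomp Require Import measurable_realfun ring lra.
Import Order.TTheory GRing.Theory Num.Theory.
Import numFieldNormedType.Exports.
Local Open Scope classical_set_scope.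
Local Open Scope ring_scope.

(** * Gaussian integrals *)

(** Three obstacles shape the proof. Time is continuous and [T_r^(t)] may equal [t], so the
    inequality bounds d_t by quantities that may involve d_t itself, and induction on [t] is
    impossible. Instead, bounds [C + l * g(u)^(s/2)] holding on a whole interval are improved
    through [l |-> xi * l + eta], from a crude finite start. The constant [C] does not contract,
    being multiplied by [K] at each pass: it is absorbed by [g(u)^(s/2) >= 1] while [l] is made
    independent of the interval, and may grow with the number of passes once [l] is to become small.
    As a supremum over an uncountable class, d_u need not be measurable in [u], and a random index
    is substituted for [u]; so d_u never occurs as a number, only explicit upper bounds of it do.
    Mean and variance are [f] and [g] only asymptotically, whereas the low-order Taylor terms must
    cancel exactly: centering and variances are the true ones, and [f], [g] enter only through
    limits and normalization. Test functions are bounded and nonnegative, so that Tonelli applies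
    freely, and an inequality between values replaces differentiability. *)

Section gaussian.
Context {R : realType}.
Local Notation mu := (@lebesgue_measure R).
Local Notation gam := (normal_prob (0 : R) 1).
Local Notation phi := (normal_pdf (0 : R) 1).

(** The Radon-Nikodym derivative and the explicit density have the same integral over every
    measurable set, hence agree almost everywhere. *)
Lemma ge0_integral_normal_prob (m s : R) (f : R -> \bar R) :
  measurable_fun [set: R] f -> (forall x, (0 <= f x)%E) ->
  (\int[normal_prob m s]_x f x = \int[mu]_x (f x * (normal_pdf m s x)%:E))%E.
Proof.
move=> mf f0.
have dom : normal_prob m s `<< mu by exact: normal_prob_dominates.
rewrite -(Radon_Nikodym_SigmaFinite.change_of_variables dom)//.
have mpdf : measurable_fun [set: R] (fun x : R => (normal_pdf m s x)%:E).
  by apply/measurable_EFinP; exact: measurable_normal_pdf.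
apply: ge0_ae_eq_integral => //.
- apply: emeasurable_funM => //.
  exact: measurable_int (Radon_Nikodym_SigmaFinite.f_integrable dom).
- exact: emeasurable_funM.
- by move=> x _; rewrite mule_ge0// Radon_Nikodym_SigmaFinite.f_ge0.
- by move=> x _; rewrite mule_ge0// lee_fin normal_pdf_ge0.
apply: ae_eqe_mul2l; apply: integral_ae_eq => //.
  exact: Radon_Nikodym_SigmaFinite.f_integrable.
by move=> E _ mE; rewrite -Radon_Nikodym_SigmaFinite.f_integral.
Qed.

Lemma continuous_comp_affine (a b : R) (G : R -> R) :
  continuous G -> continuous (fun x => G (a * x + b)).
Proof.
move=> cG x; apply: (@continuous_comp _ _ _ (fun x => a * x + b) G).
  apply: cvgD; last exact: cvg_cst.
  by apply: cvgM; [exact: cvg_cst|exact: cvg_id].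
exact: cG.
Qed.

Lemma integral_affine_subst (G : R -> R) (a b : R) : 0 < a ->
  continuous G -> (forall x, 0 <= G x) ->
  (\int[mu]_x (G x)%:E = \int[mu]_x (G (a * x + b) * a)%:E)%E.
Proof.
move=> a0 cG G0; pose F := fun x : R => a * x + b.
have dF (x : R) : is_derive x (1 : R) F a.
  by apply: is_derive_eq; rewrite addr0 /GRing.scale/= mulr1.
have F'E : F^`()%classic = cst a.
  by apply/funext => x; rewrite derive1E derive_val.
rewrite (@increasing_ge0_integration_by_substitutionT _ F)//.
- by apply: eq_integral => x _; rewrite F'E.
- by move=> x y xy; rewrite /F ltrD2r ltr_pM2l.
- by rewrite F'E => x; exact: cvg_cst.
- by rewrite F'E; exact: is_cvg_cst.
- by rewrite F'E; exact: is_cvg_cst.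
- apply/cvgrNyPle => A; exists ((A - b) / a); split; first exact: num_real.
  by move=> x; rewrite /= /F ltr_pdivlMr// -lerBrDr mulrC => /ltW.
- apply/cvgryPge => A; exists ((A - b) / a); split; first exact: num_real.
  by move=> x; rewrite /= /F ltr_pdivrMr// -lerBlDr mulrC => /ltW.
Qed.

(** Both sides are the joint density of (v X + w Y, Y) at (x, y), for independent standard normal X
    and Y: on the right it is factored as the density of the sum times the conditional density of Y
    given the sum. *)
Lemma sigma_gauss_conv (v w x y : R) : 0 < v -> 0 < w ->
  let r := Num.sqrt (v ^+ 2 + w ^+ 2) in
  normal_pdf 0 v (x - w * y) * phi y =
  normal_pdf 0 r x * normal_pdf (w * x / r ^+ 2) (v / r) y.
Proof.
move=> v0 w0 r.
have r2 : r ^+ 2 = v ^+ 2 + w ^+ 2.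
  by rewrite sqr_sqrtr// addr_ge0// sqr_ge0.
have r0 : 0 < r by rewrite sqrtr_gt0 addr_gt0// exprn_gt0.
rewrite !normal_pdfE ?oner_neq0 ?gt_eqF ?divr_gt0//.
rewrite /normal_fun /normal_peak.
have pE (s : R) : 0 < s ->
  (Num.sqrt (s ^+ 2 * pi *+ 2))^-1 = (s * Num.sqrt (pi *+ 2))^-1.
  by move=> s0; rewrite -mulrnAr sqrtrM ?sqr_ge0// sqrtr_sqr gtr0_norm.
rewrite !pE ?divr_gt0//.
have mulE (k1 k2 e1 e2 : R) :
  k1 * expR e1 * (k2 * expR e2) = k1 * k2 * expR (e1 + e2).
  by rewrite expRD; ring.
rewrite !mulE; congr (_ * expR _).
  rewrite -!invfM; congr (_^-1); rewrite mul1r; field.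
  by rewrite gt_eqF.
have rn0 : r != 0 by rewrite gt_eqF.
have vn0 : v != 0 by rewrite gt_eqF.
have vw0 : v ^+ 2 + w ^+ 2 != 0 by rewrite -r2 sqrf_eq0.
rewrite !exprMn !exprVn r2.
by field; rewrite vn0 vw0.
Qed.

Lemma gauss_scale (v b : R) (G : R -> R) : 0 < v ->
  continuous G -> (forall x, 0 <= G x) ->
  (\int[gam]_x (G (v * x + b))%:E =
   \int[mu]_x (G x * normal_pdf b v x)%:E)%E.
Proof.
move=> v0 cG G0; have vn0 : v != 0 by rewrite gt_eqF.
rewrite ge0_integral_normal_prob; last 2 first.
- apply/measurable_EFinP; apply: continuous_measurable_fun.
  exact: continuous_comp_affine.
- by move=> x /=; rewrite lee_fin G0.
rewrite [RHS](@integral_affine_subst _ v b)//.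
- apply: eq_integral => x _; rewrite -EFinM -mulrA; congr (_ * _)%:E.
  rewrite !normal_pdfE ?oner_neq0// /normal_fun /normal_peak.
  rewrite -[(v ^+ 2 * _ *+ 2)]mulrnAr sqrtrM ?sqr_ge0// sqrtr_sqr gtr0_norm//.
  rewrite expr1n mul1r invfM addrK subr0.
  have -> : - (v * x) ^+ 2 / (v ^+ 2 *+ 2) = - x ^+ 2 / (1 *+ 2) by field.
  by set q := (Num.sqrt _)^-1; set e := expR _; field.
- move=> x; apply: cvgM; first exact: cG.
  by apply: continuous_normal_pdf.
- by move=> x; rewrite mulr_ge0// normal_pdf_ge0.
Qed.

(* The inner integral of the product of the densities of [v X + w Y] and [Y] is
   evaluated by completing the square. *)
Lemma gauss_conv (v w : R) (h : R -> R) : 0 <= v -> 0 <= w ->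
  continuous h -> (forall x, 0 <= h x) ->
  (\int[gam]_y \int[gam]_x (h (v * x + w * y))%:E =
   \int[gam]_z (h (Num.sqrt (v ^+ 2 + w ^+ 2) * z))%:E)%E.
Proof.
move=> v0 w0 ch h0.
move: v0; rewrite le_eqVlt => /predU1P[<-|v0].
  apply: eq_integral => y _; rewrite expr0n add0r sqrtr_sqr ger0_norm//.
  under eq_integral do rewrite mul0r add0r.
  by rewrite integral_cst//= probability_setT mule1.
move: w0; rewrite le_eqVlt => /predU1P[<-|w0].
  rewrite expr0n addr0 sqrtr_sqr gtr0_norm//.
  under eq_integral do under eq_integral do rewrite mul0r addr0.
  by rewrite integral_cst//= probability_setT mule1.
pose r := Num.sqrt (v ^+ 2 + w ^+ 2).
have r0 : 0 < r by rewrite sqrtr_gt0 addr_gt0// exprn_gt0.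
have mh : measurable_fun [set: R] h by exact: continuous_measurable_fun.
under eq_integral do rewrite gauss_scale//.
pose D (p : R * R) := h p.2 * normal_pdf 0 v (p.2 - w * p.1) * phi p.1.
have mD1 : measurable_fun [set: R * R]
    (fun p : R * R => h p.2 * normal_pdf 0 v (p.2 - w * p.1)).
  apply: measurable_funM; first exact: measurableT_comp.
  apply: measurableT_comp; first exact: measurable_normal_pdf.
  by apply: measurable_funB => //; apply: measurable_funM.
have mD : measurable_fun [set: R * R] D.
  apply: measurable_funM => //.
  by apply: measurableT_comp => //; exact: measurable_normal_pdf.
have pdfE (y x : R) : normal_pdf (w * y) v x = normal_pdf 0 v (x - w * y).
  by rewrite !normal_pdfE ?gt_eqF// /normal_fun subr0.
rewrite [LHS]ge0_integral_normal_prob; last 2 first.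
- rewrite [X in measurable_fun _ X](_ : _ = fubini_F mu
    (fun p : R * R => (h p.2 * normal_pdf 0 v (p.2 - w * p.1))%:E)); last first.
    by apply/funext => y; rewrite /fubini_F; apply: eq_integral => x _; rewrite pdfE.
  apply: measurable_fun_fubini_tonelli_F; first exact/measurable_EFinP.
  by move=> p; rewrite lee_fin mulr_ge0// normal_pdf_ge0.
- move=> y; apply: integral_ge0 => x _.
  by rewrite lee_fin mulr_ge0// normal_pdf_ge0.
transitivity (\int[mu]_y \int[mu]_x (D (y, x))%:E)%E.
  apply: eq_integral => y _; rewrite -ge0_integralZr.
  - by apply: eq_integral => x _; rewrite -EFinM pdfE.
  - exact: measurableT.
  - apply/measurable_EFinP/measurable_funM => //.
    exact: measurable_normal_pdf.
  - by move=> x _; rewrite lee_fin mulr_ge0// normal_pdf_ge0.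
  - by rewrite lee_fin normal_pdf_ge0.
transitivity (\int[mu]_x \int[mu]_y (D (y, x))%:E)%E.
  apply: (@fubini_tonelli _ _ _ _ R mu mu (fun p => (D p)%:E)); first exact/measurable_EFinP.
  by move=> p; rewrite lee_fin !mulr_ge0// normal_pdf_ge0.
under [RHS]eq_integral do rewrite -[_ * _]addr0.
rewrite gauss_scale//; apply: eq_integral => x _.
have DE (y : R) : D (y, x) =
    h x * normal_pdf 0 r x * normal_pdf (w * x / r ^+ 2) (v / r) y.
  by rewrite /D /= -mulrA sigma_gauss_conv// mulrA.
under eq_integral do rewrite /= DE EFinM.
rewrite ge0_integralZl//.
- by rewrite integral_normal_pdf mule1.
- by apply/measurable_EFinP; exact: measurable_normal_pdf.
- by move=> y _; rewrite lee_fin normal_pdf_ge0.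
- by rewrite lee_fin mulr_ge0// normal_pdf_ge0.
Qed.
End gaussian.

(** * Moments of the standard normal law *)

Section gaussian_moments.
Context {R : realType}.
Local Notation mu := (@lebesgue_measure R).
Local Notation gam := (normal_prob (0 : R) 1).
Local Notation phi := (normal_pdf (0 : R) 1).

Lemma gauss_sym (f : R -> \bar R) :
  measurable_fun [set: R] f -> (forall x, (0 <= f x)%E) ->
  (\int[gam]_x f (- x)%R = \int[gam]_x f x)%E.
Proof.
move=> mf f0; have mN : measurable_fun [set: R] (-%R : R -> R).
  exact: oppr_measurable.
have mfN : measurable_fun [set: R] (fun x => f (- x)).
  exact: measurableT_comp mN.
have mp : measurable_fun [set: R] (fun x : R => (phi x)%:E).
  by apply/measurable_EFinP; exact: measurable_normal_pdf.
rewrite !ge0_integral_normal_prob//.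
have -> : (\int[mu]_x (f x * (phi x)%:E) =
    \int[pushforward mu (-%R : _ -> measurableTypeR R)]_x (f x * (phi x)%:E))%E.
  by apply: eq_measure_integral => A mA _; exact/esym/lebesgue_measureN.
have mF : measurable_fun [set: measurableTypeR R] (fun x => (f x * (phi x)%:E)%E).
  exact: emeasurable_funM.
have F0 : {in [set: measurableTypeR R], forall x, (0 <= f x * (phi x)%:E)%E}.
  by move=> x _; rewrite mule_ge0// lee_fin normal_pdf_ge0.
apply: (etrans _ (esym (@ge0_integral_pushforward _ _ (measurableTypeR R) (measurableTypeR R)
  R (-%R) mN mu _ _ measurableT mF F0))).
rewrite preimage_setT; apply: eq_integral => x _ /=; congr (_ * _%:E)%E.
by rewrite !normal_pdfE ?oner_neq0// /normal_fun !subr0 sqrrN.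
Qed.

Lemma is_derive_phi (x : R) :
  is_derive x (1 : R) (fun y => - phi y) (x * phi x).
Proof.
have -> : (fun y => - phi y) =
    (fun y => - normal_peak 1 * expR (- 2^-1 * y ^+ 2)).
  apply/funext => y; rewrite normal_pdfE ?oner_neq0// mulNr.
  congr (- (_ * expR _)); rewrite subr0 expr1n; by field.
apply: is_derive_eq.
rewrite normal_pdfE ?oner_neq0// /normal_fun subr0 expr1n.
have -> : - x ^+ 2 / (1 *+ 2) = - 2^-1 * x ^+ 2 :> R by field.
by rewrite /GRing.scale/=; field.
Qed.

(** Dominates the integrand of the third moment by a multiple of the density of standard deviation
    2, whose integral is 1. The constant 128 is a rounded-up (32/3)^2. *)
Lemma gauss_cube_bound (x : R) :
  (1 + `|x|) ^+ 3 * phi x <=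
  128 * normal_peak 1 / normal_peak 2 * normal_pdf 0 2 x.
Proof.
rewrite !normal_pdfE ?oner_neq0// /normal_fun !subr0 expr1n.
have k1 : 0 < normal_peak (1 : R) by rewrite normal_peak_gt0.
have k2 : normal_peak (2 : R) != 0 by rewrite gt_eqF// normal_peak_gt0.
rewrite mulrCA -[128 * _ / _ * _]mulrA mulKf// -[leRHS]mulrA [leRHS]mulrCA.
rewrite ler_pM2l//.
set a := `|x|; have a0 : 0 <= a by exact: normr_ge0.
(* The exponents x^2/2 and x^2/8 differ by 3x^2/8. Halving this gap gives two exponential factors,
   each at least 1 + 3x^2/16, whose product beats a fourth power of 1 + |x|. *)
have -> : - x ^+ 2 / (1 *+ 2) = - (3 / 16 * a ^+ 2 + 3 / 16 * a ^+ 2)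
    + - x ^+ 2 / (2 ^+ 2 *+ 2).
  by rewrite /a real_normK ?num_real//; field.
rewrite expRD mulrA ler_pM2r ?expR_gt0// expRN ler_pdivrMr ?expR_gt0// expRD.
have e1 : 1 + 3 / 16 * a ^+ 2 <= expR (3 / 16 * a ^+ 2) by exact: expR_ge1Dx.
have h1 : (1 + a) ^+ 2 <= 32 / 3 * (1 + 3 / 16 * a ^+ 2) by nra.
nra.
Qed.

Lemma gauss_moment3 :
  (\int[gam]_x ((1 + `|x|) ^+ 3)%:E <=
   (128 * normal_peak 1 / normal_peak 2 : R)%:E)%E.
Proof.
have mp (s : R) : measurable_fun [set: R] (fun x : R => (normal_pdf 0 s x)%:E).
  by apply/measurable_EFinP; exact: measurable_normal_pdf.
have m3 : measurable_fun [set: R] (fun x : R => ((1 + `|x|) ^+ 3)%:E).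
  apply/measurable_EFinP; apply: measurable_funX.
  by apply: measurable_funD => //; exact: normr_measurable.
have m30 (x : R) : (0 <= ((1 + `|x|) ^+ 3)%:E)%E.
  by rewrite lee_fin exprn_ge0// addr_ge0.
rewrite ge0_integral_normal_prob//.
have C0 : 0 <= 128 * normal_peak 1 / normal_peak 2 :> R.
  by rewrite !mulr_ge0 ?invr_ge0 ?normal_peak_ge0.
rewrite -[leRHS]mule1 -(integral_normal_pdf 0 2) -ge0_integralZl//; last first.
  by move=> x _; rewrite lee_fin normal_pdf_ge0.
  exact: mp.
apply: ge0_le_integral => //.
- by move=> x _; rewrite mule_ge0// lee_fin normal_pdf_ge0.
- exact: (emeasurable_funM m3 (mp 1)).
- exact: (emeasurable_funM (measurable_cst _) (mp 2)).
- by move=> x _; rewrite -!EFinM lee_fin gauss_cube_bound.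
Qed.

Lemma integral_phi_tail (x : R) : 0 <= x ->
  (\int[mu]_(u in `[x, +oo[) (u * phi u)%:E = (phi x)%:E)%E.
Proof.
move=> x0.
have cphi : continuous phi by apply: continuous_normal_pdf; rewrite oner_neq0.
rewrite (@ge0_continuous_FTC2y _ _ (fun y => - phi y) _ 0).
- by rewrite -EFinB sub0r opprK.
- by move=> u xu; rewrite mulr_ge0 ?normal_pdf_ge0// (le_trans x0).
- apply: continuous_subspaceT => u; apply: cvgM; [exact: cvg_id|exact: cphi].
(* The summand 2 ensures u^2/2 >= u, so that exp(u^2/2) exceeds [normal_peak 1 / e]. *)
- apply/cvgrPdist_le => e e0; exists (normal_peak 1 / e + 2); split.
    exact: num_real.
  move=> u /= ue; rewrite sub0r opprK ger0_norm ?normal_pdf_ge0//.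
  have pe : 0 <= normal_peak 1 / e by rewrite divr_ge0 ?normal_peak_ge0// ltW.
  rewrite normal_pdfE ?oner_neq0// /normal_fun subr0 expr1n mulNr expRN.
  have E1 := expR_ge1Dx (u ^+ 2 / (1 *+ 2)).
  rewrite ler_pdivrMr ?expR_gt0// mulrC -ler_pdivrMr//.
  apply: le_trans E1.
  nra.
- by move=> y xy; exact: (@ex_derive _ _ _ _ _ _ _ (is_derive_phi y)).
- by apply: cvgN; apply: cvg_at_right_filter; exact: cphi.
- by move=> y _; rewrite derive1E; exact: (@derive_val _ _ _ _ _ _ _ (is_derive_phi y)).
Qed.

(** Integration by parts in the form of Tonelli: u^2 phi(u) is the integral of u phi(u) over x in
    [0, u], and integrating over u >= x first leaves phi(x) by [integral_phi_tail]. *)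
Lemma gauss_moment2_half :
  (\int[mu]_(u in [set u : R | (0 <= u)%R]) (u ^+ 2 * phi u)%:E =
   \int[mu]_(u in [set u : R | (0 <= u)%R]) (phi u)%:E)%E.
Proof.
have mphi : measurable_fun [set: R] phi by exact: measurable_normal_pdf.
have mle (D : set (R * R)) (F G : R * R -> R) : measurable_fun setT F ->
    measurable_fun setT G -> measurable [set p : R * R | F p <= G p].
  move=> mF mG; rewrite -[X in measurable X]setTI.
  by apply: (measurable_fun_ler mF mG measurableT (_ : measurable [set true])).
pose S := [set p : R * R | 0 <= p.1] `&` [set p : R * R | p.1 <= p.2].
have mS : measurable S by apply: measurableI; apply: mle.
pose D (p : R * R) := p.2 * phi p.2 * \1_S p.
have mD : measurable_fun [set: R * R] D.
  apply: measurable_funM; last exact: measurable_indic.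
  by apply: measurable_funM => //; exact: measurableT_comp.
have D0 p : 0 <= D p.
  rewrite /D indicE; have [/[1!inE] -[/= p1 p12]|_] := boolP (p \in S).
    by rewrite mulr1 mulr_ge0 ?normal_pdf_ge0// (le_trans p1).
  by rewrite mulr0.
have mDE : measurable_fun [set: R * R] (fun p => (D p)%:E).
  exact/measurable_EFinP.
have swap : (\int[mu]_x \int[mu]_u (D (x, u))%:E =
    \int[mu]_u \int[mu]_x (D (x, u))%:E)%E.
  exact: (@fubini_tonelli _ _ _ _ R mu mu (fun p => (D p)%:E)).
have pos : [set u : R | 0 <= u] = `[0, +oo[%classic by rewrite set_itvcy.
rewrite [LHS]integral_mkcond [RHS]integral_mkcond.
transitivity (\int[mu]_u \int[mu]_x (D (x, u))%:E)%E; last first.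
  rewrite -swap; apply: eq_integral => x _; rewrite patchE.
  case: ifPn => [|x0]; rewrite ?inE /=.
    move=> x0; rewrite -(integral_phi_tail x x0) [RHS]integral_mkcond.
    apply: eq_integral => u _; rewrite patchE /D indicE /S.
    case: ifPn => [|]; rewrite ?inE ?notin_setE /= in_itv/= andbT => xu.
      by rewrite mem_set// mulr1.
    by rewrite memNset ?mulr0// => -[].
  apply: integral0_eq => u _; rewrite /D indicE memNset ?mulr0//.
  by move=> [/= x0']; rewrite mem_set in x0.
apply: eq_integral => u _; rewrite patchE.
case: ifPn => [|u0]; rewrite ?inE /=.
  move=> u0.
  have DE (x : R) : D (x, u) = u * phi u * \1_(`[0, u]%classic : set R) x.
    rewrite /D !indicE /S; congr (_ * (nat_of_bool _)%:R).
    apply/idP/idP; rewrite !inE /= in_itv/=; first by move=> [-> ->].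
    by move=> /andP[].
  under eq_integral do rewrite DE EFinM.
  rewrite ge0_integralZl//; first last.
  - by rewrite lee_fin mulr_ge0 ?normal_pdf_ge0.
  - by apply/measurable_EFinP/measurable_indic; exact: measurable_itv.
  rewrite integral_indic//= setIT lebesgue_measure_itv/= lte_fin.
  move: u0; rewrite le_eqVlt => /predU1P[<-|u0].
    by rewrite ltxx mule0 expr0n mul0r.
  by rewrite u0 -EFinB -EFinM subr0 expr2; congr (_%:E); ring.
apply/esym/integral0_eq => x _; rewrite /D indicE memNset ?mulr0//.
by move=> [/= x0 xu]; rewrite mem_set//= in u0; exact: le_trans xu.
Qed.

Lemma gauss_moment2 : (\int[gam]_x (x ^+ 2)%:E = 1)%E.
Proof.
have cphi : continuous phi by apply: continuous_normal_pdf; rewrite oner_neq0.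
have phiN : phi =1 phi \o -%R.
  by move=> x /=; rewrite !normal_pdfE ?oner_neq0// /normal_fun !subr0 sqrrN.
rewrite ge0_integral_normal_prob; last 2 first.
- exact/measurable_EFinP/measurable_funX.
- by move=> x; rewrite lee_fin sqr_ge0.
rewrite -[RHS](integral_normal_pdf 0 1).
rewrite [RHS]ge0_symfun_integralT//; last by move=> x; exact: normal_pdf_ge0.
rewrite -gauss_moment2_half -ge0_symfun_integralT//.
- by move=> x; rewrite mulr_ge0 ?sqr_ge0 ?normal_pdf_ge0.
- by move=> x; apply: cvgM; [exact: exprn_continuous|exact: cphi].
- by move=> x /=; rewrite sqrrN -[phi (- x)]/((phi \o -%R) x) -phiN.
Qed.
End gaussian_moments.

(** * Independence *)

Section independence.
Context {R : realType} {d : measure_display} {T : measurableType d}.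
Context (P : probability T R).
Local Open Scope ereal_scope.

(** The measures A |-> P (A [&] B) and A |-> P A * P B agree on a pi-system containing the whole
    space, hence on the sigma-algebra that it generates. *)
Lemma indep_g_sigma_algebra (G : set_system T) (B : set T) :
  G `<=` measurable -> setI_closed G -> G setT -> measurable B ->
  (forall A, G A -> P (A `&` B) = P A * P B) ->
  forall A, <<s G >> A -> P (A `&` B) = P A * P B.
Proof.
move=> Gm GI GT mB PG A sA.
have PB0 : (0 <= fine (P B))%R by exact: fine_ge0.
pose m2 := mscale (NngNum PB0) P.
have m2E X : m2 X = P X * P B.
  by rewrite /m2 /mscale /= fineK ?fin_num_measure// muleC.
rewrite -m2E.
apply: (g_sigma_algebra_measure_unique G Gm (fun _ : nat => setT) _ _
  (mrestr P mB) m2) => //.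
- by apply/seteqP; split => // x _; exists 0%N.
- by move=> X GX; transitivity (P X * P B); [exact: PG|exact/esym/m2E].
- by move=> k; rewrite /= /mrestr setTI -ge0_fin_numE// fin_num_measure.
Qed.

(** The intersections of one event from each [F j], [j] in [J], form a pi-system generating the
    joint sigma-algebra; on it the product formula is the assumed independence for [J] enlarged by
    [i]. *)
Lemma independent_sigmas_group (I : finType) (F : I -> set_system T)
    (J : {set I}) (i : I) :
  (forall j, sigma_algebra setT (F j) /\ F j `<=` measurable) ->
  independent_sigmas P F -> i \notin J ->
  forall A B, <<s \bigcup_(j in [set` J]) F j >> A -> F i B ->
    P (A `&` B) = P A * P B.
Proof.
move=> Fs indF iJ A B sA FB.
pose C := [set A | exists2 E : I -> set T,
  (forall j, F j (E j)) & A = \bigcap_(j in [set` J]) E j].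
have FT j : F j setT.
  by have [[F0 FC _] _] := Fs j; have := FC _ F0; rewrite setD0.
have FI j : setI_closed (F j).
  move=> X Y FX FY; have [[F0 FC FU] _] := Fs j.
  have FCc Z : F j Z -> F j (~` Z) by move=> /FC; rewrite setTD.
  rewrite -[X `&` Y]setCK setCI; apply: (FCc); rewrite -bigcup2E; apply: FU.
  by case=> [|[|n]] /=; [exact: FCc|exact: FCc|exact: F0].
have Cm : C `<=` measurable.
  move=> _ [E FE ->]; apply: fin_bigcap_measurable => // j _.
  by have [_] := Fs j; exact.
have CI : setI_closed C.
  move=> _ _ [E FE ->] [E' FE' ->]; exists (fun j => E j `&` E' j).
    by move=> j; exact: FI.
  by rewrite bigcapI.
have CT : C setT by exists (fun=> setT) => //; rewrite bigcapT.
have mB : measurable B by have [_] := Fs i; exact.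
suff PC X : C X -> P (X `&` B) = P X * P B.
  apply: (indep_g_sigma_algebra C B Cm CI CT mB PC).
  apply: sub_smallest2r sA => // X [j /= jJ FX].
  exists (fun k => if k == j then X else setT).
    by move=> k; case: eqP => [->|].
  apply/seteqP; split => [x Xx k /= kJ|x]; first by case: eqP.
  by move=> /(_ j jJ); rewrite eqxx.
move=> [E FE ->].
pose E' k := if k == i then B else E k.
have FE' k : F k (E' k) by rewrite /E'; case: eqP => [->|].
have -> : \bigcap_(j in [set` J]) E j `&` B =
    \bigcap_(j in [set` (i |: J)%SET]) E' j.
  apply/seteqP; split => [x [EJ Bx] k /=|x EJ]; last first.
    split => [k /= kJ|]; last first.
      by have := EJ i; rewrite /E' eqxx; apply; rewrite /= finset.setU11.
    have := EJ k; rewrite /E'; case: eqP => [ki|_].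
      by move: iJ; rewrite -ki kJ.
    by apply; rewrite /= finset.setU1r.
  by rewrite finset.in_setU1 /E'; case: eqP => //= _; exact: EJ.
rewrite (indF _ E')// (indF _ E)// finset.big_setU1//= /E' eqxx muleC.
congr (_ * _); apply: eq_bigr => j jJ; case: eqP => // ji.
by move: iJ; rewrite -ji jJ.
Qed.

End independence.

Section independent_fubini.
Context {R : realType} {d : measure_display} {T : measurableType d}.
Context (P : probability T R) (G1 G2 : set_system T).
Hypothesis sub1 : <<s G1 >> `<=` @measurable _ T.
Hypothesis sub2 : <<s G2 >> `<=` @measurable _ T.
Hypothesis ind : forall A B, <<s G1 >> A -> <<s G2 >> B ->
  P (A `&` B) = (P A * P B)%E.
Local Open Scope ereal_scope.

Local Notation T1 := (g_sigma_algebraType G1).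
Local Notation T2 := (g_sigma_algebraType G2).

Lemma measurable_id_g_sigma (G : set_system T) : <<s G >> `<=` @measurable _ T ->
  measurable_fun [set: T] (id : T -> g_sigma_algebraType G).
Proof. by move=> sub _ A mA; rewrite setTI; exact: sub. Qed.

Let m1 : measurable_fun [set: T] (id : T -> T1).
Proof. exact: measurable_id_g_sigma. Qed.
Let m2 : measurable_fun [set: T] (id : T -> T2).
Proof. exact: measurable_id_g_sigma. Qed.

Let i1 : {mfun T >-> T1} := mfun_Sub (mem_set m1).
Let i2 : {mfun T >-> T2} := mfun_Sub (mem_set m2).

(* Under independence the diagonal [w |-> (w, w)] maps [P] to a product
   measure on the product of the two sub-sigma-algebras. *)
Lemma independent_fubini (F : T1 * T2 -> \bar R) :
  measurable_fun setT F -> (forall p, 0 <= F p) ->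
  \int[P]_w F (w, w) = \int[P]_w \int[P]_w' F (w, w').
Proof.
move=> mF F0.
pose P1 : probability T1 R := distribution P i1.
pose P2 : probability T2 R := distribution P i2.
have mdiag : measurable_fun [set: T] ((fun w => (w, w)) : T -> T1 * T2).
  exact: measurable_fun_pair.
pose diag : {mfun T >-> (T1 * T2)%type} := mfun_Sub (mem_set mdiag).
transitivity (\int[distribution P diag]_p F p).
  by rewrite ge0_integral_distribution.
transitivity (\int[P1 \x P2]_p F p).
  apply: eq_measure_integral => A mA _.
  exact/esym/product_measure_unique.
rewrite fubini_tonelli1// ge0_integral_distribution//.
- apply: eq_integral => w _; rewrite /= /fubini_F.
  rewrite ge0_integral_distribution//.
  by apply: measurableT_comp => //; exact: measurable_pair1.
- exact: measurable_fun_fubini_tonelli_F.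
- by move=> w; exact: integral_ge0.
Qed.
End independent_fubini.

(** The integral of a nonnegative function is a supremum over the simple functions below it, which
    makes monotonicity valid for arbitrary functions, in particular for iterated integrals. *)
Lemma le_ge0_integral {d : measure_display} {T : measurableType d}
    {R : realType} (P : {measure set T -> \bar R}) (f1 f2 : T -> \bar R) :
  (forall x, (0 <= f1 x)%E) -> (forall x, (f1 x <= f2 x)%E) ->
  (\int[P]_x f1 x <= \int[P]_x f2 x)%E.
Proof.
move=> f10 f12; rewrite !ge0_integralTE//; last first.
  by move=> x; exact: le_trans (f12 x).
apply: le_ereal_sup => _ [h /= hf <-]; exists h => // x.
exact: le_trans (f12 x).
Qed.

(** * Replacement by normal variables *)

Section replacement.
Context {R : realType} {K : nat} {d : measure_display} {Om : measurableType d}.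
Context (P : probability Om R) (G : option 'I_K -> set_system Om).
Hypothesis HG : forall i, sigma_algebra setT (G i) /\ G i `<=` measurable.
Hypothesis indG : independent_sigmas P G.
Context (Z : 'I_K -> R -> Om -> R) (T : 'I_K -> Om -> R) (B : Om -> R).
Context (v : R -> R).
Hypothesis mZ : forall r, measurable_fun
  [set: measurableTypeR R * g_sigma_algebraType (G (Some r))]
  (fun p => Z r p.1 p.2).
Hypothesis mT : forall r,
  measurable_fun [set: g_sigma_algebraType (G None)] (T r).
Hypothesis mB : measurable_fun [set: g_sigma_algebraType (G None)] B.
Hypothesis mv : measurable_fun [set: R] v.

(** Lindeberg hybrids. At stage [n] the first [n] summands are still present, and the others have
    been replaced by one normal variable whose conditional variance is [hybrid_var n]. Stage [K] is
    the original sum, stage 0 the normal mixture. *)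
Definition hybrid_sum (n : nat) (w : Om) : R :=
  \sum_(r < K) (if (r < n)%N then Z r (T r w) w else 0) + B w.

Definition hybrid_var (n : nat) (w : Om) : R :=
  \sum_(r < K) (if (r < n)%N then 0 else v (T r w)).

(** [H n] generates the information contained in the toll, the indices and the first [n] copies,
    which determines both hybrids at stage [n] and is independent of copy number [n], the next
    one. *)
Let J (n : nat) : {set option 'I_K} :=
  finset.finset (fun i : option 'I_K => if i is Some r then (r < n)%N else true).
Let H n : set_system Om := \bigcup_(j in [set` J n]) G j.

Let sub_sigma n : <<s H n >> `<=` @measurable _ Om.
Proof.
apply: smallest_sub; first exact: sigma_algebra_measurable.
by move=> A [j _ GA]; have [_] := HG j; exact.
Qed.

Let sub_sigmaG i : <<s G i >> `<=` @measurable _ Om.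
Proof.
by apply: smallest_sub; [exact: sigma_algebra_measurable|have [_] := HG i].
Qed.

Let measurable_H_G n i : i \in J n ->
  measurable_fun [set: g_sigma_algebraType (H n)]
    (id : g_sigma_algebraType (H n) -> g_sigma_algebraType (G i)).
Proof.
move=> iJ _ A mA; rewrite setTI.
by apply: sub_smallest2r mA => // X GX; exists i.
Qed.

Let mTH n r : measurable_fun [set: g_sigma_algebraType (H n)] (T r).
Proof.
apply: (measurableT_comp (mT r)).
by apply: measurable_H_G; rewrite finset.in_set.
Qed.

(** Evaluation at a random index is a composition with w |-> (T r w, w); this is where joint
    measurability of the copies is needed. *)
Let mZH n (r : 'I_K) : (r < n)%N ->
  measurable_fun [set: g_sigma_algebraType (H n)] (fun w => Z r (T r w) w).
Proof.
move=> rn; apply: (measurableT_comp (mZ r)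
  (g := (fun w => (T r w, w)) : g_sigma_algebraType (H n) ->
    measurableTypeR R * g_sigma_algebraType (G (Some r)))).
apply: measurable_fun_pair; first exact: mTH.
by apply: measurable_H_G; rewrite finset.in_set.
Qed.

Let mW n : measurable_fun [set: g_sigma_algebraType (H n)] (hybrid_sum n).
Proof.
apply: measurable_funD.
  apply: measurable_sum => r; case: (boolP (r < n)%N) => rn; last exact: measurable_cst.
  exact: mZH.
by apply: (measurableT_comp mB); apply: measurable_H_G; rewrite finset.in_set.
Qed.

Let mV n m : measurable_fun [set: g_sigma_algebraType (H n)] (hybrid_var m).
Proof.
apply: measurable_sum => r; case: (boolP (r < m)%N) => rn; first exact: measurable_cst.
exact: (measurableT_comp mv (mTH n r)).
Qed.

Lemma measurable_hybrid_sum n : measurable_fun [set: Om] (hybrid_sum n).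
Proof. exact: (measurableT_comp (mW n) (measurable_id_g_sigma _ (@sub_sigma n))). Qed.

Lemma measurable_hybrid_var n : measurable_fun [set: Om] (hybrid_var n).
Proof. exact: (measurableT_comp (mV 0 n) (measurable_id_g_sigma _ (@sub_sigma 0))). Qed.

Lemma hybrid_sumS (n : 'I_K) w :
  hybrid_sum n.+1 w = hybrid_sum n w + Z n (T n w) w.
Proof.
rewrite /hybrid_sum [RHS]addrAC; congr (_ + _).
rewrite (bigD1 n)//= ltnSn [in RHS](bigD1 n)//= ltnn add0r addrC.
congr (_ + _); apply: eq_bigr => r rn.
have /negbTE rn' : nat_of_ord r != n := rn.
by rewrite ltnS (leq_eqVlt r n) rn'.
Qed.

Lemma hybrid_varS (n : 'I_K) w :
  hybrid_var n w = hybrid_var n.+1 w + v (T n w).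
Proof.
rewrite /hybrid_var (bigD1 n)//= ltnn [in RHS](bigD1 n)//= ltnSn add0r addrC.
congr (_ + _); apply: eq_bigr => r rn.
have /negbTE rn' : nat_of_ord r != n := rn.
by rewrite ltnS (leq_eqVlt r n) rn'.
Qed.

Lemma hybrid_sum0 w : hybrid_sum 0 w = B w.
Proof. by rewrite /hybrid_sum big1 ?add0r. Qed.

Lemma hybrid_sumK w : hybrid_sum K w = \sum_(r < K) Z r (T r w) w + B w.
Proof.
by rewrite /hybrid_sum; congr (_ + _); apply: eq_bigr => r _; rewrite ltn_ord.
Qed.

Lemma hybrid_var0 w : hybrid_var 0 w = \sum_(r < K) v (T r w).
Proof. by []. Qed.

Lemma hybrid_varK w : hybrid_var K w = 0.
Proof. by rewrite /hybrid_var big1// => r _; rewrite ltn_ord. Qed.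

(** Copy [n] is independent of everything else in the integrand, so it can be integrated over its
    own variable [w'] with the index [T n w] frozen. *)
Lemma hybrid_step (n : 'I_K) (F : R * R -> \bar R) :
  measurable_fun [set: R * R] F -> (forall p, (0 <= F p)%E) ->
  (\int[P]_w F (hybrid_sum n.+1 w, hybrid_var n.+1 w) =
   \int[P]_w \int[P]_w' F ((hybrid_sum n w + Z n (T n w) w')%R, hybrid_var n.+1 w))%E.
Proof.
move=> mF F0.
have ind A C : <<s H n >> A -> <<s G (Some n) >> C ->
    P (A `&` C) = (P A * P C)%E.
  move=> sA; rewrite (sigma_algebra_id (HG (Some n)).1) => GC.
  apply: (independent_sigmas_group P _ G (J n) (Some n)) => //.
  by rewrite finset.in_set ltnn.
pose Phi (p : g_sigma_algebraType (H n) * g_sigma_algebraType (G (Some n))) :=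
  F (hybrid_sum n p.1 + Z n (T n p.1) p.2, hybrid_var n.+1 p.1).
have mPhi : measurable_fun setT Phi.
  apply: measurableT_comp => //; apply: measurable_fun_pair.
    apply: measurable_funD; first exact: (measurableT_comp (mW n)).
    apply: (measurableT_comp (mZ n) (g := (fun p => (T n p.1, p.2)) :
      g_sigma_algebraType (H n) * g_sigma_algebraType (G (Some n)) ->
      measurableTypeR R * g_sigma_algebraType (G (Some n)))).
    apply: measurable_fun_pair => //.
    exact: (measurableT_comp (mTH n n)).
  exact: (measurableT_comp (mV n n.+1)).
rewrite -(independent_fubini P (H n) (G (Some n)) (@sub_sigma n)
  (@sub_sigmaG _) ind Phi)//.
  by apply: eq_integral => w _; rewrite /Phi /= hybrid_sumS.
by move=> p; exact: F0.
Qed.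

Lemma measurable_hybrid_integral n (F : R * R -> \bar R) :
  measurable_fun [set: R * R] F ->
  measurable_fun [set: Om] (fun w => F (hybrid_sum n w, hybrid_var n w)).
Proof.
move=> mF; apply: (measurableT_comp mF); apply: measurable_fun_pair.
  exact: measurable_hybrid_sum.
exact: measurable_hybrid_var.
Qed.

(** [delta r w] is the price of replacing copy [r] when its index is the one drawn at [w]. Passing
    from stage [n.+1] to stage [n] costs the mean of [delta n], and the costs add up. *)
Lemma hybrid_le (F : R * R -> \bar R) (delta : 'I_K -> Om -> \bar R) :
  measurable_fun [set: R * R] F -> (forall p, (0 <= F p)%E) ->
  (forall r, measurable_fun [set: Om] (delta r)) ->
  (forall r w, (0 <= delta r w)%E) ->
  (forall r w x y, 0 <= y ->
    (\int[P]_w' F ((x + Z r (T r w) w')%R, y) <=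
     F (x, (y + v (T r w))%R) + delta r w)%E) ->
  (forall u, 0 <= v u) ->
  (\int[P]_w F ((\sum_(r < K) Z r (T r w) w + B w)%R, 0%R) <=
   \int[P]_w F (B w, (\sum_(r < K) v (T r w))%R) +
   \sum_(r < K) \int[P]_w delta r w)%E.
Proof.
move=> mF F0 mdelta delta0 Fdelta v0.
have mFh n := measurable_hybrid_integral n F mF.
have var0 n w : 0 <= hybrid_var n w.
  by apply: sumr_ge0 => r _; case: ifP.
have step (n : 'I_K) :
  (\int[P]_w F (hybrid_sum n.+1 w, hybrid_var n.+1 w) <=
   \int[P]_w F (hybrid_sum n w, hybrid_var n w) + \int[P]_w delta n w)%E.
  rewrite hybrid_step// -ge0_integralD//.
  apply: le_ge0_integral => w; first exact: integral_ge0.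
  by rewrite hybrid_varS; exact: Fdelta.
have H' (n : nat) : (n <= K)%N ->
  (\int[P]_w F (hybrid_sum n w, hybrid_var n w) <=
   \int[P]_w F (hybrid_sum 0 w, hybrid_var 0 w) +
   \sum_(r < K | (r < n)%N) \int[P]_w delta r w)%E.
  elim: n => [_|n IHn nK]; first by rewrite big_pred0 ?adde0.
  apply: (le_trans (step (Ordinal nK))).
  rewrite [leRHS](_ : _ = (\int[P]_w F (hybrid_sum 0 w, hybrid_var 0 w) +
    \sum_(r < K | (r < n)%N) \int[P]_w delta r w) +
    \int[P]_w delta (Ordinal nK) w)%E; last first.
    rewrite -addeA; congr (_ + _)%E; rewrite addeC (bigD1 (Ordinal nK))//=.
    congr (_ + _)%E; apply: eq_bigl => r.
    by rewrite ltnS -val_eqE /= ltn_neqAle andbC.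
  by apply: leeD => //; exact: IHn (ltnW nK).
have := H' K (leqnn K).
under eq_integral do rewrite hybrid_sumK hybrid_varK.
under [X in (_ <= X + _)%E -> _]eq_integral do rewrite hybrid_sum0 hybrid_var0.
by under [X in (_ <= _ + X)%E -> _]eq_bigl do rewrite ltn_ord.
Qed.

(** The case of free replacement: it serves for quadratic functions, which see only the mean and the
    variance of each copy. *)
Lemma hybrid_eq (F : R * R -> \bar R) :
  measurable_fun [set: R * R] F -> (forall p, (0 <= F p)%E) ->
  (forall r w x y, 0 <= y ->
    (\int[P]_w' F ((x + Z r (T r w) w')%R, y) = F (x, (y + v (T r w))%R))%E) ->
  (forall u, 0 <= v u) ->
  (\int[P]_w F ((\sum_(r < K) Z r (T r w) w + B w)%R, 0%R) =
   \int[P]_w F (B w, (\sum_(r < K) v (T r w))%R))%E.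
Proof.
move=> mF F0 FE v0.
have var0 n w : 0 <= hybrid_var n w.
  by apply: sumr_ge0 => r _; case: ifP.
have H' (n : nat) : (n <= K)%N ->
  (\int[P]_w F (hybrid_sum n w, hybrid_var n w) =
   \int[P]_w F (hybrid_sum 0 w, hybrid_var 0 w))%E.
  elim: n => // n IHn nK; rewrite -IHn; last exact: ltnW.
  rewrite (hybrid_step (Ordinal nK))//; apply: eq_integral => w _.
  by rewrite (hybrid_varS (Ordinal nK)) FE.
have := H' K (leqnn K).
under eq_integral do rewrite hybrid_sumK hybrid_varK.
by under [X in _ = X -> _]eq_integral do rewrite hybrid_sum0 hybrid_var0.
Qed.
End replacement.

(** * Test functions *)

(** [h1 x] and [h2 x] stand for h'(x) and h''(x)/2. Two increments are compared with each other
    rather than each with 0, because the factor |z - y| makes the bound small for nearby increments;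
    y = 0 gives the usual remainder estimate. *)
Definition taylor2 {R : realType} (s : R) (h h1 h2 : R -> R) : Prop :=
  forall x y z : R,
    `|h (x + z) - h (x + y) - h1 x * (z - y) - h2 x * (z ^+ 2 - y ^+ 2)| <=
    (`|y| + `|z|) `^ (s - 1) * `|z - y|.

(* The test functions of the Zolotarev distance of order [s], [2 < s <= 3]:
   for a C^2 function, [taylor2] amounts, up to a factor, to the second
   derivative [2 * h2] being (s - 2)-Hoelder. *)
Definition zclass {R : realType} (s : R) (h : R -> R) : Prop :=
  [/\ continuous h, exists M : R, forall x, 0 <= h x <= M &
      exists h1 h2 : R -> R, taylor2 s h h1 h2].

Section zclass.
Context {R : realType}.
Implicit Types (s : R) (h : R -> R).

Lemma zclass_shift s h (c : R) : zclass s h -> zclass s (fun x => h (c + x)).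
Proof.
move=> [ch [M hM] [h1 [h2 hT]]]; split.
- rewrite (_ : (fun _ => _) = fun x => h (1 * x + c)).
    exact: continuous_comp_affine.
  by apply/funext => x; rewrite mul1r addrC.
- by exists M => x; exact: hM.
- exists (fun x => h1 (c + x)), (fun x => h2 (c + x)) => x y z.
  by rewrite !addrA; exact: hT.
Qed.

(** The bound in [taylor2] is homogeneous of degree [s] in the increments. This homogeneity turns
    estimates at unit scale into errors proportional to g(t)^(s/2). *)
Lemma zclass_scale s h (a : R) : 0 < a ->
  zclass s h -> zclass s (fun x => a `^ s * h (a^-1 * x)).
Proof.
move=> a0 [ch [M hM] [h1 [h2 hT]]]; split.
- have ch' : continuous (fun x => h (a^-1 * x)).
    rewrite (_ : (fun _ => _) = fun x => h (a^-1 * x + 0)).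
      exact: continuous_comp_affine.
    by apply/funext => x; rewrite addr0.
  by move=> x; apply: cvgM; [exact: cvg_cst|exact: ch'].
- exists (a `^ s * M) => x; have /andP[hx0 hxM] := hM (a^-1 * x).
  by rewrite mulr_ge0 ?powR_ge0//= ler_wpM2l ?powR_ge0.
- exists (fun x => a `^ s * h1 (a^-1 * x) * a^-1),
    (fun x => a `^ s * h2 (a^-1 * x) * a^-1 ^+ 2) => x y z.
  have an0 : a != 0 by rewrite gt_eqF.
  rewrite [leLHS](_ : _ = a `^ s * `|h (a^-1 * x + a^-1 * z) -
    h (a^-1 * x + a^-1 * y) - h1 (a^-1 * x) * (a^-1 * z - a^-1 * y) -
    h2 (a^-1 * x) * ((a^-1 * z) ^+ 2 - (a^-1 * y) ^+ 2)|); last first.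
    rewrite -[X in X * `|_|]ger0_norm ?powR_ge0// -normrM; congr `|_|.
    by rewrite !mulrDr; ring.
  apply: (le_trans (ler_wpM2l (powR_ge0 _ _) (hT _ _ _))).
  have ai0 : 0 <= a^-1 by rewrite invr_ge0 ltW.
  rewrite -mulrBr !normrM -mulrDr (ger0_norm ai0) powRM ?addr_ge0//.
  have aE : a^-1 = a `^ (-1) by rewrite powR_inv1// ltW.
  rewrite {1}aE -powRrM mulN1r {1}aE.
  rewrite [leLHS](_ : _ = (a `^ s * a `^ (- (s - 1)) * a `^ (-1)) *
    ((`|y| + `|z|) `^ (s - 1) * `|z - y|)); last by ring.
  rewrite -!powRD ?an0 ?implybT//.
  by rewrite (_ : s - (s - 1) - 1 = 0) ?powRr0 ?mul1r//; ring.
Qed.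

Lemma zclass_compl s h (M : R) : (forall x, h x <= M) ->
  zclass s h -> zclass s (fun x => M - h x).
Proof.
move=> hM [ch [M' hM'] [h1 [h2 hT]]]; split.
- by move=> x; apply: cvgB; [exact: cvg_cst|exact: ch].
- exists M => x; rewrite subr_ge0 hM/= lerBlDr lerDl.
  by have /andP[] := hM' x.
- exists (fun x => - h1 x), (fun x => - h2 x) => x y z.
  rewrite -normrN; apply: le_trans (hT x y z); rewrite le_eqVlt; apply/orP; left.
  by apply/eqP; congr `|_|; ring.
Qed.

Lemma zclass_measurable s h : zclass s h -> measurable_fun [set: R] h.
Proof. by case=> ch _ _; exact: continuous_measurable_fun. Qed.

Lemma zclass_ge0 s h x : zclass s h -> 0 <= h x.
Proof. by case=> _ [M hM] _; have /andP[] := hM x. Qed.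

Lemma taylor2_0 s h h1 h2 x : 1 < s -> taylor2 s h h1 h2 ->
  `|h x - h 0 - h1 0 * x - h2 0 * x ^+ 2| <= `|x| `^ s.
Proof.
move=> s1 /(_ 0 0 x); rewrite !add0r subr0 expr0n subr0 normr0 add0r.
move=> /le_trans; apply; rewrite le_eqVlt; apply/orP; left; apply/eqP.
rewrite -[in LHS](@powRr1 _ `|x| (normr_ge0 _)).
have [->|x0] := eqVneq x 0.
  by rewrite normr0 !powR0 ?mulr0//; lra.
rewrite powRr1// -[X in _ * X = _](@powRr1 _ `|x|)// -powRD; last first.
  by rewrite normr_eq0 x0 implybT.
by rewrite subrK.
Qed.
End zclass.

Lemma le_integrable_real {R : realType} {d : measure_display}
    {T : measurableType d} (P : {measure set T -> \bar R}) (f g : T -> R) :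
  measurable_fun [set: T] f -> (forall x, `|f x| <= g x) ->
  P.-integrable [set: T] (EFin \o g) -> P.-integrable [set: T] (EFin \o f).
Proof.
move=> mf fg; apply: le_integrable => //; first exact/measurable_EFinP.
by move=> x _; rewrite /= lee_fin (le_trans (fg x))// ler_norm.
Qed.

Section real_integrable.
Context {R : realType} {d : measure_display} {T : measurableType d}.
Context (P : {measure set T -> \bar R}).
Implicit Types f g : T -> R.

Lemma integrable_realD f g : P.-integrable [set: T] (EFin \o f) ->
  P.-integrable [set: T] (EFin \o g) ->
  P.-integrable [set: T] (EFin \o (fun x => f x + g x)).
Proof.
move=> fi gi; apply: eq_integrable (integrableD measurableT fi gi) => //.
Qed.

Lemma integrable_realB f g : P.-integrable [set: T] (EFin \o f) ->
  P.-integrable [set: T] (EFin \o g) ->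
  P.-integrable [set: T] (EFin \o (fun x => f x - g x)).
Proof.
move=> fi gi; apply: eq_integrable (integrableB measurableT fi gi) => //.
Qed.

Lemma integrable_realZl f (k : R) : P.-integrable [set: T] (EFin \o f) ->
  P.-integrable [set: T] (EFin \o (fun x => k * f x)).
Proof.
by move=> fi; apply: eq_integrable (integrableZl measurableT k fi).
Qed.
End real_integrable.

Section expectation_bounds.
Context {R : realType} {d : measure_display} {T : measurableType d}.
Context (P : probability T R).

Lemma integrable_cst_prob (c : R) : P.-integrable [set: T] (EFin \o cst c).
Proof. exact: finite_measure_integrable_cst. Qed.

Lemma Rintegral_cst_prob (c : R) : \int[P]_(_ in [set: T]) c = c.
Proof. by rewrite Rintegral_cst//= probability_setT mulr1. Qed.

Lemma integrable_bounded (f : T -> R) (M : R) : measurable_fun [set: T] f ->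
  (forall x, `|f x| <= M) -> P.-integrable [set: T] (EFin \o f).
Proof.
by move=> mf fM; apply: le_integrable_real mf fM _; exact: integrable_cst_prob.
Qed.

(** The linear Taylor term integrates to 0 and the quadratic one to [h2 0 * a]. Hence two centered
    laws with equal variance have means of [h] differing by at most the sum of their absolute
    moments of order [s]. *)
Lemma taylor2_mean (s : R) (h h1 h2 : R -> R) (M a : R) (X : T -> R) :
  1 < s -> taylor2 s h h1 h2 -> continuous h -> (forall x, 0 <= h x <= M) ->
  P.-integrable [set: T] (EFin \o X) ->
  P.-integrable [set: T] (EFin \o (fun w => X w ^+ 2)) ->
  P.-integrable [set: T] (EFin \o (fun w => `|X w| `^ s)) ->
  \int[P]_w X w = 0 -> \int[P]_w (X w ^+ 2) = a ->
  `|\int[P]_w h (X w) - (h 0 + h2 0 * a)| <= \int[P]_w (`|X w| `^ s).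
Proof.
move=> s1 hT ch hM iX iX2 iXs X0 X2.
have mX : measurable_fun [set: T] X by apply/measurable_EFinP; case/integrableP: iX.
have mh : measurable_fun [set: R] h by exact: continuous_measurable_fun.
have ihX : P.-integrable [set: T] (EFin \o (fun w => h (X w))).
  apply: (@integrable_bounded _ M); first exact: measurableT_comp.
  by move=> w; rewrite ger0_norm//; have /andP[] := hM (X w).
have i1 : P.-integrable [set: T] (EFin \o (fun w => h1 0 * X w)).
  exact: integrable_realZl.
have i2 : P.-integrable [set: T] (EFin \o (fun w => h2 0 * X w ^+ 2)).
  exact: integrable_realZl.
have i3 : P.-integrable [set: T] (EFin \o (fun w => h (X w) - h 0)).
  by apply: integrable_realB => //; exact: integrable_cst_prob.
have i4 : P.-integrable [set: T] (EFin \o (fun w => h (X w) - h 0 - h1 0 * X w)).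
  exact: integrable_realB.
have i5 : P.-integrable [set: T]
    (EFin \o (fun w => h (X w) - h 0 - h1 0 * X w - h2 0 * X w ^+ 2)).
  exact: integrable_realB.
rewrite [X in `|X|](_ : _ = \int[P]_w
    (h (X w) - h 0 - h1 0 * X w - h2 0 * X w ^+ 2)); last first.
  rewrite RintegralB// RintegralB// RintegralB//; last exact: integrable_cst_prob.
  by rewrite RintegralZl// RintegralZl// X0 X2 Rintegral_cst_prob; ring.
apply: (le_trans (le_normr_Rintegral _ i5)) => //.
apply: le_Rintegral => //; first exact: integrable_norm.
by move=> w _; exact: (taylor2_0 _ _ h1 h2).
Qed.
End expectation_bounds.

Section gaussian_real.
Context {R : realType}.
Local Notation gam := (normal_prob (0 : R) 1).

(** A single constant dominating all absolute moments of order at most 3 of the normal law, so that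
    [s] need not appear in it. *)
Definition gauss3 : R := \int[gam]_x ((1 + `|x|) ^+ 3).

Lemma integrable_gauss3 : gam.-integrable [set: R]
  (EFin \o (fun x : R => (1 + `|x|) ^+ 3)).
Proof.
apply/integrableP; split.
  apply/measurable_EFinP; apply: measurable_funX.
  by apply: measurable_funD => //; exact: normr_measurable.
under eq_integral do rewrite /= ger0_norm ?exprn_ge0 ?addr_ge0//.
by apply: (le_lt_trans gauss_moment3); rewrite ltry.
Qed.

Lemma gauss3_ge0 : 0 <= gauss3.
Proof. by apply: Rintegral_ge0 => x _; rewrite exprn_ge0// addr_ge0. Qed.

Lemma le_gauss3 (x : R) : [/\ `|x| <= (1 + `|x|) ^+ 3,
  x ^+ 2 <= (1 + `|x|) ^+ 3 & 1 <= (1 + `|x|) ^+ 3].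
Proof.
rewrite -[x ^+ 2]real_normK ?num_real//; have := normr_ge0 x.
by set a := `|x| => a0; split; nra.
Qed.

Lemma powR_le_gauss3 (s x : R) : 0 <= s -> s <= 3 ->
  `|x| `^ s <= (1 + `|x|) ^+ 3.
Proof.
move=> s0 s3; apply: (@le_trans _ _ ((1 + `|x|) `^ s)).
  by apply: ge0_ler_powR; rewrite ?nnegrE ?addr_ge0// lerDr.
by rewrite -powR_mulrn ?addr_ge0//; apply: ler_powR => //; rewrite lerDl.
Qed.

Lemma integrable_gauss_id : gam.-integrable [set: R] (EFin \o (fun x : R => x)).
Proof.
by apply: le_integrable_real integrable_gauss3 => // x; have [] := le_gauss3 x.
Qed.

Lemma integrable_gauss_sqr :
  gam.-integrable [set: R] (EFin \o (fun x : R => x ^+ 2)).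
Proof.
apply: le_integrable_real integrable_gauss3 => [|x]; first exact: measurable_funX.
by rewrite ger0_norm ?sqr_ge0//; have [] := le_gauss3 x.
Qed.

Lemma measurable_abs_powR {d : measure_display} {T : measurableType d}
  (s : R) (X : T -> R) :
  measurable_fun [set: T] X -> measurable_fun [set: T] (fun x => `|X x| `^ s).
Proof.
move=> mX; apply: (measurableT_comp (measurable_powR s)).
by apply: measurableT_comp mX; exact: normr_measurable.
Qed.

Lemma integrable_gauss_powR (s : R) : 0 <= s -> s <= 3 ->
  gam.-integrable [set: R] (EFin \o (fun x : R => `|x| `^ s)).
Proof.
move=> s0 s3; apply: le_integrable_real integrable_gauss3 => [|x].
  exact: measurable_abs_powR.
by rewrite ger0_norm ?powR_ge0// powR_le_gauss3.
Qed.

(** Reflection is applied to the nonnegative function |x| + x, which it turns into |x| - x. *)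
Lemma Rintegral_gauss_id : \int[gam]_x x = 0 :> R.
Proof.
have iN : gam.-integrable [set: R] (EFin \o (fun x : R => `|x|)).
  exact: integrable_norm integrable_gauss_id.
have iX := integrable_gauss_id.
have E : \int[gam]_x (`|x| - x) = \int[gam]_x (`|x| + x).
  have m : measurable_fun [set: R] (fun x : R => `|x| + x).
    by apply: measurable_funD; [exact: normr_measurable|exact: measurable_id].
  congr fine; rewrite -[RHS](gauss_sym (fun x => (`|x| + x)%:E)).
  - by apply: eq_integral => x _; rewrite normrN.
  - exact/measurable_EFinP.
  - by move=> x; rewrite lee_fin -lerBlDr sub0r -normrN ler_norm.
move: E; rewrite RintegralB// RintegralD//; lra.
Qed.

Lemma Rintegral_gauss_sqr : \int[gam]_x (x ^+ 2) = 1 :> R.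
Proof. by rewrite /Rintegral gauss_moment2. Qed.
End gaussian_real.

(** * Comparison of a normal mixture with a normal law *)

Section gaussian_comparison.
Context {R : realType}.
Local Notation gam := (normal_prob (0 : R) 1).

Lemma powR_le4 (s x : R) : 2 < s -> s <= 3 -> 0 <= x -> x <= 2 ->
  x `^ (s - 1) <= 4.
Proof.
move=> s2 s3 x0 x2; apply: (@le_trans _ _ (2 `^ (s - 1))).
  by apply: ge0_ler_powR; rewrite ?nnegrE//; lra.
apply: (@le_trans _ _ (2 `^ 2%:R)); first by apply: ler_powR; lra.
by rewrite powR_mulrn//; lra.
Qed.

Lemma powRS (s x : R) : 0 <= x -> 1 < s -> x `^ (s - 1) * x = x `^ s.
Proof.
move=> x0 s1; have [->|xn0] := eqVneq x 0; first by rewrite mulr0 powR0//; lra.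
by rewrite -[X in _ * X = _]powRr1// -powRD ?subrK// xn0 implybT.
Qed.

(** Replaces a product by a bound linear in [e] and [b ^ s], whose means are the quantities under
    control, at the price of the free error [4 * rho]. The three regimes are b <= rho, rho < b <= 1
    and b > 1; in the last one 1 + b <= 2b and e + b <= (2c + 1) b. *)
Lemma powR_mix (s rho c e b : R) : 2 < s -> s <= 3 -> 0 < rho -> 1 <= c ->
  0 <= e -> e <= 2 * c -> 0 <= b ->
  (1 + b) `^ (s - 1) * (e + b) <=
  4 * e + 4 * rho + (4 * rho `^ (- s) + 8 * c + 4) * b `^ s.
Proof.
move=> s2 s3 rho0 c1 e0 ec b0.
have rs0 : 0 <= rho `^ (- s) by exact: powR_ge0.
have bs0 : 0 <= b `^ s by exact: powR_ge0.
have rb0 := mulr_ge0 rs0 bs0.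
have [b1|b1] := leP b 1.
  have p4 : (1 + b) `^ (s - 1) <= 4 by apply: powR_le4 => //; lra.
  have p0 : 0 <= (1 + b) `^ (s - 1) by exact: powR_ge0.
  have {p4} : (1 + b) `^ (s - 1) * (e + b) <= 4 * (e + b).
    by rewrite ler_wpM2r// addr_ge0.
  move=> /le_trans; apply.
  have [br|br] := leP b rho; first by nra.
  (* In the regime rho < b <= 1 the bounded quantity is paid for by (b / rho)^s >= 1. *)
  have : 1 <= rho `^ (- s) * b `^ s.
    rewrite powRN mulrC -(ler_pdivrMr _ _ (_ : 0 < _)) ?invr_gt0 ?powR_gt0//.
    rewrite invrK mul1r; apply: ge0_ler_powR; rewrite ?nnegrE ?ltW//; lra.
  nra.
have p4 : (1 + b) `^ (s - 1) <= 4 * b `^ (s - 1).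
  apply: (@le_trans _ _ ((2 * b) `^ (s - 1))).
    by apply: ge0_ler_powR; rewrite ?nnegrE//; lra.
  rewrite powRM//; apply: ler_wpM2r; first exact: powR_ge0.
  exact: powR_le4.
have p0 : 0 <= b `^ (s - 1) by exact: powR_ge0.
apply: (@le_trans _ _ (4 * b `^ (s - 1) * ((2 * c + 1) * b))).
  by apply: ler_pM => //; [exact: powR_ge0|exact: addr_ge0|nra].
rewrite mulrACA mulrA -mulrA (_ : b `^ (s - 1) * b = b `^ s); last first.
  by apply: powRS => //; lra.
nra.
Qed.

(** Both roots are compared with 1: for y >= 0, |y^2 - 1| = |y - 1| (y + 1) is at least |y - 1|. *)
Lemma sqrt_dist_le (v x : R) : 0 <= v -> 0 <= x ->
  `|Num.sqrt v - x| <= `|v - 1| + `|x ^+ 2 - 1|.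
Proof.
move=> v0 x0; set r := Num.sqrt v; have r0 : 0 <= r by exact: sqrtr_ge0.
have -> : v = r ^+ 2 by rewrite sqr_sqrtr.
have H (y : R) : 0 <= y -> `|y - 1| <= `|y ^+ 2 - 1|.
  move=> y0; rewrite (_ : y ^+ 2 - 1 = (y - 1) * (y + 1)); last by ring.
  by rewrite normrM ler_peMr// ger0_norm ?addr_ge0// lerDr.
have -> : r - x = (r - 1) - (x - 1) by ring.
by apply: (le_trans (ler_normB _ _)); apply: lerD; exact: H.
Qed.

(** [taylor2] at base point 0 with the increments x N and b + v N, integrated over the normal
    variable N. The first and second order terms are kept explicit, as they cancel only after
    averaging over the random [b] and [v]. *)
Lemma taylor2_gauss (s : R) (h h1 h2 : R -> R) (M b v x c : R) :
  2 < s -> s <= 3 -> taylor2 s h h1 h2 -> continuous h ->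
  (forall x, 0 <= h x <= M) -> 1 <= c -> 0 <= v -> v <= c -> 0 <= x -> x <= c ->
  \int[gam]_y h (b + v * y) <= \int[gam]_y h (x * y) +
    4 * c ^+ 2 * gauss3 * ((1 + `|b|) `^ (s - 1) * (`|v - x| + `|b|)) +
    h1 0 * b + h2 0 * (b ^+ 2 + v ^+ 2 - x ^+ 2).
Proof.
move=> s2 s3 hT ch hM c1 v0 vc x0 xc.
set k := 4 * c ^+ 2 * ((1 + `|b|) `^ (s - 1) * (`|v - x| + `|b|)).
have k0 : 0 <= k.
  by rewrite !mulr_ge0 ?exprn_ge0 ?powR_ge0 ?addr_ge0//; lra.
(* Coefficients, in powers of the normal variable, of the Taylor polynomial for the pair of
   increments. Under the normal law the powers 0, 1, 2 have means 1, 0, 1, so [a1] disappears. *)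
pose a0 := h1 0 * b + h2 0 * b ^+ 2.
pose a1 := h1 0 * (v - x) + 2 * h2 0 * b * v.
pose a2 := h2 0 * (v ^+ 2 - x ^+ 2).
pose f (y : R) := h (b + v * y) - h (x * y) - (a0 + a1 * y + a2 * y ^+ 2).
have ih (u w : R) : gam.-integrable [set: R] (EFin \o (fun y : R => h (u + w * y))).
  apply: (@integrable_bounded _ _ _ _ _ M).
    apply: continuous_measurable_fun.
    rewrite (_ : (fun _ => _) = fun y => h (w * y + u)).
      exact: continuous_comp_affine.
    by apply/funext => y; rewrite addrC.
  by move=> y; rewrite ger0_norm//; have /andP[] := hM (u + w * y).
have ih0 : gam.-integrable [set: R] (EFin \o (fun y : R => h (x * y))).
  by apply: eq_integrable (ih 0 x) => // y _ /=; rewrite add0r.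
have iq : gam.-integrable [set: R]
    (EFin \o (fun y : R => a0 + a1 * y + a2 * y ^+ 2)).
  apply: integrable_realD.
    apply: integrable_realD; first exact: integrable_cst_prob.
    exact: integrable_realZl integrable_gauss_id.
  exact: integrable_realZl integrable_gauss_sqr.
have id_ : gam.-integrable [set: R]
    (EFin \o (fun y : R => h (b + v * y) - h (x * y))).
  exact: integrable_realB.
have fE : \int[gam]_y f y = \int[gam]_y h (b + v * y) - \int[gam]_y h (x * y)
    - (h1 0 * b + h2 0 * (b ^+ 2 + v ^+ 2 - x ^+ 2)).
  rewrite /f RintegralB// RintegralB//; congr (_ - _).
  rewrite RintegralD//; last 2 first.
  - apply: integrable_realD; first exact: integrable_cst_prob.
    exact: integrable_realZl integrable_gauss_id.
  - exact: integrable_realZl integrable_gauss_sqr.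
  rewrite RintegralD//; last 2 first.
  - exact: integrable_cst_prob.
  - exact: integrable_realZl integrable_gauss_id.
  rewrite RintegralZl//; last exact: integrable_gauss_id.
  rewrite RintegralZl//; last exact: integrable_gauss_sqr.
  rewrite Rintegral_cst_prob Rintegral_gauss_id Rintegral_gauss_sqr.
  by rewrite /a0 /a1 /a2; ring.
suff : \int[gam]_y f y <= k * gauss3.
  by rewrite fE /k; lra.
rewrite /gauss3 -RintegralZl//; last exact: integrable_gauss3.
apply: le_Rintegral => //.
- exact: integrable_realB.
- exact: integrable_realZl integrable_gauss3.
move=> y _; rewrite -/(f y); apply: (le_trans (ler_norm _)).
have := hT 0 (x * y) (b + v * y); rewrite !add0r => hTy.
have -> : f y = h (b + v * y) - h (x * y) - h1 0 * (b + v * y - x * y) -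
    h2 0 * ((b + v * y) ^+ 2 - (x * y) ^+ 2).
  by rewrite /f /a0 /a1 /a2; ring.
apply: (le_trans hTy).
set n := `|y|; have n0 : 0 <= n by exact: normr_ge0.
set B := `|b|; have B0 : 0 <= B by exact: normr_ge0.
have A1 : `|x * y| + `|b + v * y| <= (2 * c) * ((1 + B) * (1 + n)).
  have := ler_normD b (v * y); rewrite !normrM (ger0_norm x0) (ger0_norm v0).
  rewrite -/n -/B => A1.
  have : x * n <= c * n by exact: ler_wpM2r.
  have : v * n <= c * n by exact: ler_wpM2r.
  have : 0 <= c * B by rewrite mulr_ge0//; lra.
  have : 0 <= c * B * n by rewrite !mulr_ge0//; lra.
  have : 0 <= (c - 1) * B by rewrite mulr_ge0//; lra.
  nra.
have A2 : `|b + v * y - x * y| <= (`|v - x| + B) * (1 + n).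
  have -> : b + v * y - x * y = b + (v - x) * y by ring.
  have := ler_normD b ((v - x) * y); rewrite normrM -/n -/B.
  have := normr_ge0 (v - x); nra.
have c20 : 0 <= 2 * c by lra.
apply: (@le_trans _ _ (((2 * c) * ((1 + B) * (1 + n))) `^ (s - 1) *
    ((`|v - x| + B) * (1 + n)))).
  apply: ler_pM => //.
  have s10 : 0 <= s - 1 by lra.
  apply: ge0_ler_powR => //; rewrite nnegrE.
    exact: addr_ge0.
  by rewrite !mulr_ge0//; lra.
have B1 : 0 <= 1 + B by lra.
have n1 : 0 <= 1 + n by lra.
rewrite (powRM _ c20 (mulr_ge0 B1 n1)) (powRM _ B1 n1).
have A3 (z : R) : 1 <= z -> z `^ (s - 1) <= z ^+ 2.
  move=> z1; rewrite -powR_mulrn; last lra.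
  by apply: ler_powR => //; lra.
have A4 : (2 * c) `^ (s - 1) <= 4 * c ^+ 2.
  apply: (le_trans (A3 _ _)); first lra.
  by rewrite exprMn; lra.
have A5 : (1 + n) `^ (s - 1) <= (1 + n) ^+ 2 by apply: A3; lra.
rewrite /k -/B.
rewrite [leRHS](_ : _ = (4 * c ^+ 2) * ((1 + B) `^ (s - 1) * (1 + n) ^+ 2) *
  ((`|v - x| + B) * (1 + n))); last by ring.
apply: ler_wpM2r; first by rewrite mulr_ge0 ?addr_ge0.
apply: ler_pM; [exact: powR_ge0|by rewrite mulr_ge0 ?powR_ge0|exact: A4|].
by apply: ler_wpM2l; [exact: powR_ge0|exact: A5].
Qed.

Context {d : measure_display} {T : measurableType d} (P : probability T R).

(* The linear and quadratic Taylor terms cancel by the moment hypotheses. *)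
Lemma gaussian_comparison (s c rho x : R) (h : R -> R) (V B : T -> R) :
  2 < s -> s <= 3 -> zclass s h -> 1 <= c -> 0 < rho ->
  measurable_fun [set: T] V -> (forall w, 0 <= V w <= c ^+ 2) ->
  measurable_fun [set: T] B ->
  P.-integrable [set: T] (EFin \o (fun w => `|B w| `^ s)) ->
  0 <= x -> x <= c -> \int[P]_w B w = 0 ->
  \int[P]_w V w + \int[P]_w (B w ^+ 2) = x ^+ 2 ->
  (\int[P]_w \int[gam]_y (h (B w + Num.sqrt (V w) * y)%R)%:E <=
   \int[gam]_y (h (x * y)%R)%:E +
   (4 * c ^+ 2 * gauss3 * (4 * (\int[P]_w `|V w - 1| + `|x ^+ 2 - 1|) +
     4 * rho + (4 * rho `^ (- s) + 8 * c + 4) * \int[P]_w (`|B w| `^ s)))%:E)%E.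
Proof.
move=> s2 s3 [ch [M hM] [h1 [h2 hT]]] c1 rho0 mV V0 mB iBs x0 xc B0 VB.
have Bpow (b : R) : `|b| <= 1 + `|b| `^ s /\ b ^+ 2 <= 1 + `|b| `^ s.
  rewrite -[b ^+ 2]real_normK ?num_real//.
  set a := `|b|; have a0 : 0 <= a by exact: normr_ge0.
  have as0 : 0 <= a `^ s by exact: powR_ge0.
  have [a1|a1] := leP a 1; first by split; nra.
  have E : a ^+ 2 <= a `^ s.
    by rewrite -powR_mulrn//; apply: ler_powR; lra.
  by split; nra.
have i1s : P.-integrable [set: T] (EFin \o (fun w => 1 + `|B w| `^ s)).
  by apply: integrable_realD => //; exact: integrable_cst_prob.
have iB : P.-integrable [set: T] (EFin \o B).
  by apply: le_integrable_real i1s => // w; have [] := Bpow (B w).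
have iB2 : P.-integrable [set: T] (EFin \o (fun w => B w ^+ 2)).
  apply: le_integrable_real i1s => [|w]; first exact: measurable_funX.
  by rewrite ger0_norm ?sqr_ge0//; have [] := Bpow (B w).
have iV : P.-integrable [set: T] (EFin \o V).
  apply: (integrable_bounded P V (c ^+ 2) mV) => w.
  by have /andP[V1 V2] := V0 w; rewrite ger0_norm.
have iV1 : P.-integrable [set: T] (EFin \o (fun w => `|V w - 1|)).
  have : P.-integrable [set: T] (EFin \o (fun w => V w - 1)).
    by apply: integrable_realB => //; exact: integrable_cst_prob.
  exact: integrable_norm.
pose L := 4 * rho `^ (- s) + 8 * c + 4.
pose k := 4 * c ^+ 2 * gauss3 : R.
have k0 : 0 <= k by rewrite !mulr_ge0 ?gauss3_ge0 ?exprn_ge0//; lra.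
pose I := \int[gam]_y h (x * y).
pose e := `|x ^+ 2 - 1|.
(* Pointwise majorant in [w] after [powR_mix]: each term is integrable, and the last two have mean
   zero by the moment hypotheses. *)
pose D (w : T) := (I + k * (4 * e + 4 * rho)) + (k * 4) * `|V w - 1| +
  (k * L) * `|B w| `^ s + h1 0 * B w + h2 0 * (B w ^+ 2 + V w - x ^+ 2).
have ih (u w : R) : gam.-integrable [set: R] (EFin \o (fun y : R => h (u + w * y))).
  apply: (@integrable_bounded _ _ _ _ _ M).
    apply: continuous_measurable_fun.
    rewrite (_ : (fun _ => _) = fun y => h (w * y + u)).
      exact: continuous_comp_affine.
    by apply/funext => y; rewrite addrC.
  by move=> y; rewrite ger0_norm//; have /andP[] := hM (u + w * y).
have hD w : \int[gam]_y h (B w + Num.sqrt (V w) * y) <= D w.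
  have /andP[V1 V2] := V0 w.
  have sV : Num.sqrt (V w) <= c.
    rewrite -(ger0_norm (_ : 0 <= c)); last lra.
    by rewrite -sqrtr_sqr ler_wsqrtr.
  apply: (le_trans (taylor2_gauss s h h1 h2 M (B w) (Num.sqrt (V w)) x c
    s2 s3 hT ch hM c1 (sqrtr_ge0 _) sV x0 xc)).
  rewrite sqr_sqrtr// -/I -/k.
  have ev := sqrt_dist_le (V w) x V1 x0.
  have eb : `|Num.sqrt (V w) - x| <= 2 * c.
    have := sqrtr_ge0 (V w); rewrite ler_norml; lra.
  have := powR_mix s rho c _ _ s2 s3 rho0 c1 (normr_ge0 _) eb (normr_ge0 (B w)).
  rewrite -/L => mix.
  have : k * ((1 + `|B w|) `^ (s - 1) * (`|Num.sqrt (V w) - x| + `|B w|)) <=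
      k * (4 * (`|V w - 1| + e) + 4 * rho + L * `|B w| `^ s).
    by apply: ler_wpM2l => //; apply: (le_trans mix); rewrite /e; lra.
  by rewrite /D; lra.
have iD1 : P.-integrable [set: T]
    (EFin \o (fun w => (I + k * (4 * e + 4 * rho)) + (k * 4) * `|V w - 1|)).
  by apply: integrable_realD; [exact: integrable_cst_prob|exact: integrable_realZl].
have iD2 : P.-integrable [set: T]
    (EFin \o (fun w => (I + k * (4 * e + 4 * rho)) + (k * 4) * `|V w - 1| +
      (k * L) * `|B w| `^ s)).
  by apply: integrable_realD => //; exact: integrable_realZl.
have iD3 : P.-integrable [set: T]
    (EFin \o (fun w => (I + k * (4 * e + 4 * rho)) + (k * 4) * `|V w - 1| +
      (k * L) * `|B w| `^ s + h1 0 * B w)).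
  by apply: integrable_realD => //; exact: integrable_realZl.
have iBV : P.-integrable [set: T] (EFin \o (fun w => B w ^+ 2 + V w)).
  exact: integrable_realD.
have iQ : P.-integrable [set: T] (EFin \o (fun w => B w ^+ 2 + V w - x ^+ 2)).
  by apply: integrable_realB => //; exact: integrable_cst_prob.
have iD : P.-integrable [set: T] (EFin \o D).
  by apply: integrable_realD => //; exact: integrable_realZl.
have DE : \int[P]_w D w = I + k * (4 * (\int[P]_w `|V w - 1| + e) +
    4 * rho + L * \int[P]_w (`|B w| `^ s)).
  rewrite /D RintegralD//; last exact: integrable_realZl.
  rewrite RintegralD//; last exact: integrable_realZl.
  rewrite RintegralD//; last exact: integrable_realZl.
  rewrite RintegralD//; last 2 first.
  - exact: integrable_cst_prob.
  - exact: integrable_realZl.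
  rewrite !RintegralZl// Rintegral_cst_prob B0 RintegralB//; last first.
    exact: integrable_cst_prob.
  rewrite RintegralD// Rintegral_cst_prob -VB; ring.
have hE (u w : R) : (\int[gam]_y (h (u + w * y)%R)%:E =
    (\int[gam]_y h (u + w * y))%:E)%E.
  by rewrite /Rintegral fineK//; exact: integrable_fin_num (ih u w).
apply: (@le_trans _ _ (\int[P]_w (D w)%:E)%E).
  apply: le_ge0_integral => w.
    by apply: integral_ge0 => y _; rewrite lee_fin; have /andP[] := hM (B w + Num.sqrt (V w) * y).
  by rewrite hE lee_fin.
rewrite -(fineK (integrable_fin_num measurableT iD)).
rewrite -[fine _]/(\int[P]_w D w) DE.
have -> : (\int[gam]_y (h (x * y)%R)%:E = I%:E)%E.
  under eq_integral do rewrite -[(x * _)%R]add0r.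
  by rewrite hE /I; under eq_Rintegral do rewrite add0r.
by rewrite -EFinD.
Qed.
End gaussian_comparison.

(** * Upper bounds for the Zolotarev distance *)

Section zolotarev_bound.
Context {R : realType}.
Local Notation gam := (normal_prob (0 : R) 1).

(* [zdist_le P X sigma a]: the one-sided (hence, by [zclass_compl], two-sided)
   Zolotarev distance of order [s] between [X] and [sigma N] is at most [a]. *)
Definition zdist_le (s : R) {d : measure_display} {T : measurableType d}
    (P : probability T R) (X : T -> R) (sigma a : R) : Prop :=
  forall h, zclass s h ->
    (\int[P]_w (h (X w))%:E <= \int[gam]_y (h (sigma * y)%R)%:E + a%:E)%E.

Lemma zdist_leW (s : R) {d : measure_display} {T : measurableType d}
    (P : probability T R) (X : T -> R) (sigma a b : R) :
  a <= b -> zdist_le s P X sigma a -> zdist_le s P X sigma b.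
Proof.
move=> ab H h hh; apply: (le_trans (H h hh)).
by apply: leeD => //; rewrite lee_fin.
Qed.

Lemma measurable_gauss_smooth (h : R -> R) :
  continuous h -> (forall x, 0 <= h x) ->
  measurable_fun [set: R * R]
    (fun p => \int[gam]_n (h (p.1 + Num.sqrt p.2 * n)%R)%:E)%E.
Proof.
move=> ch h0.
have mh : measurable_fun [set: R] h by exact: continuous_measurable_fun.
have ms : measurable_fun [set: R] (@Num.sqrt R).
  by apply: continuous_measurable_fun; exact: sqrt_continuous.
apply: (@measurable_fun_fubini_tonelli_F _ _ (R * R)%type _ R gam
  (fun q => (h (q.1.1 + Num.sqrt q.1.2 * q.2))%:E)).
  apply/measurable_EFinP; apply: (measurableT_comp mh).
  apply: measurable_funD; first exact: measurableT_comp.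
  apply: measurable_funM => //.
  by apply: (measurableT_comp ms); exact: measurableT_comp.
by move=> q; rewrite lee_fin.
Qed.

(** An independent normal summand does not increase the distance: for each of its values the test
    function is merely translated, which keeps it in the class. The two normal variables then merge
    into one by [gauss_conv]. *)
Lemma zdist_le_smooth (s : R) {d : measure_display} {T : measurableType d}
    (P : probability T R) (X : T -> R) (v a : R) (h : R -> R) (x y : R) :
  measurable_fun [set: T] X -> 0 <= v -> 0 <= a -> 0 <= y ->
  zdist_le s P X (Num.sqrt v) a -> zclass s h ->
  (\int[P]_w \int[gam]_n (h (x + X w + Num.sqrt y * n)%R)%:E <=
   \int[gam]_n (h (x + Num.sqrt (y + v) * n)%R)%:E + a%:E)%E.
Proof.
move=> mX v0 a0 y0 Xv hh.
have [ch _ _] := hh; have h0 z : 0 <= h z := zclass_ge0 s h z hh.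
have mh := zclass_measurable s h hh.
have -> : (\int[P]_w \int[gam]_n (h (x + X w + Num.sqrt y * n)%R)%:E =
    \int[gam]_n \int[P]_w (h (x + X w + Num.sqrt y * n)%R)%:E)%E.
  apply: (@fubini_tonelli _ _ _ _ R P gam
    (fun p => (h (x + X p.1 + Num.sqrt y * p.2))%:E)).
    apply/measurable_EFinP; apply: (measurableT_comp mh).
    apply: measurable_funD; last exact: measurable_funM.
    by apply: measurable_funD => //; exact: measurableT_comp.
  by move=> p; rewrite lee_fin.
have chx : continuous (fun z => h (x + z)) by have [] := zclass_shift s h x hh.
pose G n := (\int[gam]_k (h (x + (Num.sqrt v * k + Num.sqrt y * n))%R)%:E)%E.
apply: (@le_trans _ _ (\int[gam]_n (G n + a%:E))%E).
  apply: le_ge0_integral => n; first by apply: integral_ge0 => w _; rewrite lee_fin.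
  have := Xv _ (zclass_shift s h (x + Num.sqrt y * n) hh).
  under eq_integral do rewrite addrAC.
  move=> /le_trans; apply; apply: leeD => //; rewrite le_eqVlt; apply/orP; left.
  apply/eqP; rewrite /G; apply: eq_integral => k _; congr (h _)%:E; ring.
have mG : measurable_fun [set: R] G.
  apply: (@measurable_fun_fubini_tonelli_F _ _ _ _ R gam
    (fun p => (h (x + (Num.sqrt v * p.2 + Num.sqrt y * p.1)))%:E)).
    apply/measurable_EFinP; apply: (measurableT_comp mh).
    apply: measurable_funD => //.
    by apply: measurable_funD; apply: measurable_funM.
  by move=> p; rewrite lee_fin.
have G0 n : (0 <= G n)%E by apply: integral_ge0 => k _; rewrite lee_fin.
rewrite ge0_integralD//.
rewrite integral_cst//= probability_setT mule1.
apply: leeD => //.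
rewrite (gauss_conv _ _ (fun z => h (x + z)) (sqrtr_ge0 _) (sqrtr_ge0 _))//.
by rewrite !sqr_sqrtr// addrC.
Qed.

Lemma zclass_compl_le (s : R) {d : measure_display} {T : measurableType d}
    (P : probability T R) (X : T -> R) (sigma a : R) (h : R -> R) :
  measurable_fun [set: T] X -> zdist_le s P X sigma a -> zclass s h ->
  `| \int[P]_w h (X w) - \int[gam]_y h (sigma * y) | <= a.
Proof.
have aux (p q b c : R) : p <= q + c -> b - p <= b - q + c -> `|p - q| <= c.
  by rewrite ler_norml => ? ?; apply/andP; split; lra.
move=> mX Xa hh; have [ch [M hM] _] := hh.
have mh := zclass_measurable s h hh.
have hn z : `|h z| <= M by rewrite ger0_norm; have /andP[] := hM z.
have i1 (g : R -> R) : measurable_fun [set: R] g -> (forall z, `|g z| <= M) ->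
    P.-integrable [set: T] (EFin \o (fun w => g (X w))).
  move=> mg gM; apply: (integrable_bounded P _ M) => //.
  exact: (measurableT_comp mg).
have mm : measurable_fun [set: R] (fun y : R => sigma * y) by exact: measurable_funM.
have i2 (g : R -> R) : measurable_fun [set: R] g -> (forall z, `|g z| <= M) ->
    gam.-integrable [set: R] (EFin \o (fun y => g (sigma * y))).
  move=> mg gM; apply: (integrable_bounded gam _ M) => //.
  exact: (measurableT_comp mg).
have H (g : R -> R) : zclass s g -> (forall z, `|g z| <= M) ->
    \int[P]_w g (X w) <= \int[gam]_y g (sigma * y) + a.
  move=> gz gM; have mg := zclass_measurable s g gz.
  rewrite -lee_fin EFinD.
  rewrite /Rintegral !fineK; [exact: Xa|exact: integrable_fin_num (i2 g mg gM)|].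
  exact: integrable_fin_num (i1 g mg gM).
have hc : zclass s (fun x => M - h x).
  by apply: zclass_compl => // x; have /andP[] := hM x.
have hcM z : `|M - h z| <= M.
  by have /andP[hz1 hz2] := hM z; rewrite ger0_norm; lra.
have := H _ hc hcM; rewrite RintegralB//; last 2 first.
- exact: integrable_cst_prob.
- exact: i1.
rewrite RintegralB//; last 2 first.
- exact: integrable_cst_prob.
- exact: i2.
rewrite !Rintegral_cst_prob => H2.
exact: aux (H h hh hn) H2.
Qed.
End zolotarev_bound.

Section equality_in_law.
Context {R : realType} {d1 d2 d : measure_display}.
Context {T1 : measurableType d1} {T2 : measurableType d2} {T : measurableType d}.
Context (P1 : probability T1 R) (X : T1 -> T) (P2 : probability T2 R) (Y : T2 -> T).
Hypotheses (mX : measurable_fun [set: T1] X) (mY : measurable_fun [set: T2] Y).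
Hypothesis XY : eq_dist P1 X P2 Y.

Lemma eq_dist_ge0_integral (F : T -> \bar R) :
  measurable_fun [set: T] F -> (forall x, (0 <= F x)%E) ->
  (\int[P1]_w F (X w) = \int[P2]_w F (Y w))%E.
Proof.
move=> mF F0.
pose X' : {mfun T1 >-> T} := mfun_Sub (mem_set mX).
pose Y' : {mfun T2 >-> T} := mfun_Sub (mem_set mY).
transitivity (\int[distribution P1 X']_y F y)%E.
  by rewrite ge0_integral_distribution.
transitivity (\int[distribution P2 Y']_y F y)%E.
  by apply: eq_measure_integral => B mB _; exact: XY.
by rewrite ge0_integral_distribution.
Qed.
End equality_in_law.

(** * The recursion *)

Section measurable_families.
Context {R : realType} {d : measure_display} {T : measurableType d}.

(** Times are clipped at 0 because joint measurability is given on [0, +oo[ only, whereas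
    substituting random times is simplest for functions measurable on the whole line. *)
Lemma measurable_family_patch {d' : measure_display} {U : measurableType d'}
    (X : R -> T -> U) : measurable_family X ->
  measurable_fun [set: measurableTypeR R * T] (fun p => X (Num.max p.1 0) p.2).
Proof.
move=> mX; pose D := [set t : R | 0 <= t] `*` [set: T].
have mD : measurable (D : set (measurableTypeR R * T)).
  apply: measurableX => //.
  rewrite (_ : [set t : R | 0 <= t] = `[0, +oo[%classic); first exact: measurable_itv.
  by rewrite set_itvcy.
apply: (@measurable_comp _ _ _ _ _ _ D
  (fun p : measurableTypeR R * T => X p.1 p.2) setT
  ((fun p => (Num.max p.1 0, p.2)) : measurableTypeR R * T -> _) mD) => //.
  by move=> _ [p _ <-]; split => //=; rewrite le_max lexx orbT.
apply: measurable_fun_pair => //.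
by apply: measurable_maxr.
Qed.

Lemma measurable_family_at {d' : measure_display} {U : measurableType d'}
    (X : R -> T -> U) (t : R) : measurable_family X -> 0 <= t ->
  measurable_fun [set: T] (X t).
Proof.
move=> /measurable_family_patch mX t0.
have := measurableT_comp mX (@measurable_pair1 _ _ (measurableTypeR R) T t).
by apply: eq_measurable_fun => w _ /=; rewrite max_l.
Qed.

Lemma measurable_Rintegral_param (P : probability T R)
    {d' : measure_display} {U : measurableType d'} (F : U * T -> R) :
  measurable_fun [set: U * T] F ->
  measurable_fun [set: U] (fun u => \int[P]_w F (u, w)).
Proof.
move=> mF; have mF' : measurable_fun [set: U * T] (EFin \o F).
  exact/measurable_EFinP.
apply: (measurableT_comp (@fine_measurable R setT measurableT)).
rewrite (_ : (fun _ => _) = fun u => (\int[P]_w (EFin \o F)^\+ (u, w) -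
    \int[P]_w (EFin \o F)^\- (u, w))%E); last first.
  apply/funext => u; rewrite integralE; congr (_ - _)%E;
    by apply: eq_integral => w _; rewrite ?funeposE ?funenegE.
apply: emeasurable_funB.
- apply: (measurable_fun_fubini_tonelli_F (m2 := P) ((EFin \o F)^\+)%E).
    exact: measurable_funepos.
  by move=> p; exact: funepos_ge0.
- apply: (measurable_fun_fubini_tonelli_F (m2 := P) ((EFin \o F)^\-)%E).
    exact: measurable_funeneg.
  by move=> p; exact: funeneg_ge0.
Qed.
End measurable_families.

Lemma powR_addr_le {R : realType} (s a b : R) : 0 <= s -> s <= 3 ->
  0 <= a -> 0 <= b -> (a + b) `^ s <= 8 * (a `^ s + b `^ s).
Proof.
move=> s0 s3 a0 b0.
have H (x y : R) : 0 <= x -> 0 <= y -> x <= y -> (x + y) `^ s <= 8 * y `^ s.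
  move=> x0 y0 xy; apply: (@le_trans _ _ ((2 * y) `^ s)).
    by apply: ge0_ler_powR; rewrite ?nnegrE//; lra.
  rewrite powRM//; apply: ler_wpM2r; first exact: powR_ge0.
  apply: (@le_trans _ _ (2 `^ 3%:R)); first by apply: ler_powR; lra.
  by rewrite powR_mulrn//; lra.
have a1 := powR_ge0 a s; have b1 := powR_ge0 b s.
have [ab|ba] := leP a b; first by have := H _ _ a0 b0 ab; lra.
by have := H _ _ b0 a0 (ltW ba); rewrite addrC; lra.
Qed.

Lemma le_1_powR {R : realType} (s x : R) : 2 <= s ->
  `|x| <= 1 + `|x| `^ s /\ x ^+ 2 <= 1 + `|x| `^ s.
Proof.
move=> s2; rewrite -[x ^+ 2]real_normK ?num_real//.
set a := `|x|; have a0 : 0 <= a by exact: normr_ge0.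
have as0 : 0 <= a `^ s by exact: powR_ge0.
have [a1|a1] := leP a 1; first by split; nra.
have E : a ^+ 2 <= a `^ s by rewrite -powR_mulrn//; apply: ler_powR; lra.
by split; nra.
Qed.

(** * Means, variances and bounds on bounded time intervals *)

Section process_moments.
Context {R : realType} {d : measure_display} {T : measurableType d}.
Context (P : probability T R) (Y : R -> T -> R) (s : R).
Local Notation gam := (normal_prob (0 : R) 1).

(** Clipped at 0, like the families, so as to be measurable on the whole line. *)
Definition pmean (u : R) : R := \int[P]_w Y (Num.max u 0) w.
Definition pvar (u : R) : R := \int[P]_w ((Y (Num.max u 0) w - pmean u) ^+ 2).

Hypotheses (s2 : 2 < s) (s3 : s <= 3).
Hypothesis mY : measurable_family Y.
Hypothesis iY : forall t, 0 <= t ->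
  P.-integrable [set: T] (fun w => (`|Y t w| `^ s)%:E).

Lemma measurable_pmean : measurable_fun [set: R] pmean.
Proof.
exact: (measurable_Rintegral_param P (U := measurableTypeR R) _
  (measurable_family_patch Y mY)).
Qed.

Lemma measurable_pvar : measurable_fun [set: R] pvar.
Proof.
apply: (measurable_Rintegral_param P (U := measurableTypeR R)
  (fun p => (Y (Num.max p.1 0) p.2 - pmean p.1) ^+ 2)).
apply: measurable_funX; apply: measurable_funB.
  exact: measurable_family_patch.
exact: (measurableT_comp measurable_pmean).
Qed.

Lemma pvar_ge0 u : 0 <= pvar u.
Proof. by apply: Rintegral_ge0 => w _; exact: sqr_ge0. Qed.

Section at_u.
Variable u : R.
Hypothesis u0 : 0 <= u.

Let maxu : Num.max u 0 = u. Proof. exact: max_l. Qed.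
Let mYu : measurable_fun [set: T] (Y u).
Proof. exact: measurable_family_at. Qed.

Lemma measurable_centered : measurable_fun [set: T] (fun w => Y u w - pmean u).
Proof. exact: measurable_funB. Qed.

Let i1 : P.-integrable [set: T] (EFin \o (fun w => 1 + `|Y u w| `^ s)).
Proof.
by apply: integrable_realD; [exact: integrable_cst_prob|exact: iY].
Qed.

Lemma integrable_process : P.-integrable [set: T] (EFin \o Y u).
Proof.
by apply: le_integrable_real i1 => // w; have [] := le_1_powR s (Y u w) (ltW s2).
Qed.

Lemma integrable_centered :
  P.-integrable [set: T] (EFin \o (fun w => Y u w - pmean u)).
Proof.
apply: integrable_realB; [exact: integrable_process|exact: integrable_cst_prob].
Qed.

Lemma centered_powR_le w :
  `|Y u w - pmean u| `^ s <= 8 * (`|Y u w| `^ s + `|pmean u| `^ s).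
Proof.
have s0 : 0 <= s by move: s2; lra.
apply: (@le_trans _ _ ((`|Y u w| + `|pmean u|) `^ s)).
  by apply: ge0_ler_powR; rewrite ?nnegrE ?addr_ge0// ler_normB.
exact: powR_addr_le.
Qed.

Let i8 : P.-integrable [set: T]
  (EFin \o (fun w => 8 * (`|Y u w| `^ s + `|pmean u| `^ s))).
Proof.
apply: integrable_realZl; apply: integrable_realD; first exact: iY.
exact: integrable_cst_prob.
Qed.

Lemma integrable_centered_powR :
  P.-integrable [set: T] (EFin \o (fun w => `|Y u w - pmean u| `^ s)).
Proof.
apply: le_integrable_real i8 => [|w].
  exact/measurable_abs_powR/measurable_centered.
by rewrite ger0_norm ?powR_ge0//; exact: centered_powR_le.
Qed.

Let i1c : P.-integrable [set: T]
  (EFin \o (fun w => 1 + `|Y u w - pmean u| `^ s)).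
Proof.
apply: integrable_realD; first exact: integrable_cst_prob.
exact: integrable_centered_powR.
Qed.

Lemma integrable_centered_sqr :
  P.-integrable [set: T] (EFin \o (fun w => (Y u w - pmean u) ^+ 2)).
Proof.
apply: le_integrable_real i1c => [|w].
  exact/measurable_funX/measurable_centered.
by rewrite ger0_norm ?sqr_ge0//; have [] := le_1_powR s (Y u w - pmean u) (ltW s2).
Qed.

Lemma Rintegral_centered : \int[P]_w (Y u w - pmean u) = 0.
Proof.
rewrite RintegralB//; last exact: integrable_cst_prob.
  by rewrite Rintegral_cst_prob /pmean maxu subrr.
exact: integrable_process.
Qed.

Lemma Rintegral_centered_sqr : \int[P]_w ((Y u w - pmean u) ^+ 2) = pvar u.
Proof. by rewrite /pvar maxu. Qed.

Lemma pmean_le : `|pmean u| <= 1 + \int[P]_w (`|Y u w| `^ s).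
Proof.
rewrite {1}/pmean maxu; apply: (le_trans (le_normr_Rintegral _ integrable_process)) => //.
rewrite -[X in X + _](Rintegral_cst_prob P) -RintegralD//; last 2 first.
- exact: integrable_cst_prob.
- exact: iY.
apply: le_Rintegral => //; first exact: integrable_norm integrable_process.
by move=> w _; have [] := le_1_powR s (Y u w) (ltW s2).
Qed.

Lemma pvar_le : pvar u <= 1 + \int[P]_w (`|Y u w - pmean u| `^ s).
Proof.
rewrite -Rintegral_centered_sqr -[X in X + _](Rintegral_cst_prob P) -RintegralD//; last 2 first.
- exact: integrable_cst_prob.
- exact: integrable_centered_powR.
apply: le_Rintegral => //; first exact: integrable_centered_sqr.
by move=> w _; have [] := le_1_powR s (Y u w - pmean u) (ltW s2).
Qed.

Lemma Rintegral_centered_powR_le : \int[P]_w (`|Y u w - pmean u| `^ s) <=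
  8 * (\int[P]_w (`|Y u w| `^ s) + `|pmean u| `^ s).
Proof.
rewrite -[X in _ + X](Rintegral_cst_prob P) -RintegralD//; last 2 first.
- exact: iY.
- exact: integrable_cst_prob.
rewrite -RintegralZl//; last first.
  by apply: integrable_realD; [exact: iY|exact: integrable_cst_prob].
apply: le_Rintegral => //; first exact: integrable_centered_powR.
by move=> w _; exact: centered_powR_le.
Qed.

(** By [taylor2_mean], the centered variable and the normal one of equal variance are both close to
    [h 0 + h2 0 * pvar u]. For the normal one, r^s <= (1 + r^2)^2 with r^2 the variance. *)
Lemma zdist_le_trivial : zdist_le s P (fun w => Y u w - pmean u)
  (Num.sqrt (pvar u))
  (\int[P]_w (`|Y u w - pmean u| `^ s) + (1 + pvar u) ^+ 2 * gauss3).
Proof.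
move=> h [ch [M hM] [h1 [h2 hT]]].
have [s2' s3'] := (s2, s3).
have s1 : 1 < s by lra.
have A1 := taylor2_mean P s h h1 h2 M (pvar u) _ s1 hT ch hM
  integrable_centered integrable_centered_sqr integrable_centered_powR
  Rintegral_centered Rintegral_centered_sqr.
set r := Num.sqrt (pvar u); have r0 : 0 <= r by exact: sqrtr_ge0.
have r2 : r ^+ 2 = pvar u by rewrite sqr_sqrtr ?pvar_ge0.
have s0 : 0 <= s by move: s2; lra.
have E2 : (fun y : R => (r * y) ^+ 2) = (fun y => r ^+ 2 * y ^+ 2).
  by apply/funext => y; rewrite exprMn.
have Es : (fun y : R => `|r * y| `^ s) = (fun y => r `^ s * `|y| `^ s).
  by apply/funext => y; rewrite normrM (ger0_norm r0) powRM.
have j1 : gam.-integrable [set: R] (EFin \o (fun y : R => r * y)).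
  exact: integrable_realZl integrable_gauss_id.
have j2 : gam.-integrable [set: R] (EFin \o (fun y : R => (r * y) ^+ 2)).
  by rewrite E2; exact: integrable_realZl integrable_gauss_sqr.
have js : gam.-integrable [set: R] (EFin \o (fun y : R => `|r * y| `^ s)).
  by rewrite Es; apply: integrable_realZl; exact: integrable_gauss_powR.
have v1 : \int[gam]_y (r * y) = 0.
  by rewrite RintegralZl ?Rintegral_gauss_id ?mulr0//; exact: integrable_gauss_id.
have v2 : \int[gam]_y ((r * y) ^+ 2) = pvar u.
  rewrite E2 RintegralZl//; last exact: integrable_gauss_sqr.
  by rewrite Rintegral_gauss_sqr mulr1.
have A2 := taylor2_mean gam s h h1 h2 M (pvar u) _ s1 hT ch hM j1 j2 js v1 v2.
have A3 : \int[gam]_y (`|r * y| `^ s) <= (1 + pvar u) ^+ 2 * gauss3.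
  rewrite Es RintegralZl//; last exact: integrable_gauss_powR.
  apply: ler_pM; [exact: powR_ge0| | |].
  - by apply: Rintegral_ge0 => y _; exact: powR_ge0.
  - rewrite -r2; have [r1|r1] := leP r 1.
      apply: (@le_trans _ _ (1 `^ s)).
        by apply: ge0_ler_powR; rewrite ?nnegrE.
      by rewrite powR1; nra.
    apply: (@le_trans _ _ (r `^ 4%:R)); first by apply: ler_powR; lra.
    by rewrite powR_mulrn//; nra.
  - apply: le_Rintegral => //; [exact: integrable_gauss_powR|exact: integrable_gauss3|].
    by move=> y _; exact: powR_le_gauss3.
have mh : measurable_fun [set: R] h by exact: continuous_measurable_fun.
have hn z : `|h z| <= M by rewrite ger0_norm; have /andP[] := hM z.
have k1 : P.-integrable [set: T] (EFin \o (fun w => h (Y u w - pmean u))).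
  apply: (integrable_bounded P _ M) => //.
  exact: (measurableT_comp mh measurable_centered).
have k2 : gam.-integrable [set: R] (EFin \o (fun y : R => h (r * y))).
  apply: (integrable_bounded gam _ M) => //.
  by apply: (measurableT_comp mh); exact: measurable_funM.
rewrite -(fineK (integrable_fin_num measurableT k1)).
rewrite -(fineK (integrable_fin_num measurableT k2)) -EFinD lee_fin.
rewrite -[fine _]/(\int[P]_w h (Y u w - pmean u)).
rewrite -[fine (\int[gam]_y _)%E]/(\int[gam]_y h (r * y)).
move: A1 A2; rewrite !ler_norml => /andP[_ A1] /andP[A2 _].
lra.
Qed.
End at_u.

Hypothesis supY : forall t, 0 <= t ->
  (ereal_sup [set 'E_P[fun w => (`|Y u w| `^ s)%R] | u in `[0%R, t]] < +oo)%E.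

(** Provides the finite starting point of the iteration on every bounded interval, without any use
    of the recursion. *)
Lemma local_moment_bound t : 0 <= t ->
  exists2 C : R, 0 <= C & forall u, 0 <= u <= t ->
    [/\ `|pmean u| <= C, pvar u <= C &
        zdist_le s P (fun w => Y u w - pmean u) (Num.sqrt (pvar u)) C].
Proof.
move=> t0; have [s2' s3'] := (s2, s3).
have [c [c0 Yc]] : exists c : R, 0 <= c /\
    forall u, 0 <= u <= t -> \int[P]_w (`|Y u w| `^ s) <= c.
  have := supY t t0; set e := ereal_sup _ => e_lt.
  have eE u : 0 <= u <= t -> ((\int[P]_w (`|Y u w| `^ s))%:E <= e)%E.
    move=> ut; apply: ereal_sup_ubound; exists u; first by rewrite /= in_itv.
    have /andP[u0 _] := ut.
    by rewrite unlock /Rintegral fineK//; exact: integrable_fin_num (iY u u0).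
  have e0 : (0 <= e)%E.
    apply: (le_trans _ (eE 0 _)); last by rewrite lexx.
    by rewrite lee_fin; apply: Rintegral_ge0 => w _; exact: powR_ge0.
  exists (fine e); split; first exact: fine_ge0.
  by move=> u /eE; rewrite -{1}(fineK (_ : e \is a fin_num)) ?ge0_fin_numE.
(* Bound for the centered moments of order [s]: the mean is at most 1 + c, and 8 comes from (a +
   b)^s <= 8 (a^s + b^s). *)
pose c1 := 8 * (c + (1 + c) `^ s).
have c10 : 0 <= c1 by rewrite mulr_ge0// addr_ge0// powR_ge0.
exists ((1 + c) + (1 + c1) + (c1 + (1 + (1 + c1)) ^+ 2 * gauss3)).
  have := gauss3_ge0 (R := R); have := sqr_ge0 (1 + (1 + c1)); nra.
move=> u ut; have /andP[u0 _] := ut.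
have Yuc := Yc u ut.
have A1 : `|pmean u| <= 1 + c by apply: (le_trans (pmean_le u u0)); lra.
have A2 : \int[P]_w (`|Y u w - pmean u| `^ s) <= c1.
  apply: (le_trans (Rintegral_centered_powR_le u u0)).
  rewrite /c1 ler_pM2l//; apply: lerD => //.
  by apply: ge0_ler_powR; rewrite ?nnegrE//; lra.
have A3 : pvar u <= 1 + c1 by apply: (le_trans (pvar_le u u0)); lra.
have g0 : 0 <= (1 + (1 + c1)) ^+ 2 * gauss3 by rewrite mulr_ge0 ?sqr_ge0 ?gauss3_ge0.
split; [lra|lra|].
apply: zdist_leW (zdist_le_trivial u u0).
have : (1 + pvar u) ^+ 2 * gauss3 <= (1 + (1 + c1)) ^+ 2 * gauss3.
  apply: ler_wpM2r; first exact: gauss3_ge0.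
  by have := pvar_ge0 u; nra.
lra.
Qed.
End process_moments.

(** * The recursion at a fixed time *)

Section recursion.
Context {R : realType} {K : nat} (s : R).
Context {d0 : measure_display} {Om0 : measurableType d0} (P0 : probability Om0 R).
Context (Y : R -> Om0 -> R).
Context {d : measure_display} {Om : measurableType d} (P : probability Om R).
Context (Yc : 'I_K -> R -> Om -> R) (b : R -> Om -> R) (T : 'I_K -> R -> Om -> R).
Local Notation gam := (normal_prob (0 : R) 1).
Local Notation m := (pmean P0 Y).
Local Notation v := (pvar P0 Y).

Hypotheses (s2 : 2 < s) (s3 : s <= 3).
Hypothesis mY : measurable_family Y.
Hypothesis mYc : forall r, measurable_family (Yc r).
Hypothesis Tt : forall r t w, 0 <= t -> 0 <= T r t w <= t.
Hypothesis indf : independent_families P Yc b T.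
Hypothesis YcY : forall r t, 0 <= t -> eq_dist P (Yc r t) P0 (Y t).
Hypothesis iY : forall t, 0 <= t ->
  P0.-integrable setT (fun w => (`|Y t w| `^ s)%:E).

Variable t : R.
Hypothesis t0 : 0 <= t.
Hypothesis rec : eq_dist P0 (Y t) P (fun w => \sum_(r < K) Yc r (T r t w) w + b t w).

(** The toll of the recursion satisfied by the centered variables. With the exact means in place of
    [f], its own mean is exactly 0. *)
Definition toll (w : Om) : R := b t w - m t + \sum_(r < K) m (T r t w).
(** The conditional variance, given the indices, of the normal variable replacing all copies. *)
Definition mixvar (w : Om) : R := \sum_(r < K) v (T r t w).

Let Z r u w := Yc r (Num.max u 0) w - m u.

Let Ymeas u : 0 <= u -> measurable_fun [set: Om0] (Y u).
Proof. exact: measurable_family_at. Qed.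
Let Ycmeas r u : 0 <= u -> measurable_fun [set: Om] (Yc r u).
Proof. exact: measurable_family_at. Qed.

Let law_Z r u (F : R -> \bar R) : 0 <= u -> measurable_fun [set: R] F ->
  (forall x, (0 <= F x)%E) ->
  (\int[P]_w F (Z r u w) = \int[P0]_w F (Y u w - m u)%R)%E.
Proof.
move=> u0 mF F0; rewrite /Z max_l//.
apply: (eq_dist_ge0_integral P (Yc r u) P0 (Y u) (Ycmeas r u u0) (Ymeas u u0)
  (YcY r u u0) (fun x => F (x - m u))) => //.
by apply: (measurableT_comp mF); exact: measurable_funB.
Qed.

Let sumZ w : \sum_(r < K) Z r (T r t w) w + toll w =
  \sum_(r < K) Yc r (T r t w) w + b t w - m t.
Proof.
rewrite /toll /Z big_split/= sumrN.
under eq_bigr => r _ do rewrite max_l ?(andP (Tt r t w t0)).1//.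
ring.
Qed.

Section with_sigma_algebras.
Context (G : option 'I_K -> set_system Om).
Hypothesis HG : forall i, sigma_algebra setT (G i) /\ G i `<=` measurable.
Hypothesis indG : independent_sigmas P G.
Hypothesis GY : forall r,
  measurable_family (T := g_sigma_algebraType (G (Some r))) (Yc r).
Hypothesis Gb : measurable_family (T := g_sigma_algebraType (G None)) b.
Hypothesis GT : forall r,
  measurable_family (T := g_sigma_algebraType (G None)) (T r).

Let mZ r : measurable_fun
  [set: measurableTypeR R * g_sigma_algebraType (G (Some r))]
  (fun p => Z r p.1 p.2).
Proof.
apply: measurable_funB; first exact: (measurable_family_patch _ (GY r)).
exact: (measurableT_comp (measurable_pmean P0 Y mY)).
Qed.

Let mT r : measurable_fun [set: g_sigma_algebraType (G None)] (T r t).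
Proof. exact: (measurable_family_at _ _ (GT r)). Qed.

Let mB : measurable_fun [set: g_sigma_algebraType (G None)] toll.
Proof.
apply: measurable_funD.
  by apply: measurable_funB => //; exact: (measurable_family_at _ _ Gb).
apply: measurable_sum => r.
exact: (measurableT_comp (measurable_pmean P0 Y mY) (mT r)).
Qed.

Let mv : measurable_fun [set: R] v.
Proof. exact: measurable_pvar. Qed.

Let mtoll : measurable_fun [set: Om] toll.
Proof.
have := measurable_hybrid_sum G HG Z (fun r => T r t) toll mZ mT mB 0%N.
by apply: eq_measurable_fun => w _; rewrite hybrid_sum0.
Qed.

Let msum : measurable_fun [set: Om]
  (fun w => \sum_(r < K) Yc r (T r t w) w + b t w).
Proof.
have := measurable_hybrid_sum G HG Z (fun r => T r t) toll mZ mT mB K.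
move=> /measurable_funD /(_ (measurable_cst (m t))).
by apply: eq_measurable_fun => w _ /=; rewrite hybrid_sumK sumZ subrK.
Qed.

Let rec_integral (F : R -> \bar R) : measurable_fun [set: R] F ->
  (forall x, (0 <= F x)%E) ->
  (\int[P0]_w F (Y t w - m t)%R =
   \int[P]_w F (\sum_(r < K) Z r (T r t w) w + toll w)%R)%E.
Proof.
move=> mF F0.
under [RHS]eq_integral do rewrite sumZ.
apply: (eq_dist_ge0_integral P0 (Y t) P _ (Ymeas t t0) msum rec
  (fun x => F (x - m t))) => //.
by apply: (measurableT_comp mF); exact: measurable_funB.
Qed.

(** The replacement scheme is run with [F (x, y)] the mean of [h] at x plus a normal variable of
    variance y; [F (x, 0)] is [h x], and [zdist_le_smooth] gives the cost of one step. *)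
Lemma rec_zdist_sigma (delta : R -> R) (h : R -> R) :
  (forall u, 0 <= u <= t -> zdist_le s P0 (fun w => Y u w - m u)
    (Num.sqrt (v u)) (delta u)) ->
  (forall u, 0 <= u <= t -> 0 <= delta u) ->
  (forall r, measurable_fun [set: Om] (fun w => delta (T r t w))) ->
  zclass s h ->
  (\int[P0]_w (h (Y t w - m t)%R)%:E <=
   \int[P]_w \int[gam]_n (h (toll w + Num.sqrt (mixvar w) * n)%R)%:E +
   \sum_(r < K) \int[P]_w (delta (T r t w))%:E)%E.
Proof.
move=> H delta0 mdelta hh.
have [ch _ _] := hh; have h0 z : 0 <= h z := zclass_ge0 s h z hh.
have mh := zclass_measurable s h hh.
pose F (p : R * R) := (\int[gam]_n (h (p.1 + Num.sqrt p.2 * n)%R)%:E)%E.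
have mF : measurable_fun [set: R * R] F by exact: measurable_gauss_smooth.
have F0 p : (0 <= F p)%E by apply: integral_ge0 => n _; rewrite lee_fin.
have d0' r w : (0 <= (delta (T r t w))%:E)%E by rewrite lee_fin delta0// Tt.
have step r w x y : 0 <= y -> (\int[P]_w' F ((x + Z r (T r t w) w')%R, y) <=
     F (x, (y + v (T r t w))%R) + (delta (T r t w))%:E)%E.
  move=> y0; have ut := Tt r t w t0; have /andP[u0 _] := ut.
  have mFx : measurable_fun [set: R] (fun z => F (x + z, y)).
    apply: (measurableT_comp mF); apply: measurable_fun_pair => //.
    exact: measurable_funD.
  rewrite (law_Z r (T r t w) (fun z => F (x + z, y)) u0 mFx)//.
  apply: zdist_le_smooth => //.
  - by apply: measurable_funB => //; exact: Ymeas.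
  - exact: pvar_ge0.
  - exact: delta0.
  - exact: H.
  - exact: hh.
have md' r : measurable_fun [set: Om] (fun w => (delta (T r t w))%:E).
  exact/measurable_EFinP.
have := hybrid_le P G HG indG Z (fun r => T r t) toll v mZ mT mB mv F
  (fun r w => (delta (T r t w))%:E) mF F0 md' d0' step (pvar_ge0 P0 Y).
rewrite -(rec_integral (fun z => F (z, 0))); last 2 first.
- by apply: (measurableT_comp mF); exact: measurable_fun_pair.
- by move=> x; exact: F0.
apply: le_trans; apply: le_ge0_integral => w; first by rewrite lee_fin.
rewrite /F/=; under eq_integral do rewrite sqrtr0 mul0r addr0.
by rewrite integral_cst//= probability_setT mule1.
Qed.

(** Replacement is exact for the square, each copy being centered with variance [v]. The free shift
    [c] lets identities between nonnegative integrals give access to the mean as well. *)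
Lemma rec_square_sigma (c : R) :
  (\int[P0]_w ((Y t w - m t + c) ^+ 2)%:E =
   \int[P]_w ((toll w + c) ^+ 2 + mixvar w)%:E)%E.
Proof.
(* The maximum only makes [F] nonnegative on the whole plane; all variances met are nonnegative
   already. *)
pose F (p : R * R) : \bar R := ((p.1 + c) ^+ 2 + Num.max p.2 0)%:E.
have mF : measurable_fun [set: R * R] F.
  apply/measurable_EFinP; apply: measurable_funD.
    by apply: measurable_funX; exact: measurable_funD.
  exact: measurable_maxr.
have F0 p : (0 <= F p)%E.
  by rewrite lee_fin addr_ge0 ?sqr_ge0// le_max lexx orbT.
have step r w x y : 0 <= y -> (\int[P]_w' F ((x + Z r (T r t w) w')%R, y) =
     F (x, (y + v (T r t w))%R))%E.
  move=> y0; have /andP[u0 _] := Tt r t w t0; set u := T r t w.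
  rewrite (law_Z r u (fun z => F (x + z, y)) u0); last 2 first.
  - apply: (measurableT_comp mF); apply: measurable_fun_pair => //.
    exact: measurable_funD.
  - by move=> z; exact: F0.
  rewrite /F/= !max_l ?addr_ge0 ?pvar_ge0//.
  have i1 := integrable_centered P0 Y s s2 mY iY u u0.
  have i2 := integrable_centered_sqr P0 Y s s2 s3 mY iY u u0.
  have e w' : (x + (Y u w' - m u) + c) ^+ 2 + y =
      ((x + c) ^+ 2 + y) + (2 * (x + c)) * (Y u w' - m u) + (Y u w' - m u) ^+ 2.
    by ring.
  under eq_integral do rewrite e.
  have j1 : P0.-integrable [set: Om0] (EFin \o (fun w' =>
      ((x + c) ^+ 2 + y) + (2 * (x + c)) * (Y u w' - m u))).
    apply: integrable_realD; first exact: integrable_cst_prob.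
    exact: integrable_realZl.
  rewrite -(fineK (integrable_fin_num measurableT (integrable_realD P0 _ _ j1 i2))).
  congr EFin; rewrite -[fine _]/(\int[P0]_w' (((x + c) ^+ 2 + y) +
    (2 * (x + c)) * (Y u w' - m u) + (Y u w' - m u) ^+ 2)).
  rewrite RintegralD// RintegralD//; last 2 first.
  - exact: integrable_cst_prob.
  - exact: integrable_realZl.
  rewrite Rintegral_cst_prob RintegralZl// (Rintegral_centered P0 Y s)//.
  by rewrite (Rintegral_centered_sqr P0 Y)//; ring.
have := hybrid_eq P G HG indG Z (fun r => T r t) toll v mZ mT mB mv F
  mF F0 step (pvar_ge0 P0 Y).
rewrite -(rec_integral (fun z => F (z, 0))); last 2 first.
- by apply: (measurableT_comp mF); exact: measurable_fun_pair.
- by move=> x; exact: F0.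
rewrite /F/= maxxx; under eq_integral do rewrite addr0.
move=> ->; apply: eq_integral => w _; rewrite max_l//.
by apply: sumr_ge0 => r _; exact: pvar_ge0.
Qed.
End with_sigma_algebras.

Lemma measurable_rec : [/\ measurable_fun [set: Om] toll,
  measurable_fun [set: Om] mixvar &
  forall r, measurable_fun [set: Om] (T r t)].
Proof.
have [G [HG indG GY Gb GT]] := indf.
have mT r : measurable_fun [set: g_sigma_algebraType (G None)] (T r t).
  exact: (measurable_family_at _ _ (GT r)).
have mB : measurable_fun [set: g_sigma_algebraType (G None)] toll.
  apply: measurable_funD.
    by apply: measurable_funB => //; exact: (measurable_family_at _ _ Gb).
  apply: measurable_sum => r.
  exact: (measurableT_comp (measurable_pmean P0 Y mY) (mT r)).
have sub : <<s G None >> `<=` @measurable _ Om.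
  by rewrite (sigma_algebra_id (HG None).1); exact: (HG None).2.
have idG := measurable_id_g_sigma _ sub.
have mT' r : measurable_fun [set: Om] (T r t) := measurableT_comp (mT r) idG.
split; [exact: (measurableT_comp mB idG)| |exact: mT'].
apply: measurable_sum => r.
exact: (measurableT_comp (measurable_pvar P0 Y mY) (mT' r)).
Qed.

Lemma rec_zdist (delta : R -> R) (h : R -> R) :
  (forall u, 0 <= u <= t -> zdist_le s P0 (fun w => Y u w - m u)
    (Num.sqrt (v u)) (delta u)) ->
  (forall u, 0 <= u <= t -> 0 <= delta u) ->
  (forall r, measurable_fun [set: Om] (fun w => delta (T r t w))) ->
  zclass s h ->
  (\int[P0]_w (h (Y t w - m t)%R)%:E <=
   \int[P]_w \int[gam]_n (h (toll w + Num.sqrt (mixvar w) * n)%R)%:E +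
   \sum_(r < K) \int[P]_w (delta (T r t w))%:E)%E.
Proof.
have [G [HG indG GY Gb GT]] := indf.
exact: (rec_zdist_sigma G HG indG GY Gb GT).
Qed.

(** The squared identity at c = 0 shows that the toll is square integrable and gives the variance
    decomposition; subtracting it from the case c = 1 leaves the mean of the toll. *)
Lemma rec_moments :
  [/\ P.-integrable [set: Om] (EFin \o (fun w => toll w ^+ 2)),
      \int[P]_w toll w = 0 &
      \int[P]_w mixvar w + \int[P]_w (toll w ^+ 2) = v t].
Proof.
have [G [HG indG GY Gb GT]] := indf.
have [mtoll mmix _] := measurable_rec.
have sq := rec_square_sigma G HG indG GY Gb GT.
have mix0 w : 0 <= mixvar w by apply: sumr_ge0 => r _; exact: pvar_ge0.
have i1 := integrable_centered P0 Y s s2 mY iY t t0.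
have i2 := integrable_centered_sqr P0 Y s s2 s3 mY iY t t0.
have lhs (c : R) : (\int[P0]_w ((Y t w - m t + c) ^+ 2)%:E = (v t + c ^+ 2)%:E)%E.
  have j1 : P0.-integrable [set: Om0]
      (EFin \o (fun w => c ^+ 2 + (2 * c) * (Y t w - m t))).
    by apply: integrable_realD; [exact: integrable_cst_prob|exact: integrable_realZl].
  have j2 := integrable_realD P0 _ _ j1 i2.
  have e w : (Y t w - m t + c) ^+ 2 =
      c ^+ 2 + (2 * c) * (Y t w - m t) + (Y t w - m t) ^+ 2 by ring.
  under eq_integral do rewrite e.
  rewrite -(fineK (integrable_fin_num measurableT j2)).
  congr EFin; rewrite -[fine _]/(\int[P0]_w (c ^+ 2 + (2 * c) * (Y t w - m t)
    + (Y t w - m t) ^+ 2)).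
  rewrite RintegralD// RintegralD//; last 2 first.
  - exact: integrable_cst_prob.
  - exact: integrable_realZl.
  rewrite Rintegral_cst_prob RintegralZl// (Rintegral_centered P0 Y s)//.
  by rewrite (Rintegral_centered_sqr P0 Y)//; ring.
have iq : P.-integrable [set: Om] (EFin \o (fun w => toll w ^+ 2 + mixvar w)).
  apply/integrableP; split.
    by apply/measurable_EFinP; apply: measurable_funD => //; exact: measurable_funX.
  have := sq 0; rewrite lhs => E.
  rewrite (eq_integral (fun w => ((toll w + 0) ^+ 2 + mixvar w)%:E)).
    by rewrite -E ltry.
  by move=> w _; rewrite /= addr0 ger0_norm// addr_ge0 ?sqr_ge0.
have iB2 : P.-integrable [set: Om] (EFin \o (fun w => toll w ^+ 2)).
  apply: le_integrable_real iq => [|w]; first exact: measurable_funX.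
  by rewrite ger0_norm ?sqr_ge0// lerDl.
have iV : P.-integrable [set: Om] (EFin \o mixvar).
  by apply: le_integrable_real iq => [//|w]; rewrite ger0_norm// lerDr sqr_ge0.
have iB : P.-integrable [set: Om] (EFin \o toll).
  have iB1 : P.-integrable [set: Om] (EFin \o (fun w => 1 + toll w ^+ 2)).
    by apply: integrable_realD => //; exact: integrable_cst_prob.
  apply: le_integrable_real iB1 => // w.
  rewrite -[toll w ^+ 2]real_normK ?num_real//; have := normr_ge0 (toll w).
  by set a := `|_| => a0; have := sqr_ge0 (a - 1); nra.
have rhs (c : R) : v t + c ^+ 2 = (2 * c) * \int[P]_w toll w + c ^+ 2 +
    \int[P]_w (toll w ^+ 2) + \int[P]_w mixvar w.
  have := sq c; rewrite lhs => /(congr1 fine) /= ->.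
  rewrite -[LHS]/(\int[P]_w ((toll w + c) ^+ 2 + mixvar w)).
  have e w : (toll w + c) ^+ 2 + mixvar w =
      (2 * c) * toll w + c ^+ 2 + toll w ^+ 2 + mixvar w by ring.
  have j1 : P.-integrable [set: Om] (EFin \o (fun w => (2 * c) * toll w)).
    exact: integrable_realZl.
  have j2 : P.-integrable [set: Om] (EFin \o (fun w => (2 * c) * toll w + c ^+ 2)).
    by apply: integrable_realD => //; exact: integrable_cst_prob.
  have j3 := integrable_realD P _ _ j2 iB2.
  under eq_Rintegral do rewrite e.
  rewrite RintegralD// RintegralD// RintegralD//; last exact: integrable_cst_prob.
  by rewrite RintegralZl// Rintegral_cst_prob.
have r0 := rhs 0; have r1 := rhs 1.
split => //; first by move: r0 r1; lra.
by move: r0; lra.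
Qed.
End recursion.

(** * Convergence of the coefficients *)

Section wasserstein.
Context {R : realType} {k : nat} (s : R).
Context {d1 d2 : measure_display}.
Context {T1 : measurableType d1} (P1 : probability T1 R) (V : R -> T1 -> k.-tuple R).
Context {T2 : measurableType d2} (P2 : probability T2 R) (W : T2 -> k.-tuple R).
Hypothesis s1 : 1 < s.

Lemma enorm_ge0 (x : k.-tuple R) : 0 <= enorm x.
Proof. exact: sqrtr_ge0. Qed.

Lemma ler_tnth_enorm (x : k.-tuple R) (i : 'I_k) : `|tnth x i| <= enorm x.
Proof.
rewrite /enorm -sqrtr_sqr ler_wsqrtr// (bigD1 i)//= lerDl.
by apply: sumr_ge0 => j _; exact: sqr_ge0.
Qed.

Lemma measurable_enorm_tsub {d : measure_display} {T : measurableType d}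
    (X Y : T -> k.-tuple R) :
  measurable_fun [set: T] X -> measurable_fun [set: T] Y ->
  measurable_fun [set: T] (fun w => enorm (tsub (X w) (Y w))).
Proof.
move=> mX mY.
have ms : measurable_fun [set: R] (@Num.sqrt R).
  by apply: continuous_measurable_fun; exact: sqrt_continuous.
apply: (measurableT_comp ms); apply: measurable_sum => i.
rewrite (_ : (fun _ => _) = fun w => (tnth (X w) i - tnth (Y w) i) ^+ 2).
  apply: measurable_funX; apply: measurable_funB.
    exact: (measurableT_comp (measurable_tnth i) mX).
  exact: (measurableT_comp (measurable_tnth i) mY).
by apply/funext => w; rewrite tnth_mktuple.
Qed.

Lemma ell_cvg_coupling (rho : R) : ell_cvg s P1 V P2 W -> 0 < rho ->
  \forall t \near +oo, exists (d : measure_display) (T : measurableType d)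
    (P : probability T R) (X Y : {mfun T >-> k.-tuple R}),
    [/\ eq_dist P X P1 (V t), eq_dist P Y P2 W &
      (\int[P]_w (enorm (tsub (X w) (Y w)) `^ s)%:E <= (rho `^ s)%:E)%E].
Proof.
move=> [_ _ cvgV] rho0.
have n0 : nbhs (0 : \bar R) [set x | (x < rho%:E)%E].
  apply: open_nbhs_nbhs; split; first exact: open_ereal_lt_ereal.
  by rewrite /= lte_fin.
have H : \forall t \near +oo, (ell_dist s P1 (V t) P2 W < rho%:E)%E.
  exact: cvgV n0.
apply: filterS H => t /ereal_inf_lt[_ [d [T [P [X [Y [XV YW ->]]]]]] lt_rho].
exists d, T, P, X, Y; split => //.
have s0 : s != 0 by rewrite gt_eqF// (lt_trans ltr01).
rewrite (_ : \int[P]_w _ = Lnorm P s%:E (fun w => (enorm (tsub (X w) (Y w)))%:E) `^ s)%E.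
  rewrite -poweR_EFin; apply: gt0_ler_poweR.
  - by rewrite ltW// (lt_trans ltr01).
  - by rewrite in_itv/= Lnorm_ge0 leey.
  - by rewrite in_itv/= lee_fin ltW//= leey.
  - exact: ltW.
rewrite poweR_Lnorm//; apply: eq_integral => w _.
by rewrite abse_EFin poweR_EFin ger0_norm// enorm_ge0.
Qed.

(** Under a coupling at distance at most [rho] in L^s, the Lipschitz bound transfers the mean from
    one law to the other with an error of at most [2 * L * rho]. *)
Lemma ell_cvg_lipschitz (phi : k.-tuple R -> R) (L eps : R) :
  ell_cvg s P1 V P2 W -> measurable_fun [set: k.-tuple R] phi ->
  (forall x, 0 <= phi x) -> 0 <= L ->
  (forall x y, phi x <= phi y + L * enorm (tsub x y)) -> 0 < eps ->
  \forall t \near +oo,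
    (\int[P1]_w (phi (V t w))%:E <= \int[P2]_w (phi (W w))%:E + eps%:E)%E.
Proof.
move=> VW mphi phi0 L0 phiL eps0.
(* Makes [2 * L * rho] at most [eps]; the summand 1 covers L = 0. *)
pose rho := eps / (2 * L + 1).
have L1 : 0 < 2 * L + 1 by lra.
have rho0 : 0 < rho by rewrite divr_gt0.
have [mV [mW _] _] := VW.
have mphiE : measurable_fun [set: k.-tuple R] (fun x => (phi x)%:E).
  exact/measurable_EFinP.
have := ell_cvg_coupling rho VW rho0.
apply: filterS2 mV => t [mVt _] [d [T [P [X [Y [XV YW Xrho]]]]]].
rewrite -(eq_dist_ge0_integral P X P1 (V t) _ mVt XV (fun x => (phi x)%:E))//.
rewrite -(eq_dist_ge0_integral P Y P2 W _ mW YW (fun x => (phi x)%:E))//.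
pose e w := enorm (tsub (X w) (Y w)).
have me : measurable_fun [set: T] e by exact: measurable_enorm_tsub.
have e0 w : 0 <= e w by exact: enorm_ge0.
have mes : measurable_fun [set: T] (fun w => (e w `^ s)%:E).
  by apply/measurable_EFinP; exact: (measurableT_comp (measurable_powR s)).
have q0 : 0 <= L * rho `^ (1 - s) by rewrite mulr_ge0// powR_ge0.
have Lr0 : 0 <= L * rho by rewrite mulr_ge0// ltW.
(* A pointwise substitute for the comparison of L^1 and L^s norms: integrated, the two terms
   contribute [rho] each. *)
have le_e w : e w <= rho + rho `^ (1 - s) * e w `^ s.
  have [er|er] := leP (e w) rho.
    by rewrite ler_wpDr// mulr_ge0 ?powR_ge0.
  have ew0 : 0 < e w by exact: lt_trans er.
  apply: (@le_trans _ _ (rho `^ (1 - s) * e w `^ s)); last by rewrite lerDr ltW.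
  have -> : 1 - s = - (s - 1) by ring.
  rewrite powRN mulrC ler_pdivlMr ?powR_gt0// -(powRS s (e w))// mulrC.
  rewrite ler_wpM2r//; apply: ge0_ler_powR; rewrite ?nnegrE ?ltW//.
  by rewrite subr_gt0.
apply: (@le_trans _ _ (\int[P]_w ((phi (Y w))%:E +
    ((L * rho)%:E + (L * rho `^ (1 - s))%:E * (e w `^ s)%:E)))%E).
  apply: le_ge0_integral => w; first by rewrite lee_fin.
  rewrite -EFinM -!EFinD lee_fin; apply: (le_trans (phiL (X w) (Y w))).
  rewrite lerD2l -mulrA -mulrDr ler_wpM2l//; exact: le_e.
have mY' : measurable_fun [set: T] (fun w => (phi (Y w))%:E).
  exact: (measurableT_comp mphiE).
rewrite ge0_integralD//; last 3 first.
- by move=> w _; rewrite lee_fin.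
- by move=> w _; rewrite -EFinM -EFinD lee_fin addr_ge0// mulr_ge0// powR_ge0.
- by apply: emeasurable_funD => //; exact: measurable_funeM.
apply: leeD => //.
rewrite ge0_integralD//; last 2 first.
- by move=> w _; rewrite -EFinM lee_fin mulr_ge0// powR_ge0.
- exact: measurable_funeM.
rewrite integral_cst//= probability_setT mule1.
rewrite ge0_integralZl//; last by move=> w _; rewrite lee_fin powR_ge0.
apply: (@le_trans _ _ ((L * rho)%:E + (L * rho `^ (1 - s))%:E * (rho `^ s)%:E)%E).
  by apply: leeD => //; apply: lee_wpmul2l => //; rewrite lee_fin.
rewrite -EFinM -EFinD lee_fin -mulrA -powRD; last first.
  by rewrite (gt_eqF rho0) implybT.
rewrite (_ : 1 - s + s = 1) ?powRr1 ?ltW//; last by ring.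
have : rho * (2 * L + 1) = eps by rewrite /rho mulfVK// gt_eqF.
by move: rho0; lra.
Qed.
End wasserstein.

(** Any variable coupled as the limit vanishes almost surely, so the coupling distance is the
    absolute moment itself. *)
Lemma ell_cvg0 {R : realType} (s : R) {d1 d2 : measure_display}
    {T1 : measurableType d1} (P1 : probability T1 R) (X : R -> T1 -> R)
    {T2 : measurableType d2} (P2 : probability T2 R) (eps : R) :
  1 < s ->
  ell_cvg s P1 (fun t w => [tuple X t w]) P2 (fun=> [tuple 0]) -> 0 < eps ->
  \forall t \near +oo, measurable_fun [set: T1] (X t) /\
    (\int[P1]_w (`|X t w| `^ s)%:E <= eps%:E)%E.
Proof.
move=> s1 H eps0; have [mV [mW _] _] := H.
have s0 : 0 < s by exact: lt_trans s1.
have rho0 : 0 < eps `^ s^-1 by rewrite powR_gt0.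
have := ell_cvg_coupling s P1 _ P2 _ s1 (eps `^ s^-1) H rho0.
apply: filterS2 mV => t [mVt _] [d [T [P [V [W [VX W0 VW]]]]]].
have X1 w : X t w = tnth [tuple X t w] ord0 by [].
split.
  exact: (measurableT_comp (measurable_tnth ord0) mVt).
have mE (i : 'I_1) : measurable_fun [set: 1.-tuple R]
    (fun x : 1.-tuple R => (`|tnth x i| `^ s)%:E).
  apply/measurable_EFinP; apply: measurable_abs_powR.
  exact: measurable_tnth.
have mVn : measurable_fun [set: T] V by [].
have mWn : measurable_fun [set: T] W by [].
have e1 := eq_dist_ge0_integral P V P1 _ mVn mVt VX
  (fun x => (`|tnth x ord0| `^ s)%:E) (mE ord0).
rewrite [leLHS](_ : _ = \int[P1]_w (`|tnth [tuple X t w] ord0| `^ s)%:E)%E//.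
rewrite -e1; last by move=> x; rewrite lee_fin powR_ge0.
have aeW : {ae P, forall w, tnth (W w) ord0 = 0}.
  have mN : measurable [set x : 1.-tuple R | tnth x ord0 != 0].
    rewrite -[X in measurable X]setTI.
    have -> : [set x : 1.-tuple R | tnth x ord0 != 0] =
        (fun x : 1.-tuple R => tnth x ord0) @^-1` (~` [set 0]).
      by apply/seteqP; split => x /= => [/eqP|/eqP].
    by apply: (measurable_tnth ord0) => //; exact: measurableC.
  exists (W @^-1` [set x | tnth x ord0 != 0]); split.
  - by rewrite -[X in measurable X]setTI; exact: mWn.
  - have := W0 _ mN; rewrite /pushforward => ->.
    rewrite (_ : _ @^-1` _ = set0) ?measure0//.
    by apply/seteqP; split => // x /= /eqP; apply.
  - by move=> w /= /eqP.
apply: (le_trans _ (le_trans VW _)); last first.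
  by rewrite lee_fin -powRrM mulVf ?gt_eqF// powRr1// ltW.
apply: ae_ge0_le_integral.
- by [].
- by move=> w _; rewrite lee_fin powR_ge0.
- exact: (measurableT_comp (mE ord0)).
- by move=> w _; rewrite lee_fin powR_ge0.
- apply/measurable_EFinP; apply: (measurableT_comp (measurable_powR s)).
  exact: measurable_enorm_tsub.
apply: filterS aeW => w W0w _; rewrite lee_fin.
apply: ge0_ler_powR; rewrite ?nnegrE ?enorm_ge0//; first exact: ltW.
have := ler_tnth_enorm (tsub (V w) (W w)) ord0.
by rewrite tnth_mktuple W0w subr0.
Qed.

Lemma littleo_pinfty {R : realType} (F1 F2 e : R -> R) :
  (forall t, F1 t = F2 t +o_(t \near +oo_R) e t) ->
  forall eps, 0 < eps -> \forall t \near +oo, `|F1 t - F2 t| <= eps * `|e t|.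
Proof.
move=> H eps eps0.
pose F := pinfty_nbhs_filter_on R.
have E : F1 = F2 +o_ F e by apply/funext => t; exact: H.
by move/eqaddoP : E => /(_ eps eps0).
Qed.

Lemma near_pinftyP {R : realType} (Q : R -> Prop) :
  (\forall t \near +oo, Q t) -> exists2 A : R, 0 < A & forall t, A <= t -> Q t.
Proof.
move=> [A [_ H]]; exists (Num.max A 0 + 1).
  by rewrite ltr_wpDl// le_max lexx orbT.
move=> t At; apply: H; apply: lt_le_trans At.
by rewrite ltr_pwDr// le_max lexx.
Qed.

(** * Truncation of the weights *)

Section clipping.
Context {R : realType}.
Implicit Types x y c lo : R.

(** Truncation turns squares and powers into bounded Lipschitz functions, to which convergence in
    l_s applies; it leaves the weights unchanged once [c] exceeds them. *)
Definition clip (lo c x : R) : R := Num.min (Num.max x lo) c.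

Lemma clip_itv lo c x : lo <= c -> lo <= clip lo c x <= c.
Proof.
by move=> lc; rewrite /clip le_min le_max lexx orbT lc /= ge_min lexx orbT.
Qed.

Lemma clip_id lo c x : lo <= x -> x <= c -> clip lo c x = x.
Proof. by move=> lx xc; rewrite /clip max_l// min_l. Qed.

Lemma clip_lip lo c x y : `|clip lo c x - clip lo c y| <= `|x - y|.
Proof.
rewrite /clip /Num.max /Num.min.
do ?case: ifPn; rewrite -?leNgt => *; rewrite ler_norml;
  have := ler_norm (x - y); have := ler_norm (y - x);
  rewrite (distrC y x) => *; apply/andP; split; lra.
Qed.

Lemma measurable_clip lo c : measurable_fun [set: R] (clip lo c).
Proof.
apply: measurable_minr => //; exact: measurable_maxr.
Qed.

(** For b < a the quotient r = b/a lies in [0, 1], where r^s >= r^3 >= 1 - 3 (1 - r). Multiplying by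
    a^s and using a^(s-1) <= c^2 yields the constant 3 c^2. *)
Lemma powR_clip_lip (s c x y : R) : 2 < s -> s <= 3 -> 1 <= c ->
  clip 0 c x `^ s <= clip 0 c y `^ s + 3 * c ^+ 2 * `|x - y|.
Proof.
move=> s2 s3 c1; have c0 : 0 <= c by lra.
apply: (@le_trans _ _ (clip 0 c y `^ s + 3 * c ^+ 2 *
    `|clip 0 c x - clip 0 c y|)); last first.
  by rewrite lerD2l; apply: ler_wpM2l (clip_lip _ _ _ _);
    rewrite mulr_ge0// sqr_ge0.
have /andP[x0 xc] := clip_itv 0 c x c0.
have /andP[y0 yc] := clip_itv 0 c y c0.
set a := clip 0 c x in x0 xc *; set b := clip 0 c y in y0 yc *.
have cab : 0 <= 3 * c ^+ 2 * `|a - b| by rewrite !mulr_ge0 ?sqr_ge0.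
have [ab|ba] := leP a b.
  have : a `^ s <= b `^ s by apply: ge0_ler_powR; rewrite ?nnegrE//; lra.
  lra.
have a0 : 0 < a by lra.
have r0 : 0 <= b / a by rewrite divr_ge0// ltW.
have r1 : b / a <= 1 by rewrite ler_pdivrMr// mul1r ltW.
have bE : b `^ s = a `^ s * (b / a) `^ s.
  by rewrite -powRM ?(ltW a0)// mulrCA divff ?mulr1// gt_eqF.
(* r^3 - 1 + 3 (1 - r) factors as (r - 1)^2 (r + 2). *)
have rs : 1 - 3 * (1 - b / a) <= (b / a) `^ s.
  apply: (@le_trans _ _ ((b / a) ^+ 3)).
    move: r0; set r := b / a => r0.
    have : 0 <= (r - 1) ^+ 2 * (r + 2) by rewrite mulr_ge0 ?sqr_ge0//; lra.
    by lra.
  have [->|rn0] := eqVneq (b / a) 0; first by rewrite expr0n/= powR_ge0.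
  rewrite -powR_mulrn//; apply: ger_powR => //.
  by rewrite lt_neqAle eq_sym rn0 r0.
have as1 : a `^ (s - 1) <= c ^+ 2.
  have [a1|a1] := leP a 1.
    apply: (@le_trans _ _ (1 `^ (s - 1))).
      by apply: ge0_ler_powR; rewrite ?nnegrE//; lra.
    by rewrite powR1; nra.
  apply: (@le_trans _ _ (a `^ 2%:R)); first by apply: ler_powR; lra.
  by rewrite powR_mulrn//; nra.
have as0 : 0 <= a `^ s by exact: powR_ge0.
have e1 : a `^ s * (1 - b / a) = a `^ (s - 1) * (a - b).
  rewrite -(powRS s a)//; last lra.
  by rewrite -mulrA; congr (_ * _); rewrite mulrBr mulr1 mulrCA divff ?mulr1// gt_eqF.
have e2 : a `^ (s - 1) * (a - b) <= c ^+ 2 * (a - b).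
  by apply: ler_wpM2r => //; rewrite subr_ge0 ltW.
have e3 : a `^ s * (1 - 3 * (1 - b / a)) <= b `^ s.
  by rewrite bE; exact: ler_wpM2l.
have ab0 : 0 <= a - b by rewrite subr_ge0 ltW.
rewrite (ger0_norm ab0).
have -> : a `^ s = a `^ s * (1 - 3 * (1 - b / a)) + 3 * (a `^ s * (1 - b / a)).
  by ring.
rewrite e1; have -> : 3 * c ^+ 2 * (a - b) = 3 * (c ^+ 2 * (a - b)) by ring.
apply: lerD => //.
by rewrite ler_pM2l.
Qed.

Lemma sqr_clip_lip (c x y : R) : 0 <= c ->
  `|clip (- c) c x ^+ 2 - clip (- c) c y ^+ 2| <= 2 * c * `|x - y|.
Proof.
move=> c0; have cc : - c <= c by lra.
have /andP[x0 xc] := clip_itv (- c) c x cc.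
have /andP[y0 yc] := clip_itv (- c) c y cc.
rewrite subr_sqr normrM mulrC; apply: ler_pM => //; last exact: clip_lip.
by rewrite ler_norml; apply/andP; split; lra.
Qed.
End clipping.

(** * The limit weights *)

Section limit_weights.
Context {R : realType} {K : nat} {d : measure_display} {T : measurableType d}.
Context (P : probability T R) (A : 'I_K -> {RV P >-> R}).
Context (s c : R).
Hypotheses (s2 : 2 < s) (c1 : 1 <= c).
Hypothesis A1 : {ae P, forall w, \sum_(r < K) A r w ^+ 2 = 1}.

Let abs_le1 w r : \sum_(r < K) A r w ^+ 2 = 1 -> `|A r w| <= 1.
Proof.
move=> S1; have : A r w ^+ 2 <= 1.
  rewrite -S1 (bigD1 r)//= lerDl; apply: sumr_ge0 => j _; exact: sqr_ge0.
by rewrite -[A r w ^+ 2]real_normK ?num_real// expr_le1.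
Qed.

Lemma limit_weights_sqr :
  (\int[P]_w (`|\sum_(r < K) clip (- c) c (A r w) ^+ 2 - 1|)%:E = 0)%E.
Proof.
have mX : measurable_fun [set: T]
    (fun w => \sum_(r < K) clip (- c) c (A r w) ^+ 2 - 1).
  apply: measurable_funB => //; apply: measurable_sum => r.
  apply: measurable_funX; apply: (measurableT_comp (measurable_clip _ _)).
  exact: measurable_funPT.
rewrite (@ae_eq_integral _ _ _ P setT (cst 0%E))//.
- by rewrite integral0.
- by apply/measurable_EFinP; exact: (measurableT_comp _ mX).
apply: filterS A1 => w S1 _; rewrite (eq_bigr (fun r => A r w ^+ 2)).
  by rewrite S1 subrr normr0.
move=> r _; have := abs_le1 w r S1; rewrite ler_norml => /andP[a1 a2].
by rewrite clip_id//; move: c1; lra.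
Qed.

Let leifI (x y : R) (C : bool) : (if C then x == y else x < y) ->
  x <= y ?= iff C.
Proof. by move=> H; apply/leifP. Qed.

(** The equality cases are recorded because the strict contraction rests on them. A negative [x] is
    clipped to 0, so it gives strict inequality. *)
Let powR_clip_sqr x : `|x| <= 1 ->
  clip 0 c x `^ s <= x ^+ 2 ?= iff ((x == 0) || (x == 1)).
Proof.
have s0 : 0 < s by move: s2; lra.
rewrite ler_norml => /andP[x1 x2]; apply: leifI.
have [xlt0|xgt0|->] := ltgtP x 0.
- have -> : clip 0 c x = 0.
    by rewrite /clip max_r ?(ltW xlt0)// min_l//; move: c1; lra.
  have -> : (x == 1) = false by apply/eqP; lra.
  rewrite powR0; last by rewrite gt_eqF.
  by rewrite /= lt_neqAle sqr_ge0 eq_sym sqrf_eq0 (lt_eqF xlt0).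
- rewrite clip_id ?(ltW xgt0)//; last by move: c1; lra.
  rewrite /=; case: eqP => [->|xn1]; first by rewrite powR1 expr1n.
  have {}x2 : x < 1 by rewrite lt_neqAle x2 andbT; exact/eqP.
  rewrite -powR_mulrn ?(ltW xgt0)// /powR (gt_eqF xgt0) ltr_expR ltr_nM2r//.
  by rewrite -ln1 ltr_ln// posrE.
- rewrite clip_id//; last by move: c1; lra.
  by rewrite powR0 ?(gt_eqF s0)// expr0n/= eqxx.
Qed.

(** The sum of the powers is almost surely at most the sum of the squares, that is 1. A mean of at
    least 1 would force equality almost surely, and then some weight would equal 1 almost surely. *)
Lemma limit_weights_powR :
  (P [set w | exists r, A r w = 1%R] < 1)%E ->
  exists2 xi : R, 0 <= xi < 1 &
    (\int[P]_w (\sum_(r < K) clip 0 c (A r w) `^ s)%:E = xi%:E)%E.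
Proof.
move=> S1; have c0 : 0 <= c by move: c1; lra.
pose X w := \sum_(r < K) clip 0 c (A r w) `^ s.
have X0 w : 0 <= X w by apply: sumr_ge0 => r _; exact: powR_ge0.
have mX : measurable_fun [set: T] X.
  apply: measurable_sum => r; apply: (measurableT_comp (measurable_powR s)).
  by apply: (measurableT_comp (measurable_clip _ _)); exact: measurable_funPT.
have XK w : X w <= K%:R * c `^ s.
  rewrite mulr_natl -[K in leRHS]card_ord -sumr_const; apply: ler_sum => r _.
  have /andP[h1 h2] := clip_itv 0 c (A r w) c0.
  by apply: ge0_ler_powR; rewrite ?nnegrE//; move: s2; lra.
have iX : P.-integrable [set: T] (EFin \o X).
  by apply: (integrable_bounded P X _ mX) => w; rewrite ger0_norm.
have Xlt w : \sum_(r < K) A r w ^+ 2 = 1 -> X w <= 1 ?= iff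
    [forall r, (A r w == 0) || (A r w == 1)].
  move=> E; rewrite -[X in _ <= X ?= iff _]E.
  have -> : [forall r, (A r w == 0) || (A r w == 1)] =
      [forall (r | xpredT r), (A r w == 0) || (A r w == 1)].
    by apply: eq_forallb.
  by apply: leif_sum => r _; apply: powR_clip_sqr; exact: abs_le1.
exists (\int[P]_w X w); last first.
  by rewrite -[LHS]fineK//; exact: integrable_fin_num iX.
rewrite Rintegral_ge0//= ltNge; apply/negP => xi1.
have mS : measurable [set w | exists r, A r w = 1].
  rewrite (_ : [set w | _] = \bigcup_(r in [set: 'I_K]) (A r @^-1` [set 1])).
    by apply: fin_bigcup_measurable.
  by apply/seteqP; split=> [w [r ?]|w [r _ ?]]; exists r.
(* 1 - X is almost surely nonnegative with mean at most 0, hence null. The equality case puts every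
   weight in {0, 1}, and they cannot all vanish as their squares sum to 1. *)
have aeS : {ae P, forall w, [set w | exists r, A r w = 1] w}.
  have mY : measurable_fun [set: T] (fun w => (1 - X w)%:E).
    by apply/measurable_EFinP; exact: measurable_funB.
  have /(ae_eq_integral_abs P measurableT mY) Y0 :
      (\int[P]_(w in setT) `|(1 - X w)%:E| = 0)%E.
    rewrite (@ae_eq_integral _ _ _ P setT (fun w => (1 - X w)%:E))//.
    - apply/eqP; rewrite eq_le; apply/andP; split.
        have iY := integrable_realB P _ _ (integrable_cst_prob P 1) iX.
        rewrite -(fineK (integrable_fin_num measurableT iY)) lee_fin.
        rewrite -[fine _]/(\int[P]_w (1 - X w)) RintegralB//; last first.
          exact: integrable_cst_prob.
        by rewrite Rintegral_cst_prob subr_le0.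
      rewrite (@ae_eq_integral _ _ _ P setT (fun w => `|(1 - X w)%:E|%E))//.
      - by apply: integral_ge0.
      - exact: measurableT_comp.
      - apply: filterS A1 => w E _; rewrite /= ger0_norm// subr_ge0.
        exact: (Xlt w E).1.
    - exact: measurableT_comp.
    - apply: filterS A1 => w E _; rewrite /= ger0_norm// subr_ge0.
      exact: (Xlt w E).1.
  apply: filterS2 A1 Y0 => w E /(_ I) [] /eqP.
  rewrite subr_eq0 eq_sym (Xlt w E).2 => /forallP A01.
  apply: contrapT => nS; move: E; rewrite big1 => [/eqP|r _].
    by rewrite eq_sym oner_eq0.
  have /orP[/eqP->|/eqP A1r] := A01 r; first by rewrite expr0n.
  by exfalso; apply: nS; exists r.
move: S1; rewrite (_ : P _ = 1%E) ?ltxx//.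
have [N [mN PN sN]] := aeS.
apply/eqP; rewrite eq_le probability_le1//=.
have : (P (~` [set w | exists r, A r w = 1%R]) <= 0)%E.
  by rewrite -PN le_measure ?inE//; exact: measurableC.
by rewrite probability_setC// leeBlDr ?add0e// fin_num_measure.
Qed.
End limit_weights.

(** * Asymptotics of the normalized toll, variance and weights *)

Section asymptotics.
Context {R : realType} {K : nat} (s : R).
Context {d0 : measure_display} {Om0 : measurableType d0} (P0 : probability Om0 R).
Context (Y : R -> Om0 -> R).
Context {d : measure_display} {Om : measurableType d} (P : probability Om R).
Context (b : R -> Om -> R) (T : 'I_K -> R -> Om -> R).
Context {dA : measure_display} {OmA : measurableType dA} (PA : probability OmA R).
Context (A : 'I_K -> {RV PA >-> R}) (f g : R -> R) (Cg : R).
Local Notation m := (pmean P0 Y).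
Local Notation v := (pvar P0 Y).

Hypotheses (s2 : 2 < s) (s3 : s <= 3) (K0 : (0 < K)%N).
Hypothesis mY : measurable_family Y.
Hypothesis Tt : forall r t w, 0 <= t -> 0 <= T r t w <= t.
Hypothesis iY : forall t, 0 <= t ->
  P0.-integrable setT (fun w => (`|Y t w| `^ s)%:E).
Hypothesis supY : forall t, 0 <= t ->
  (ereal_sup [set 'E_P0[fun w => (`|Y u w| `^ s)%R] | u in `[0%R, t]] < +oo)%E.
Hypothesis EY : forall t,
  fine 'E_P0[Y t] = f t +o_(t \near +oo_R) Num.sqrt (g t).
Hypothesis VY : forall t, fine 'V_P0[Y t] = g t +o_(t \near +oo_R) g t.
Hypothesis bf : forall t, 0 < t -> has_ubound [set `|f u| | u in `[0, t]].
Hypothesis g0 : forall t, 0 <= t -> 0 <= g t.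
Hypothesis goo : g t @[t --> +oo] --> +oo.
Hypothesis Cg1 : 1 <= Cg.
Hypothesis gC : forall u t, 0 <= u <= t -> g u <= Cg * g t.
Hypothesis XA : ell_cvg s P
  (fun t w => [tuple Num.sqrt (g (T r t w) / g t) | r < K])
  PA (fun w => [tuple A r w | r < K]).
Hypothesis b0 : ell_cvg s P
  (fun t w => [tuple (b t w - f t + \sum_(r < K) f (T r t w)) / Num.sqrt (g t)])
  P (fun=> [tuple 0]).
Hypothesis A1 : {ae PA, forall w, \sum_(r < K) A r w ^+ 2 = 1}.
Hypothesis Alt1 : (PA [set w | exists r, A r w = 1%R] < 1)%E.

Lemma near_mean_var eps : 0 < eps -> \forall t \near +oo,
  `|m t - f t| <= eps * Num.sqrt (g t) /\ `|v t - g t| <= eps * g t.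
Proof.
move=> eps0.
have N0 : \forall t \near +oo, 0 <= t :> R by exact: nbhs_pinfty_ge.
have := littleo_pinfty _ _ _ VY eps eps0.
have := littleo_pinfty _ _ _ EY eps eps0.
apply: filterS3 N0 => t t0.
rewrite (ger0_norm (g0 t t0)) (ger0_norm (sqrtr_ge0 _)).
have -> : fine 'E_P0[Y t] = m t by rewrite /pmean max_l// unlock.
have -> // : fine 'V_P0[Y t] = v t.
rewrite /pvar /pmean max_l// /variance unlock unlock /Rintegral.
by congr fine; apply: eq_integral => w _; rewrite expr2.
Qed.

(** The random indices need not tend to infinity with [t], so the asymptotic estimates are extended
    to all times at the price of an additive constant, negligible against g(t). *)
Lemma close_mean_var eps : 0 < eps -> exists2 C : R, 0 <= C & forall u, 0 <= u ->
  `|m u - f u| <= eps * Num.sqrt (g u) + C /\ `|v u - g u| <= eps * g u + C.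
Proof.
move=> eps0; have [t0 t0_gt0 H] := near_pinftyP _ (near_mean_var eps eps0).
have [C1 C10 HC1] := local_moment_bound P0 Y s s2 s3 mY iY supY t0 (ltW t0_gt0).
have [F HF] := bf t0 t0_gt0.
(* On [0, t0] these bound the mean and the variance, [f], and [g] respectively. *)
exists (C1 + `|F| + Cg * g t0).
  by rewrite !addr_ge0// mulr_ge0 ?(le_trans ler01 Cg1)// g0// ltW.
move=> u u0; have [tu|ut] := leP t0 u.
  have [h1 h2] := H u tu.
  have C0 : 0 <= C1 + `|F| + Cg * g t0.
    by rewrite !addr_ge0// mulr_ge0 ?(le_trans ler01 Cg1)// g0// ltW.
  by split; lra.
have u01 : 0 <= u <= t0 by rewrite u0 ltW.
have [mC vC _] := HC1 u u01.
have fF : `|f u| <= `|F|.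
  apply: (@le_trans _ _ F); last exact: ler_norm.
  by apply: HF; exists u => //; rewrite /= in_itv.
have gu := gC u t0 u01; have gu0 := g0 u u0.
have v0 := pvar_ge0 P0 Y u.
have e1 : 0 <= eps * Num.sqrt (g u) by rewrite mulr_ge0 ?sqrtr_ge0// ltW.
have e2 : 0 <= eps * g u by rewrite mulr_ge0// ltW.
have n1 := normr_ge0 F.
split.
  by apply: (le_trans (ler_normB _ _)); lra.
by rewrite ler_norml; apply/andP; split; lra.
Qed.

Lemma near_ge (a : R) : \forall t \near +oo, a <= g t.
Proof. by move/cvgryPge : goo => /(_ a). Qed.

Let K1 : 1 <= K%:R :> R. Proof. by rewrite ler1n. Qed.

(** Each summand errs by at most [e * g (T r t w) + C]. Since g(T) <= Cg g(t), and C <= e g(t) for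
    large [t], the [K] summands give [K * (Cg + 1) * e] after division by g(t), uniformly in [w]. *)
Lemma near_mixvar eps : 0 < eps -> \forall t \near +oo, forall w,
  `|mixvar P0 Y T t w / g t - \sum_(r < K) g (T r t w) / g t| <= eps.
Proof.
move=> eps0; have [k1 cg1] := (K1, Cg1).
pose e := eps / (K%:R * (Cg + 1)).
have KC0 : 0 < K%:R * (Cg + 1) by rewrite mulr_gt0//; lra.
have e0 : 0 < e by rewrite divr_gt0.
have [C C0 HC] := close_mean_var e e0.
have N0 : \forall t \near +oo, 0 <= t :> R by exact: nbhs_pinfty_ge.
apply: filterS3 N0 (near_ge 1) (near_ge (C / e)) => t t0 g1 gC' w.
have gt0 : 0 < g t by lra.
rewrite -mulr_suml -mulrBl /mixvar -sumrB normrM (gtr0_norm (_ : 0 < (g t)^-1)) ?invr_gt0//.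
rewrite ler_pdivrMr//.
apply: (le_trans (ler_norm_sum _ _ _)).
apply: (@le_trans _ _ (\sum_(r < K) e * (Cg + 1) * g t)).
  apply: ler_sum => r _; have Tr := Tt r t w t0; have /andP[T0 _] := Tr.
  have [_ h] := HC (T r t w) T0; apply: (le_trans h).
  have h2 : e * g (T r t w) <= e * (Cg * g t).
    by apply: ler_wpM2l; [exact: ltW|exact: gC].
  have : C <= e * g t by rewrite -ler_pdivrMl// mulrC.
  lra.
rewrite sumr_const card_ord -mulr_natl.
rewrite [leLHS](_ : _ = (e * (K%:R * (Cg + 1))) * g t); last by ring.
by rewrite /e divfK// gt_eqF.
Qed.

(** Here [K + 1] means are exchanged for values of [f], each at a cost of at most [e * (Cg + 1)]
    after normalization; C <= e g(t)^(1/2) is what requires g(t) >= (C / e)^2. *)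
Lemma near_toll eps : 0 < eps -> \forall t \near +oo, forall w,
  `|toll P0 Y b T t w / Num.sqrt (g t) -
    (b t w - f t + \sum_(r < K) f (T r t w)) / Num.sqrt (g t)| <= eps.
Proof.
move=> eps0; have [k1 cg1] := (K1, Cg1).
pose e := eps / ((K%:R + 1) * (Cg + 1)).
have KC0 : 0 < (K%:R + 1) * (Cg + 1) by rewrite mulr_gt0//; lra.
have e0 : 0 < e by rewrite divr_gt0.
have [C C0 HC] := close_mean_var e e0.
have N0 : \forall t \near +oo, 0 <= t :> R by exact: nbhs_pinfty_ge.
apply: filterS3 N0 (near_ge 1) (near_ge ((C / e) ^+ 2)) => t t0 g1 gC' w.
have gt0 : 0 < g t by lra.
have sg0 : 0 < Num.sqrt (g t) by rewrite sqrtr_gt0.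
have Cs : C <= e * Num.sqrt (g t).
  rewrite -ler_pdivrMl// mulrC -(ger0_norm (_ : 0 <= C / e)); last first.
    by rewrite divr_ge0// ltW.
  by rewrite -sqrtr_sqr ler_wsqrtr.
rewrite -mulrBl normrM (gtr0_norm (_ : 0 < (Num.sqrt (g t))^-1)) ?invr_gt0//.
rewrite ler_pdivrMr// /toll.
have bnd u : 0 <= u <= t -> `|m u - f u| <= e * (Cg + 1) * Num.sqrt (g t).
  move=> ut; have /andP[u0 _] := ut; have [h _] := HC u u0.
  apply: (le_trans h).
  have : Num.sqrt (g u) <= Cg * Num.sqrt (g t).
    rewrite -[Cg in leRHS](ger0_norm (_ : 0 <= Cg)); last lra.
    rewrite -sqrtr_sqr -sqrtrM ?sqr_ge0// ler_wsqrtr//.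
    apply: (le_trans (gC u t ut)); rewrite ler_wpM2r//; first exact: ltW.
    by nra.
  move=> /(ler_wpM2l (ltW e0)); lra.
have -> : b t w - m t + \sum_(r < K) m (T r t w) -
    (b t w - f t + \sum_(r < K) f (T r t w)) =
    - (m t - f t) + \sum_(r < K) (m (T r t w) - f (T r t w)).
  by rewrite sumrB; ring.
apply: (le_trans (ler_normD _ _)); rewrite normrN.
apply: (@le_trans _ _ (e * (Cg + 1) * Num.sqrt (g t) +
    \sum_(r < K) e * (Cg + 1) * Num.sqrt (g t))).
  apply: lerD; first by apply: bnd; rewrite t0 lexx.
  apply: (le_trans (ler_norm_sum _ _ _)); apply: ler_sum => r _.
  by apply: bnd; exact: Tt.
rewrite sumr_const card_ord -mulr_natl.
rewrite [leLHS](_ : _ = (e * ((K%:R + 1) * (Cg + 1))) * Num.sqrt (g t)); last by ring.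
by rewrite /e divfK// gt_eqF.
Qed.

(** One constant for all truncations: it exceeds every ratio root, is at least 2 and so bounds the
    normalized standard deviation of Y_t, and its square exceeds [K * Cg + 1], which bounds the
    normalized [mixvar] for large [t]. *)
Definition ctrunc : R := K%:R * Cg + 2.

Lemma ctrunc_ge1 : 1 <= ctrunc.
Proof. by have [k1 cg1] := (K1, Cg1); rewrite /ctrunc; nra. Qed.

Lemma ratio_le r t w : 0 <= t -> 0 < g t -> g (T r t w) / g t <= Cg.
Proof. by move=> t0 gt0; rewrite ler_pdivrMr//; apply: gC; exact: Tt. Qed.

Lemma sqrt_ratio_le r t w : 0 <= t -> 0 < g t ->
  0 <= Num.sqrt (g (T r t w) / g t) <= ctrunc.
Proof.
move=> t0 gt0; have [k1 cg1] := (K1, Cg1); rewrite sqrtr_ge0/=.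
apply: (@le_trans _ _ (Num.sqrt (Cg ^+ 2))).
  rewrite ler_wsqrtr//; apply: (le_trans (ratio_le r t w t0 gt0)); nra.
by rewrite sqrtr_sqr ger0_norm /ctrunc; nra.
Qed.

Let sumK (a : R) : K%:R * a = \sum_(r < K) a.
Proof. by rewrite sumr_const card_ord mulr_natl. Qed.

Let mtuple (phi : R -> R) : measurable_fun [set: R] phi ->
  measurable_fun [set: K.-tuple R] (fun x : K.-tuple R => \sum_(r < K) phi (tnth x r)).
Proof.
move=> mphi; apply: measurable_sum => r.
exact: (measurableT_comp mphi (measurable_tnth r)).
Qed.

(** By [near_mixvar] it suffices to treat the sum of the squared weights. The mean of its distance
    to 1 is a Lipschitz functional of the truncated weights, and vanishes in the limit. *)
Lemma near_mixvar_mean eps : 0 < eps -> \forall t \near +oo,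
  (\int[P]_w (`|mixvar P0 Y T t w / g t - 1|)%:E <= eps%:E)%E.
Proof.
move=> eps0; have [k1 cg1] := (K1, Cg1).
have c0 : 0 <= ctrunc by have := ctrunc_ge1; lra.
pose phi (x : K.-tuple R) : R :=
  `|\sum_(r < K) clip (- ctrunc) ctrunc (tnth x r) ^+ 2 - 1|.
have mphi : measurable_fun [set: K.-tuple R] phi.
  apply: measurableT_comp; first exact: normr_measurable.
  apply: measurable_funB => //; apply: (mtuple (fun x => _ ^+ 2)).
  by apply: measurable_funX; exact: measurable_clip.
have e20 : 0 < eps / 2 by rewrite divr_gt0.
have s1 : 1 < s by move: s2; lra.
have L0 : 0 <= K%:R * (2 * ctrunc) by rewrite !mulr_ge0.
have lip (x y : K.-tuple R) :
    phi x <= phi y + K%:R * (2 * ctrunc) * enorm (tsub x y).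
  rewrite -lerBlDl /phi; apply: (le_trans (lerB_dist _ _)).
  rewrite [X in `|X|](_ : _ = \sum_(r < K) (clip (- ctrunc) ctrunc (tnth x r) ^+ 2
    - clip (- ctrunc) ctrunc (tnth y r) ^+ 2)); last by rewrite sumrB; ring.
  apply: (le_trans (ler_norm_sum _ _ _)).
  rewrite -mulrA sumK; apply: ler_sum => r _.
  apply: (le_trans (sqr_clip_lip _ _ _ c0)); apply: ler_wpM2l; first by rewrite mulr_ge0.
  by have := ler_tnth_enorm (tsub x y) r; rewrite tnth_mktuple.
have N0 : \forall t \near +oo, 0 <= t :> R by exact: nbhs_pinfty_ge.
have N1 := near_mixvar (eps / 2) e20.
have [mV _ _] := XA.
have H1 := ell_cvg_lipschitz s P _ PA _ s1 phi (K%:R * (2 * ctrunc)) (eps / 2)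
  XA mphi (fun x => normr_ge0 _) L0 lip e20.
have H2 : \forall t \near +oo, [/\ 0 <= t, 1 <= g t & forall w,
   `|mixvar P0 Y T t w / g t - \sum_(r < K) g (T r t w) / g t| <= eps / 2].
  by apply: filterS3 N0 (near_ge 1) N1.
apply: filterS3 H2 mV H1 => t [t0 g1 {}N1] [mVt _] {}H1.
have gt0 : 0 < g t by lra.
apply: (@le_trans _ _ (\int[P]_w ((phi [tuple Num.sqrt (g (T r t w) / g t) | r < K])%:E
    + (eps / 2)%:E))%E).
  apply: le_ge0_integral => w; first by rewrite lee_fin.
  rewrite -EFinD lee_fin /phi.
  rewrite (eq_bigr (fun r => g (T r t w) / g t)); last first.
    move=> r _; rewrite tnth_mktuple.
    have /andP[x0 xc] := sqrt_ratio_le r t w t0 gt0.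
    rewrite clip_id//; last by lra.
    rewrite sqr_sqrtr// divr_ge0 ?g0 ?(ltW gt0)//.
    by have /andP[] := Tt r t w t0.
  have := ler_normD (mixvar P0 Y T t w / g t - \sum_(r < K) g (T r t w) / g t)
    (\sum_(r < K) g (T r t w) / g t - 1).
  rewrite addrA subrK => /le_trans; apply.
  by rewrite addrC lerD2l.
rewrite ge0_integralD//; last 3 first.
- by move=> w _; rewrite lee_fin /phi.
- by apply/measurable_EFinP; exact: (measurableT_comp mphi mVt).
- by move=> w _; rewrite lee_fin ltW.
rewrite integral_cst//= probability_setT mule1.
have -> : eps%:E = ((eps / 2)%:E + (eps / 2)%:E)%E by rewrite -EFinD -splitr.
apply: leeD => //; apply: (le_trans H1).
have := limit_weights_sqr PA A ctrunc ctrunc_ge1 A1.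
rewrite /phi; under [X in (X + _)%E]eq_integral do
  under eq_bigr do rewrite tnth_mktuple.
by move=> ->; rewrite add0e.
Qed.

(** [xi] is the contraction factor: after division by g(t)^(s/2), the powers are those of the
    truncated weights, whose mean sum approaches a limit below 1. *)
Lemma near_weights : exists2 xi : R, 0 <= xi < 1 & \forall t \near +oo,
  (forall r, measurable_fun [set: Om] (fun w => Num.sqrt (g (T r t w)) `^ s)) /\
  (\int[P]_w (\sum_(r < K) Num.sqrt (g (T r t w)) `^ s)%:E <=
   (xi * Num.sqrt (g t) `^ s)%:E)%E.
Proof.
have [x0 /andP[x00 x01] Ex0] :=
  limit_weights_powR PA A s ctrunc s2 ctrunc_ge1 A1 Alt1.
(* Midpoint between the limit [x0] and 1, leaving room (1 - x0) / 2 for the error at finite [t]. *)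
exists ((1 + x0) / 2); first by apply/andP; split; lra.
have c0 : 0 <= ctrunc by have := ctrunc_ge1; lra.
pose phi (x : K.-tuple R) : R := \sum_(r < K) clip 0 ctrunc (tnth x r) `^ s.
have mphi : measurable_fun [set: K.-tuple R] phi.
  apply: (mtuple (fun x => clip 0 ctrunc x `^ s)).
  exact: (measurableT_comp (measurable_powR s) (measurable_clip _ _)).
have e20 : 0 < (1 - x0) / 2 by lra.
have s1 : 1 < s by move: s2; lra.
have L0 : 0 <= K%:R * (3 * ctrunc ^+ 2) by rewrite !mulr_ge0 ?exprn_ge0.
have lip (x y : K.-tuple R) :
    phi x <= phi y + K%:R * (3 * ctrunc ^+ 2) * enorm (tsub x y).
  rewrite -mulrA sumK -big_split/=.
  apply: ler_sum => r _.
  apply: (le_trans (powR_clip_lip s _ _ (tnth y r) s2 s3 ctrunc_ge1)).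
  rewrite lerD2l; apply: ler_wpM2l; first by rewrite mulr_ge0 ?exprn_ge0.
  by have := ler_tnth_enorm (tsub x y) r; rewrite tnth_mktuple.
have phi0 x : 0 <= phi x by apply: sumr_ge0 => r _; exact: powR_ge0.
have N0 : \forall t \near +oo, 0 <= t :> R by exact: nbhs_pinfty_ge.
have [mV _ _] := XA.
have H1 := ell_cvg_lipschitz s P _ PA _ s1 phi _ _ XA mphi phi0 L0 lip e20.
have H2 : \forall t \near +oo, 0 <= t /\ 1 <= g t by apply: filterS2 N0 (near_ge 1).
apply: filterS3 H2 mV H1 => t [t0 g1] [mVt _] {}H1.
have gt0 : 0 < g t by lra.
have sE r w : Num.sqrt (g (T r t w)) `^ s =
    Num.sqrt (g t) `^ s * clip 0 ctrunc (Num.sqrt (g (T r t w) / g t)) `^ s.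
  have /andP[y0 yc] := sqrt_ratio_le r t w t0 gt0.
  rewrite clip_id// -powRM ?sqrtr_ge0// -sqrtrM ?(ltW gt0)//.
  by rewrite mulrCA divff ?mulr1// gt_eqF.
(* [g] is an arbitrary function, so the measurability of its value at a random index is read off the
   random vectors in the convergence hypothesis. *)
have mr r : measurable_fun [set: Om] (fun w => Num.sqrt (g (T r t w) / g t)).
  apply: (eq_measurable_fun (fun w => tnth [tuple Num.sqrt (g (T r t w) / g t) | r < K] r)).
    by move=> w _; rewrite tnth_mktuple.
  exact: (measurableT_comp (measurable_tnth r) mVt).
split.
  move=> r; under eq_fun do rewrite sE.
  apply: measurable_funM => //; apply: (measurableT_comp (measurable_powR s)).
  exact: (measurableT_comp (measurable_clip _ _)).
rewrite (eq_integral (fun w => (Num.sqrt (g t) `^ s)%:E *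
    (phi [tuple Num.sqrt (g (T r t w) / g t) | r < K])%:E)%E); last first.
  move=> w _; rewrite -EFinM /phi mulr_sumr; congr EFin; apply: eq_bigr => r _.
  by rewrite sE tnth_mktuple.
rewrite ge0_integralZl//; last 2 first.
- by apply/measurable_EFinP; exact: (measurableT_comp mphi mVt).
- by move=> w _; rewrite lee_fin.
rewrite mulrC EFinM; apply: lee_wpmul2l; first by rewrite lee_fin powR_ge0.
apply: (le_trans H1); rewrite /phi.
under [X in (X + _)%E]eq_integral do under eq_bigr do rewrite tnth_mktuple.
by rewrite Ex0 -EFinD lee_fin; lra.
Qed.

Lemma near_toll_moment eps : 0 < eps -> \forall t \near +oo,
  (\int[P]_w (`|toll P0 Y b T t w / Num.sqrt (g t)| `^ s)%:E <= eps%:E)%E.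
Proof.
(* 8 (a^s + e^s) is integrated with the mean of a^s at most e and, as e <= 1, e^s <= e: the total 16
   e is at most eps. *)
move=> eps0; pose e := Num.min (eps / 16) 1.
have e0 : 0 < e by rewrite lt_min divr_gt0//=.
have e16 : e <= eps / 16 by rewrite ge_min lexx.
have e1 : e <= 1 by rewrite ge_min lexx orbT.
have s1 : 1 < s by move: s2; lra.
have s0 : 0 <= s by lra.
have H1 := ell_cvg0 s P _ P e s1 b0 e0.
apply: filterS2 H1 (near_toll e e0) => t [mb H1] H2.
set bt := fun w => (b t w - f t + \sum_(r < K) f (T r t w)) / Num.sqrt (g t).
apply: (@le_trans _ _ (\int[P]_w (8%:E * ((`|bt w| `^ s)%:E + e%:E)))%E).
  apply: le_ge0_integral => w; first by rewrite lee_fin powR_ge0.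
  rewrite -EFinD -EFinM lee_fin.
  apply: (@le_trans _ _ ((`|bt w| + e) `^ s)).
    apply: ge0_ler_powR; rewrite ?nnegrE ?addr_ge0// ?(ltW e0)//.
    have := H2 w; rewrite -/(bt w) => h.
    have := ler_normD (bt w) (toll P0 Y b T t w / Num.sqrt (g t) - bt w).
    rewrite addrC subrK => /le_trans; apply.
    by rewrite lerD2l.
  apply: (le_trans (powR_addr_le s _ _ s0 s3 (normr_ge0 _) (ltW e0))).
  rewrite ler_pM2l// lerD2l; apply: ge1r_powR; last exact: ltW.
  by rewrite e0.
have mbt : measurable_fun [set: Om] (fun w => (`|bt w| `^ s)%:E).
  by apply/measurable_EFinP; exact: measurable_abs_powR.
rewrite ge0_integralZl//; last 2 first.
- by apply: emeasurable_funD.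
- by move=> w _; rewrite -EFinD lee_fin addr_ge0 ?powR_ge0// ltW.
rewrite ge0_integralD//; last first.
  by move=> w _; rewrite lee_fin ltW.
rewrite integral_cst//= probability_setT mule1.
apply: (@le_trans _ _ (8%:E * (e%:E + e%:E))%E).
  by apply: lee_wpmul2l => //; apply: leeD.
by rewrite -EFinD -EFinM lee_fin; lra.
Qed.
End asymptotics.

(** * Weak convergence *)

Section smooth_step.
Context {R : realType}.
Implicit Types x y z : R.

Local Notation pos x := (Num.max (x : R) 0).

Let posge x : 0 <= pos x. Proof. by rewrite le_max lexx orbT. Qed.

Let pos_lip x y : `|pos x - pos y| <= `|x - y|.
Proof.
have [x0|x0] := leP x 0; have [y0|y0] := leP y 0.
all: rewrite ?subrr ?normr0 ?normr_ge0// ?sub0r ?subr0 ?normrN.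
- rewrite gtr0_norm// distrC ger0_norm; lra.
- rewrite gtr0_norm// ger0_norm; lra.
Qed.

Let pos_cube_lip x y a b : 0 <= a -> 0 <= b -> pos x <= a -> pos y <= b ->
  `|pos x ^+ 3 - pos y ^+ 3| <= (a + b) ^+ 2 * `|x - y|.
Proof.
move=> a0 b0 xa yb; have [px py] := (posge x, posge y).
rewrite (_ : pos x ^+ 3 - pos y ^+ 3 = (pos x ^+ 2 + pos x * pos y + pos y ^+ 2) *
  (pos x - pos y)); last by ring.
rewrite normrM ler_pM//; move: (pos x) (pos y) xa yb px py => u v xa yb px py.
by rewrite ger0_norm; nra.
Qed.

(** For x <= 0 the Taylor terms vanish and the positive parts at x + y, x + z are at most |y|, |z|.
    For x > 0 the truncated cube is u^3 plus the truncated cube of -u: the former has remainder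
    exactly z^3 - y^3, the latter falls under the previous argument. *)
Let pos_cube_taylor x y z :
  `|pos (x + z) ^+ 3 - pos (x + y) ^+ 3 - 3 * pos x ^+ 2 * (z - y)
    - 3 * pos x * (z ^+ 2 - y ^+ 2)| <= 2 * ((`|y| + `|z|) ^+ 2 * `|z - y|).
Proof.
have zy : x + z - (x + y) = z - y by ring.
have [x0|x0] := leP x 0.
  rewrite expr0n/= !mulr0 !mul0r !subr0.
  have pz : pos (x + z) <= `|z|.
    by rewrite ge_max normr_ge0 andbT; have := ler_norm z; lra.
  have py : pos (x + y) <= `|y|.
    by rewrite ge_max normr_ge0 andbT; have := ler_norm y; lra.
  have := pos_cube_lip _ _ _ _ (normr_ge0 z) (normr_ge0 y) pz py.
  rewrite zy [`|z| + _]addrC; have : 0 <= (`|y| + `|z|) ^+ 2 * `|z - y|.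
    by rewrite mulr_ge0// sqr_ge0.
  lra.
have pz : pos (- (x + z)) <= `|z|.
  by rewrite ge_max normr_ge0 andbT; have := ler_norm (- z); rewrite normrN; lra.
have py : pos (- (x + y)) <= `|y|.
  by rewrite ge_max normr_ge0 andbT; have := ler_norm (- y); rewrite normrN; lra.
have cubeE u : pos u ^+ 3 = u ^+ 3 + pos (- u) ^+ 3.
  have [u0|u0] := leP u 0; have [v0|v0] := leP (- u) 0.
  - have -> : u = 0 by lra.
    by ring.
  - by ring.
  - by ring.
  - by exfalso; lra.
rewrite (cubeE (x + z)) (cubeE (x + y)).
have := pos_cube_lip _ _ _ _ (normr_ge0 z) (normr_ge0 y) pz py.
rewrite (_ : - (x + z) - - (x + y) = - (z - y)) ?normrN; last by ring.
rewrite [`|z| + _]addrC.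
set a := _ ^+ 3 in pz py *; set b := pos (- (x + y)) ^+ 3 => ab.
have zy3 : `|z ^+ 3 - y ^+ 3| <= (`|y| + `|z|) ^+ 2 * `|z - y|.
  rewrite (_ : z ^+ 3 - y ^+ 3 = (z ^+ 2 + z * y + y ^+ 2) * (z - y)); last by ring.
  rewrite normrM ler_wpM2r//; apply: (le_trans (ler_normD _ _)).
  rewrite (ger0_norm (sqr_ge0 y)).
  apply: (@le_trans _ _ (`|z ^+ 2| + `|z * y| + y ^+ 2)).
    by rewrite lerD2r ler_normD.
  rewrite (ger0_norm (sqr_ge0 z)) normrM -(real_normK (num_real z)) -(real_normK (num_real y)).
  by have := mulr_ge0 (normr_ge0 y) (normr_ge0 z); nra.
rewrite (_ : _ - _ = (z ^+ 3 - y ^+ 3) + (a - b)); last by ring.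
by apply: (le_trans (ler_normD _ _)); lra.
Qed.

(* The integral of the quadratic B-spline on [0, 3]. *)
Definition smooth_step x : R := (pos x ^+ 3 - 3 * pos (x - 1) ^+ 3 +
  3 * pos (x - 2) ^+ 3 - pos (x - 3) ^+ 3) / 6.

(** The B-spline itself, derivative of [smooth_step]. *)
Let step1 x : R := (pos x ^+ 2 - 3 * pos (x - 1) ^+ 2 +
  3 * pos (x - 2) ^+ 2 - pos (x - 3) ^+ 2) / 2.

(** Half the second derivative, as the convention of [taylor2] requires. *)
Let step2 x : R := (pos x - 3 * pos (x - 1) + 3 * pos (x - 2) - pos (x - 3)) / 2.

Let step_bounds x : [/\ 0 <= smooth_step x <= 1, 0 <= step1 x <= 1 & `|step2 x| <= 1].
Proof.
rewrite /smooth_step /step1 /step2 ler_norml.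
have [h0|h0] := leP x 0; have [h1|h1] := leP (x - 1) 0; have [h2|h2] := leP (x - 2) 0;
  have [h3|h3] := leP (x - 3) 0; try by exfalso; lra.
- by split; apply/andP; split; lra.
- by split; apply/andP; split; nra.
- have {h1}[u0 u1] : 0 < x - 1 /\ x - 1 <= 1 by lra.
  have -> : x = (x - 1) + 1 by ring.
  move: (x - 1) u0 u1 => u u0 u1.
  by split; apply/andP; split; nra.
- have [u0 u1] : 0 <= 3 - x /\ 3 - x < 1 by lra.
  have -> : x = 3 - (3 - x) by ring.
  move: (3 - x) u0 u1 => u u0 u1.
  by split; apply/andP; split; nra.
- by split; apply/andP; split; lra.
Qed.

Lemma smooth_step_ge0 x : 0 <= smooth_step x.
Proof. by have [/andP[]] := step_bounds x. Qed.

Lemma smooth_step_le1 x : smooth_step x <= 1.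
Proof. by have [/andP[]] := step_bounds x. Qed.

Lemma smooth_step0 x : x <= 0 -> smooth_step x = 0.
Proof. by move=> x0; rewrite /smooth_step !max_r; lra. Qed.

Lemma smooth_step1 x : 3 <= x -> smooth_step x = 1.
Proof. by move=> x0; rewrite /smooth_step !max_l; lra. Qed.

(** The four truncated cubes have weights 1, 3, 3, 1 over 6, so the constant 2 becomes 16/6, rounded
    up to 3. *)
Let step_taylor x y z :
  `|smooth_step (x + z) - smooth_step (x + y) - step1 x * (z - y)
    - step2 x * (z ^+ 2 - y ^+ 2)| <= 3 * ((`|y| + `|z|) ^+ 2 * `|z - y|).
Proof.
have T (k : R) := pos_cube_taylor (x - k) y z.
have := (T 0, T 1, T 2, T 3); rewrite subr0.
have E k u : x - k + u = x + u - k by ring.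
rewrite !E /smooth_step /step1 /step2.
set N := _ * `|z - y|.
have N0 : 0 <= N by rewrite mulr_ge0// sqr_ge0.
rewrite !ler_norml => -[[[/andP[? ?] /andP[? ?]] /andP[? ?]] /andP[? ?]].
by apply/andP; split; lra.
Qed.

(** For increments shorter than 1 the Taylor estimate gives 1 + 1 + 3 = 5, from the linear,
    quadratic and remainder terms; longer ones are trivial as the values lie in [0, 1]. *)
Lemma smooth_step_lip x y : `|smooth_step x - smooth_step y| <= 5 * `|x - y|.
Proof.
have [xy|xy] := leP 1 `|x - y|.
  have := smooth_step_ge0 x; have := smooth_step_le1 x.
  have := smooth_step_ge0 y; have := smooth_step_le1 y => *.
  by apply: (@le_trans _ _ 1); [rewrite ler_norml; apply/andP; split|]; lra.
have := step_taylor y 0 (x - y); rewrite normr0 add0r subr0 addr0.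
rewrite (_ : y + (x - y) = x); last by ring.
have [_ B1 B2] := step_bounds y; move: B1 B2.
set a := step1 y; set b := step2 y; set u := x - y in xy *; rewrite expr0n/= subr0.
set D := _ - smooth_step y => /andP[a0 a1] b1 H.
have u0 := normr_ge0 u.
have h1 : `|a * u| <= `|u| by rewrite normrM (ger0_norm a0); nra.
have h2 : `|b * u ^+ 2| <= `|u|.
  by rewrite normrM normrX; have := normr_ge0 b; nra.
have h3 : 3 * (`|u| ^+ 2 * `|u|) <= 3 * `|u| by nra.
have -> : D = (D - a * u - b * u ^+ 2) + (a * u + b * u ^+ 2) by ring.
apply: (le_trans (ler_normD _ _)); have := ler_normD (a * u) (b * u ^+ 2); lra.
Qed.

Lemma continuous_smooth_step : continuous smooth_step.
Proof.
move=> x; apply/cvgrPdist_le => e e0; near=> y.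
apply: (le_trans (smooth_step_lip x y)).
rewrite -ler_pdivlMl//; near: y; apply: cvgr_dist_le => //.
by rewrite mulr_gt0.
Unshelve. all: by end_near. Qed.

(** With N = |y| + |z|: for N <= 1 the cubic estimate suffices since N^2 <= N^(s-1); for N > 1 the
    terms are bounded separately by 5 + 1 + N <= 7 N^(s-1), whence the divisor 7. *)
Lemma zclass_smooth_step (s : R) : 2 < s -> s <= 3 ->
  zclass s (fun x => smooth_step x / 7).
Proof.
move=> s2 s3; split.
- by move=> x; apply: cvgM; [exact: continuous_smooth_step|exact: cvg_cst].
- exists 1 => x; have := smooth_step_ge0 x; have := smooth_step_le1 x => *.
  by apply/andP; split; lra.
exists (fun x => step1 x / 7), (fun x => step2 x / 7) => x y z.
set N := `|y| + `|z|; have N0 : 0 <= N by rewrite addr_ge0.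
have zyN : `|z - y| <= N by rewrite /N [`|y| + _]addrC ler_normB.
rewrite [leLHS](_ : _ = `|smooth_step (x + z) - smooth_step (x + y)
    - step1 x * (z - y) - step2 x * (z ^+ 2 - y ^+ 2)| / 7); last first.
  rewrite -[X in _ = _ * X](@ger0_norm _ 7^-1)// -normrM; congr `|_|; by field.
rewrite ler_pdivrMr//.
have [N1|N1] := leP N 1.
  apply: (le_trans (step_taylor x y z)); rewrite -/N.
  have : N ^+ 2 <= N `^ (s - 1).
    have [->|N0'] := eqVneq N 0; first by rewrite expr0n/= powR_ge0.
    have -> : N ^+ 2 = N `^ (s - 1) * N `^ (3 - s).
      rewrite -powRD ?N0' ?implybT// -powR_mulrn//; congr (N `^ _); ring.
    rewrite -[leRHS]mulr1 ler_wpM2l ?powR_ge0//.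
    rewrite [leRHS](_ : 1 = 1 `^ (3 - s)); last by rewrite powR1.
    by apply: ge0_ler_powR; rewrite ?nnegrE//; lra.
  move/(ler_wpM2r (normr_ge0 (z - y))); have := normr_ge0 (z - y).
  by have := powR_ge0 N (s - 1); set a := N `^ _; set b := `|z - y|; nra.
have [_ /andP[a0 a1] b1] := step_bounds x.
have NN : N <= N `^ (s - 1).
  by rewrite -{1}(powRr1 N0); apply: ler_powR; lra.
have h1 := smooth_step_lip (x + z) (x + y).
have h2 : `|step1 x * (z - y)| <= `|z - y| by rewrite normrM (ger0_norm a0) ler_piMl.
have h3 : `|step2 x * (z ^+ 2 - y ^+ 2)| <= N * `|z - y|.
  rewrite (_ : z ^+ 2 - y ^+ 2 = (z + y) * (z - y)); last by ring.
  rewrite mulrA normrM ler_wpM2r// normrM.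
  have : `|z + y| <= N by rewrite /N [`|y| + _]addrC ler_normD.
  by have := normr_ge0 (z + y); have := normr_ge0 (step2 x); nra.
move: h1; rewrite (_ : x + z - (x + y) = z - y); last by ring.
move=> h1.
apply: (@le_trans _ _ ((6 + N) * `|z - y|)).
  apply: (le_trans (ler_normB _ _)).
  have := ler_normB (smooth_step (x + z) - smooth_step (x + y)) (step1 x * (z - y)).
  by lra.
rewrite mulrAC ler_wpM2r//; lra.
Qed.
End smooth_step.

(** [y] may leave the interval. A radius of continuity at each center is halved, so that [x] and [y]
    both stay within it, and compactness makes the halves uniform. *)
Lemma compact_unif_cont {R : realType} (h : R -> R) (B eps : R) : continuous h -> 0 < eps ->
  exists2 delta, 0 < delta & forall x y, `|x| <= B -> `|x - y| <= delta -> `|h x - h y| <= eps.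
Proof.
move=> ch e0.
have /compact_near_coveringP cov : compact `[- B, B].
  exact: segment_compact.
pose Q (delta x : R) := forall y, `|x - y| <= delta -> `|h x - h y| <= eps.
have : \forall delta \near 0^'+, `[- B, B] `<=` Q delta.
  apply: cov => x _.
  have e20 : 0 < eps / 2 by rewrite divr_gt0.
  have /cvgrPdist_le /(_ _ e20) [r /= r0 Hr] := ch x.
  have r20 : 0 < r / 2 by rewrite divr_gt0.
  exists ([set x' | `|x - x'| < r / 2], [set delta | delta < r / 2]).
    by split; [exists (r / 2)|exact: nbhs_right_lt].
  move=> [x' delta] /= [xx' dr] y x'y.
  have h1 : `|h x - h x'| <= eps / 2 by apply: Hr; rewrite /ball_/=; lra.
  have h2 : `|h x - h y| <= eps / 2.
    apply: Hr; rewrite /ball_ /= (_ : x - y = (x - x') + (x' - y)); last by ring.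
    by have := ler_normD (x - x') (x' - y); lra.
  rewrite (_ : h x' - h y = (h x - h y) - (h x - h x')); last by ring.
  by apply: (le_trans (ler_normB _ _)); lra.
move=> cov'.
have [delta [d0 Hd]] := @filter_ex _ _ _ _ (filterI (nbhs_right_gt 0) cov').
by exists delta => // x y xB; apply: Hd; rewrite /= in_itv/= -ler_norml.
Qed.

(** Interpolates [h] at the nodes a + i delta. A step rises over a length of 3, so the factor 3 /
    delta makes step [i] rise exactly between nodes [i] and [i + 1]. *)
Definition step_interp {R : realType} (h : R -> R) (a delta : R) (n : nat) (x : R) : R :=
  h a + \sum_(i < n) (h (a + i.+1%:R * delta) - h (a + i%:R * delta)) *
    smooth_step (delta^-1 * 3 * x - (delta^-1 * 3 * a + 3 * i%:R)).

Section interp.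
Context {R : realType}.

Lemma step_interpS (h : R -> R) a delta n x : step_interp h a delta n.+1 x =
  step_interp h a delta n x + (h (a + n.+1%:R * delta) - h (a + n%:R * delta)) *
    smooth_step (delta^-1 * 3 * x - (delta^-1 * 3 * a + 3 * n%:R)).
Proof. by rewrite /step_interp big_ord_recr addrA. Qed.

Lemma step_interp_last (h : R -> R) a delta n x : 0 < delta ->
  a + n%:R * delta <= x -> step_interp h a delta n x = h (a + n%:R * delta).
Proof.
move=> d0; elim: n => [|n IH] ax.
  by rewrite /step_interp big_ord0 mul0r !addr0.
have an : a + n%:R * delta <= x by move: ax; rewrite -natr1; lra.
rewrite step_interpS IH// smooth_step1 ?mulr1 ?subrKC//.
have : delta^-1 * (a + n.+1%:R * delta) <= delta^-1 * x by rewrite ler_wpM2l// invr_ge0 ltW.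
rewrite mulrDr mulrCA mulVf ?gt_eqF// mulr1 -natr1; lra.
Qed.

(** At any point at most one step is rising, so the interpolant is a convex combination of the
    values of [h] at two neighbouring nodes. *)
Lemma step_interp_approx (h : R -> R) (M a delta eps : R) n : 0 < delta -> 0 <= eps ->
  (forall x, `|h x| <= M) ->
  (forall i x y, (i < n)%N -> a + i%:R * delta <= x <= a + i.+1%:R * delta ->
    `|x - y| <= delta -> `|h x - h y| <= eps) ->
  forall x, `|step_interp h a delta n x| <= M /\
    (a <= x <= a + n%:R * delta -> `|h x - step_interp h a delta n x| <= eps).
Proof.
move=> d0 eps0 hM; elim: n => [|n IH] he x.
  rewrite /step_interp big_ord0 addr0 mul0r addr0; split; first exact: hM.
  move=> ax; have -> : x = a by lra.
  by rewrite subrr normr0.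
have {}IH := IH (fun i x y ii => he i x y (ltnW ii)).
have [IH1 IH2] := IH x; rewrite step_interpS.
have [xn|xn] := leP x (a + n%:R * delta).
  rewrite smooth_step0 ?mulr0 ?addr0.
    by split=> // /andP[ax _]; apply: IH2; rewrite ax.
  have : delta^-1 * x <= delta^-1 * (a + n%:R * delta) by rewrite ler_wpM2l// invr_ge0 ltW.
  rewrite mulrDr mulrCA mulVf ?gt_eqF// mulr1; lra.
rewrite step_interp_last ?(ltW xn)//.
set S := smooth_step _; have S0 : 0 <= S := smooth_step_ge0 _.
have S1 : S <= 1 := smooth_step_le1 _.
have M1 := hM (a + n%:R * delta); have M2 := hM (a + n.+1%:R * delta).
split.
  move: M1 M2; rewrite !ler_norml => /andP[? ?] /andP[? ?].
  by apply/andP; split; nra.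
move=> /andP[_ xn1].
have xI : a + n%:R * delta <= x <= a + n.+1%:R * delta by rewrite (ltW xn).
have e1 : `|h x - h (a + n%:R * delta)| <= eps.
  by apply: (he n) => //; move: xn1; rewrite -natr1 ger0_norm; lra.
have e2 : `|h x - h (a + n.+1%:R * delta)| <= eps.
  by apply: (he n) => //; move: xn1; rewrite -natr1 ler0_norm; lra.
move: e1 e2; rewrite !ler_norml => /andP[? ?] /andP[? ?].
by apply/andP; split; nra.
Qed.
End interp.

(** Convergence for a single test function, bundled with continuity and boundedness so as to be
    stable under linear combinations. *)
Definition mean_cvg {R : realType} {d : measure_display} {T : measurableType d}
    (P : probability T R) (X : R -> T -> R) (nu : probability (measurableTypeR R) R)
    (h : R -> R) : Prop :=
  [/\ continuous h, exists M, forall x, `|h x| <= M &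
    forall eps : R, 0 < eps -> \forall t \near +oo,
      `|\int[P]_w h (X t w) - \int[nu]_y h y| <= eps].

Section mean_cvg.
Context {R : realType} {d : measure_display} {T : measurableType d}.
Context (P : probability T R) (X : R -> T -> R) (nu : probability (measurableTypeR R) R).
Hypothesis mX : \forall t \near +oo, measurable_fun [set: T] (X t).
Local Notation good := (mean_cvg P X nu).

Lemma bounded_continuous_integrable {d' : measure_display} {U : measurableType d'}
    (Q : probability U R) (Z : U -> R) (h : R -> R) (M : R) :
  measurable_fun [set: U] Z -> continuous h -> (forall x, `|h x| <= M) ->
  Q.-integrable [set: U] (EFin \o (fun w => h (Z w))).
Proof.
move=> mZ ch hM; apply: (integrable_bounded Q _ M) => //.
exact: (measurableT_comp (continuous_measurable_fun ch) mZ).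
Qed.

Lemma mean_cvg_cst (c : R) : good (fun=> c).
Proof.
split; first by move=> x; exact: cvg_cst.
  by exists (`|c|).
move=> eps e0; apply: nearW => t.
by rewrite !Rintegral_cst_prob subrr normr0 ltW.
Qed.

Lemma mean_cvgD (h1 h2 : R -> R) : good h1 -> good h2 -> good (fun x => h1 x + h2 x).
Proof.
move=> [c1 [M1 B1] E1] [c2 [M2 B2] E2]; split.
- by move=> x; apply: cvgD; [exact: c1|exact: c2].
- by exists (M1 + M2) => x; apply: (le_trans (ler_normD _ _)); exact: lerD.
move=> eps e0; have e20 : 0 < eps / 2 by rewrite divr_gt0.
apply: filterS3 mX (E1 _ e20) (E2 _ e20) => t mt h1t h2t.
have mid : measurable_fun [set: measurableTypeR R] (fun y : measurableTypeR R => y : R).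
  exact: measurable_id.
have i1 := bounded_continuous_integrable P (X t) h1 M1 mt c1 B1.
have i2 := bounded_continuous_integrable P (X t) h2 M2 mt c2 B2.
have j1 := bounded_continuous_integrable nu _ h1 M1 mid c1 B1.
have j2 := bounded_continuous_integrable nu _ h2 M2 mid c2 B2.
rewrite !RintegralD//.
rewrite [X in `|X|](_ : _ = (\int[P]_w h1 (X t w) - \int[nu]_y h1 y) +
  (\int[P]_w h2 (X t w) - \int[nu]_y h2 y)); last by ring.
by apply: (le_trans (ler_normD _ _)); lra.
Qed.

Lemma mean_cvgZ (k : R) (h : R -> R) : good h -> good (fun x => k * h x).
Proof.
move=> [c [M B] E]; split.
- by move=> x; apply: cvgM; [exact: cvg_cst|exact: c].
- by exists (`|k| * M) => x; rewrite normrM ler_wpM2l.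
move=> eps e0; have k0 : 0 < `|k| + 1 by have := normr_ge0 k; lra.
have ek0 : 0 < eps / (`|k| + 1) by rewrite divr_gt0.
apply: filterS2 mX (E _ ek0) => t mt ht.
have mid : measurable_fun [set: measurableTypeR R] (fun y : measurableTypeR R => y : R).
  exact: measurable_id.
have i := bounded_continuous_integrable P (X t) h M mt c B.
have j := bounded_continuous_integrable nu _ h M mid c B.
rewrite !RintegralZl// -mulrBr normrM.
have := ler_pM (normr_ge0 k) (normr_ge0 _) (_ : `|k| <= `|k| + 1) ht.
rewrite mulrCA divff ?(gt_eqF k0)// mulr1; apply; lra.
Qed.

Lemma mean_cvg_sum n (c : nat -> R) (h : nat -> R -> R) : (forall i, good (h i)) ->
  good (fun x => \sum_(i < n) c i * h i x).
Proof.
move=> H; elim: n => [|n IH].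
  rewrite (_ : (fun _ => _) = fun=> 0); first exact: mean_cvg_cst.
  by apply/funext => x; rewrite big_ord0.
rewrite (_ : (fun _ => _) = fun x => \sum_(i < n) c i * h i x + c n * h n x).
  by apply: mean_cvgD => //; exact: mean_cvgZ.
by apply/funext => x; rewrite big_ord_recr.
Qed.

(** [k] absorbs the error where [H] is a poor approximation. Its mean under the law of [X t] is
    controlled through its own convergence, which takes the place of tightness. *)
Lemma mean_cvg_approx (h : R -> R) (M : R) : continuous h -> (forall x, `|h x| <= M) ->
  (forall eps : R, 0 < eps -> exists H k, [/\ good H, good k,
    forall x, `|h x - H x| <= eps + k x & \int[nu]_y k y <= eps]) -> good h.
Proof.
move=> ch hM app; split=> //; first by exists M.
move=> eps e0; have e80 : 0 < eps / 8 by rewrite divr_gt0.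
have [H [k [[cH [MH BH] EH] [ck [Mk Bk] Ek] Hk nuk]]] := app _ e80.
apply: filterS3 mX (EH _ e80) (Ek _ e80) => t mt.
have mid : measurable_fun [set: measurableTypeR R] (fun y : measurableTypeR R => y : R).
  exact: measurable_id.
have aux (d' : measure_display) (U : measurableType d') (Q : probability U R) (Z : U -> R) :
  measurable_fun [set: U] Z ->
  `|\int[Q]_w h (Z w) - \int[Q]_w H (Z w)| <= eps / 8 + \int[Q]_w k (Z w).
  move=> mZ.
  have ih := bounded_continuous_integrable Q Z h M mZ ch hM.
  have iH := bounded_continuous_integrable Q Z H MH mZ cH BH.
  have ik := bounded_continuous_integrable Q Z k Mk mZ ck Bk.
  rewrite -RintegralB//; apply: le_trans (le_normr_Rintegral _ _) _ => //.
    exact: integrable_realB.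
  apply: (@le_trans _ _ (\int[Q]_w (eps / 8 + k (Z w)))).
    apply: le_Rintegral => //.
    - by apply: integrable_norm; exact: integrable_realB.
    - by apply: integrable_realD => //; exact: integrable_cst_prob.
  rewrite RintegralD//; last exact: integrable_cst_prob.
  by rewrite Rintegral_cst_prob.
have := aux _ _ P (X t) mt; have := aux _ _ nu _ mid.
rewrite !ler_norml => /andP[? ?] /andP[? ?] /andP[? ?] /andP[? ?].
by apply/andP; split; lra.
Qed.

(** On a large interval [h] is uniformly close to a combination of steps; outside, the error is
    majorized by another combination of steps, whose mean under [nu] is small by Chebyshev. *)
Lemma mean_cvg_of_steps :
  (forall a c : R, 0 < a -> good (fun x => smooth_step (a * x - c))) ->
  nu.-integrable [set: R] (EFin \o (fun x : R => x ^+ 2)) ->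
  forall (h : R -> R) (M : R), continuous h -> (forall x, `|h x| <= M) -> good h.
Proof.
move=> steps nu2 h M ch hM; apply: (mean_cvg_approx h M ch hM) => eps e0.
have M0 : 0 <= M := le_trans (normr_ge0 _) (hM 0).
set V := \int[nu]_x (x ^+ 2).
have V0 : 0 <= V by apply: Rintegral_ge0 => x _; exact: sqr_ge0.
(* Chosen for Chebyshev: 2 M V <= eps L0 and L0 >= 1 give 2 M V / L0^2 <= eps. *)
pose L0 := 2 * M * V / eps + 1.
have L01 : 1 <= L0 by rewrite lerDr divr_ge0 ?mulr_ge0// ltW.
(* The length 3 is the width of a step, needed by the transition between L0 and L. *)
pose L := L0 + 3.
have [delta' d'0 Hd'] := compact_unif_cont h (L + 1) eps ch e0.
pose delta := Num.min delta' 1.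
have d0 : 0 < delta by rewrite lt_min d'0 ltr01.
have d1 : delta <= 1 by rewrite ge_min lexx orbT.
have dd' : delta <= delta' by rewrite ge_min lexx.
(* Enough nodes to cover [-L, L], yet the last one is at most L + 1, the range on which [delta']
   works. *)
pose n := (Num.trunc (2 * L / delta)).+1.
have Ld0 : 0 <= 2 * L / delta by rewrite divr_ge0 ?(ltW d0)// /L; lra.
have n1 : L <= - L + n%:R * delta.
  have : 2 * L / delta * delta <= n%:R * delta.
    by rewrite ler_wpM2r ?(ltW d0)// ltW//; have /andP[] := truncn_itv Ld0.
  by rewrite divfK ?(gt_eqF d0)//; lra.
have n2 : - L + n%:R * delta <= L + 1.
  have : n%:R * delta <= 2 * L / delta * delta + delta.
    have -> : n%:R = (Num.trunc (2 * L / delta))%:R + 1 :> R by rewrite natr1.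
    rewrite mulrDl mul1r lerD2r ler_wpM2r ?(ltW d0)//.
    by have /andP[] := truncn_itv Ld0.
  by rewrite divfK ?(gt_eqF d0)//; lra.
(* [k] is nonnegative, is at least [2 * M] off [-L, L], and vanishes on [-L0, L0]. *)
pose k x := 2 * M * (1 + (-1 * smooth_step (1 * x - - L) + smooth_step (1 * x - (L - 3)))).
have Gk : good k.
  apply: mean_cvgZ; apply: mean_cvgD; first exact: mean_cvg_cst.
  by apply: mean_cvgD; [apply: mean_cvgZ; exact: steps|exact: steps].
exists (step_interp h (- L) delta n), k; split => //.
- apply: mean_cvgD; first exact: mean_cvg_cst.
  apply: (mean_cvg_sum n (fun i => h (- L + i.+1%:R * delta) - h (- L + i%:R * delta))
    (fun i x => smooth_step (delta^-1 * 3 * x - (delta^-1 * 3 * - L + 3 * i%:R)))) => i.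
  by apply: steps; rewrite mulr_gt0// invr_gt0.
- move=> x.
  have k0 : 0 <= k x.
    rewrite !mulr_ge0//.
    by have := smooth_step_le1 (1 * x - - L); have := smooth_step_ge0 (1 * x - (L - 3)); lra.
  have he i x' y : (i < n)%N -> - L + i%:R * delta <= x' <= - L + i.+1%:R * delta ->
      `|x' - y| <= delta -> `|h x' - h y| <= eps.
    move=> ii /andP[x'1 x'2] xy; apply: Hd'; last exact: le_trans xy dd'.
    have i0 : 0 <= i%:R * delta by rewrite mulr_ge0 ?(ltW d0)//.
    have i1 : i.+1%:R * delta <= n%:R * delta by rewrite ler_wpM2r ?(ltW d0)// ler_nat.
    by rewrite ler_norml; apply/andP; split; lra.
  have [HM Happ] := step_interp_approx h M (- L) delta eps n d0 (ltW e0) hM he x.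
  have far : 1 <= 1 + (-1 * smooth_step (1 * x - - L) + smooth_step (1 * x - (L - 3))) ->
      `|h x - step_interp h (- L) delta n x| <= eps + k x.
    move=> k1; have : 2 * M * 1 <= k x by rewrite ler_wpM2l ?mulr_ge0.
    by have := ler_normB (h x) (step_interp h (- L) delta n x); have := hM x; lra.
  have [xL|xL] := leP x (- L).
    apply: far; rewrite smooth_step0; last by lra.
    by have := smooth_step_ge0 (1 * x - (L - 3)); lra.
  have [Lx|Lx] := leP L x.
    apply: far; rewrite (smooth_step1 (_ - (L - 3))); last by lra.
    by have := smooth_step_le1 (1 * x - - L); lra.
  apply: (@le_trans _ _ eps); last by rewrite lerDl.
  by apply: Happ; lra.
have kx x : k x <= 2 * M / L0 ^+ 2 * x ^+ 2.
  rewrite [leRHS](_ : _ = 2 * M * (x ^+ 2 / L0 ^+ 2)); last by ring.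
  rewrite /k ler_wpM2l ?mulr_ge0// ler_pdivlMr; last first.
    by rewrite exprn_gt0//; lra.
  have s1 := smooth_step_le1 (1 * x - (L - 3)).
  have s0 := smooth_step_ge0 (1 * x - - L).
  have L02 : 0 <= L0 ^+ 2 by exact: sqr_ge0.
  have [xL|xL] := leP x (- L0).
    rewrite (smooth_step0 (_ - (L - 3))); last by rewrite /L; lra.
    by nra.
  rewrite (smooth_step1 (_ - - L)); last by rewrite /L; lra.
  have [Lx|Lx] := leP L0 x; first by nra.
  rewrite (smooth_step0 (_ - (L - 3))); last by rewrite /L; lra.
  by have := sqr_ge0 x; lra.
apply: (@le_trans _ _ (\int[nu]_x (2 * M / L0 ^+ 2 * x ^+ 2))).
  apply: le_Rintegral => //.
  - have [ck [Mk Bk] _] := Gk.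
    exact: (bounded_continuous_integrable nu (fun y : measurableTypeR R => y : R) k Mk).
  - exact: integrable_realZl.
rewrite RintegralZl// -/V.
rewrite mulrAC ler_pdivrMr; last by rewrite exprn_gt0//; lra.
have : 2 * M * V <= eps * L0.
  rewrite /L0 mulrDr mulrCA divff ?(gt_eqF e0)//; lra.
have : 0 <= eps * (L0 * (L0 - 1)) by rewrite !mulr_ge0 ?(ltW e0)//; lra.
by rewrite expr2; lra.
Qed.
End mean_cvg.

Lemma Rintegral_dist {R : realType} {d : measure_display} {T : measurableType d}
    (P : probability T R) (F G k : T -> R) :
  P.-integrable [set: T] (EFin \o F) -> P.-integrable [set: T] (EFin \o G) ->
  P.-integrable [set: T] (EFin \o k) -> (forall w, `|F w - G w| <= k w) ->
  `|\int[P]_w F w - \int[P]_w G w| <= \int[P]_w k w.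
Proof.
move=> iF iG ik FG; rewrite -RintegralB//.
apply: le_trans (le_normr_Rintegral _ _) _ => //; first exact: integrable_realB.
by apply: le_Rintegral => //; apply: integrable_norm; exact: integrable_realB.
Qed.

(** * From small distances to the normal limit *)

Section normal_limit.
Context {R : realType} (s : R).
Context {d0 : measure_display} {Om0 : measurableType d0} (P0 : probability Om0 R).
Context (Y : R -> Om0 -> R) (f g : R -> R).
Local Notation gam := (normal_prob (0 : R) 1).
Local Notation m := (pmean P0 Y).
Local Notation v := (pvar P0 Y).

Hypotheses (s2 : 2 < s) (s3 : s <= 3).
Hypothesis mY : measurable_family Y.
Hypothesis EY : forall t,
  fine 'E_P0[Y t] = f t +o_(t \near +oo_R) Num.sqrt (g t).
Hypothesis VY : forall t, fine 'V_P0[Y t] = g t +o_(t \near +oo_R) g t.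
Hypothesis g0 : forall t, 0 <= t -> 0 <= g t.
Hypothesis goo : g t @[t --> +oo] --> +oo.
Hypothesis small : forall eps : R, 0 < eps -> exists2 C, 0 <= C & forall u, 0 <= u ->
  zdist_le s P0 (fun w => Y u w - m u) (Num.sqrt (v u))
    (C + eps * Num.sqrt (g u) `^ s).

Local Notation X := (fun t w => (Y t w - f t) / Num.sqrt (g t)).
Local Notation good := (mean_cvg P0 X gam).

Let mYt t : 0 <= t -> measurable_fun [set: Om0] (Y t).
Proof. exact: measurable_family_at. Qed.

(** Three comparisons: exact against approximate centering, by the Lipschitz bound; the centered
    variable against a normal one of equal variance, by the distance bound rescaled by g(t)^(-s/2);
    and that normal variable against the standard one, again by the Lipschitz bound. *)
Lemma zclass_mean_cvg (h : R -> R) (L : R) : zclass s h -> 0 <= L ->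
  (forall x y, `|h x - h y| <= L * `|x - y|) -> good h.
Proof.
move=> hh L0 hL; have [ch [M hM] _] := hh.
have hM' x : `|h x| <= M by have /andP[h0 hx] := hM x; rewrite ger0_norm.
split=> //; first by exists M.
move=> eps eps0.
have iabs : gam.-integrable [set: R] (EFin \o (fun y : R => `|y|)).
  exact: (integrable_norm (integrable_gauss_id (R := R))).
set G := \int[gam]_y `|y|.
have G0 : 0 <= G by exact: Rintegral_ge0.
have D0 : 0 < 2 + L + L * G by have := mulr_ge0 L0 G0; lra.
(* The three comparisons cost [L * e], [2 * e] and [L * e * G], which add up to [eps]. *)
pose e := eps / (2 + L + L * G).
have e0 : 0 < e by rewrite divr_gt0.
have eE : e * (2 + L + L * G) = eps by rewrite divfK ?gt_eqF.
have triangle (p q r z : R) : `|q - r| <= 2 * e -> `|p - q| <= L * e ->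
    `|r - z| <= L * e * G -> `|p - z| <= eps.
  rewrite !ler_norml => /andP[? ?] /andP[? ?] /andP[? ?].
  by apply/andP; split; lra.
have [C C0 HC] := small e e0.
have N0 : \forall t \near +oo, 0 <= t :> R by exact: nbhs_pinfty_ge.
apply: filterS3 N0 (near_mean_var P0 Y f g EY VY g0 e e0) (near_ge g goo (C / e + 1)).
move=> t t0 [mf vg] gt1.
have Ce0 : 0 <= C / e by rewrite divr_ge0// ltW.
have gt0 : 0 < g t by lra.
set sg := Num.sqrt (g t); have sg0 : 0 < sg by rewrite sqrtr_gt0.
have sgn0 : sg != 0 by rewrite gt_eqF.
have sg2 : sg ^+ 2 = g t by rewrite sqr_sqrtr// ltW.
have sg1 : 1 <= sg by rewrite -[1](sqrtr1 R) ler_wsqrtr//; lra.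
have gs0 : 0 < sg `^ s by exact: powR_gt0.
have Cgs : C <= e * sg `^ s.
  apply: (@le_trans _ _ (e * g t)).
    by rewrite mulrC -ler_pdivrMr//; lra.
  rewrite ler_wpM2l ?(ltW e0)// -sg2 -powR_mulrn ?(ltW sg0)//.
  by apply: ler_powR => //; exact: ltW.
have mt := mYt t t0.
have mZ : measurable_fun [set: Om0] (fun w => sg^-1 * (Y t w - m t)).
  by apply: measurable_funM => //; exact: measurable_funB.
have mX : measurable_fun [set: Om0] (fun w => (Y t w - f t) / sg).
  by apply: measurable_funM => //; exact: measurable_funB.
have mN : measurable_fun [set: measurableTypeR R]
    (fun y : measurableTypeR R => sg^-1 * (Num.sqrt (v t) * y)).
  by do 2! apply: measurable_funM => //.
have mid : measurable_fun [set: measurableTypeR R] (fun y : measurableTypeR R => y : R).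
  exact: measurable_id.
have iZ := bounded_continuous_integrable P0 _ h M mZ ch hM'.
have iX := bounded_continuous_integrable P0 _ h M mX ch hM'.
have iN := bounded_continuous_integrable gam _ h M mN ch hM'.
have iI := bounded_continuous_integrable gam _ h M mid ch hM'.
have b1 : `|\int[P0]_w h (sg^-1 * (Y t w - m t)) -
    \int[gam]_y h (sg^-1 * (Num.sqrt (v t) * y))| <= 2 * e.
  have mYm : measurable_fun [set: Om0] (fun w => Y t w - m t) by exact: measurable_funB.
  have := zclass_compl_le s P0 _ _ _ _ mYm (HC t t0) (zclass_scale s h sg sg0 hh).
  rewrite /= !RintegralZl// -mulrBr normrM (gtr0_norm gs0).
  have h2 : C + e * sg `^ s <= sg `^ s * (2 * e) by lra.
  by move=> /le_trans /(_ h2); rewrite ler_pM2l.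
have b2 : `|\int[P0]_w h ((Y t w - f t) / sg) -
    \int[P0]_w h (sg^-1 * (Y t w - m t))| <= L * e.
  rewrite -[leRHS](Rintegral_cst_prob P0); apply: Rintegral_dist => //.
    exact: integrable_cst_prob.
  move=> w; apply: (le_trans (hL _ _)); rewrite ler_wpM2l//.
  rewrite (_ : (Y t w - f t) / sg - sg^-1 * (Y t w - m t) = (m t - f t) / sg); last by ring.
  by rewrite normrM normfV (gtr0_norm sg0) ler_pdivrMr.
have b3 : `|\int[gam]_y h (sg^-1 * (Num.sqrt (v t) * y)) - \int[gam]_y h y| <= L * e * G.
  rewrite /G -RintegralZl//; apply: Rintegral_dist => //.
    exact: integrable_realZl.
  move=> y; apply: (le_trans (hL _ _)); rewrite -mulrA ler_wpM2l//.
  set a := sg^-1 * Num.sqrt (v t).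
  have a0 : 0 <= a by rewrite mulr_ge0 ?sqrtr_ge0 ?invr_ge0 ?(ltW sg0).
  have a2 : a ^+ 2 = v t / g t.
    by rewrite /a exprMn exprVn sg2 sqr_sqrtr ?pvar_ge0// mulrC.
  rewrite (_ : sg^-1 * (Num.sqrt (v t) * y) - y = (a - 1) * y); last by rewrite /a; ring.
  rewrite normrM ler_wpM2r//.
  have : `|a ^+ 2 - 1| <= e.
    rewrite a2 (_ : v t / g t - 1 = (v t - g t) / g t).
      by rewrite normrM normfV (gtr0_norm gt0) ler_pdivrMr.
    by rewrite mulrBl divff// gt_eqF.
  apply: le_trans; rewrite (_ : a ^+ 2 - 1 = (a - 1) * (a + 1)); last by ring.
  by rewrite normrM ler_peMr// ger0_norm; lra.
exact: triangle b1 b2 b3.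
Qed.

Lemma smooth_step_mean_cvg (a c : R) : 0 < a -> good (fun x => smooth_step (a * x - c)).
Proof.
move=> a0.
have ai0 : 0 < a^-1 by rewrite invr_gt0.
pose h x := a^-1 `^ s * (smooth_step (- c + a^-1^-1 * x) / 7).
have hh : zclass s h.
  exact: (zclass_scale s _ _ ai0 (zclass_shift s _ (- c) (zclass_smooth_step s s2 s3))).
have k0 : 0 < a^-1 `^ s by exact: powR_gt0.
have -> : (fun x => smooth_step (a * x - c)) = fun x => (7 / a^-1 `^ s) * h x.
  apply/funext => x; rewrite /h invrK [a * x - c]addrC.
  by field; rewrite gt_eqF.
apply: mean_cvgZ.
  have N0 : \forall t \near +oo, 0 <= t :> R by exact: nbhs_pinfty_ge.
  apply: filterS N0 => t t0; apply: measurable_funM => //.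
  by apply: measurable_funB => //; exact: mYt.
apply: (zclass_mean_cvg h (a^-1 `^ s * (5 * a) / 7)) => //.
  by rewrite !mulr_ge0 ?powR_ge0// ltW.
move=> x y; rewrite /h -mulrBr normrM (gtr0_norm k0).
rewrite [leRHS](_ : _ = a^-1 `^ s * (5 * a / 7 * `|x - y|)); last by ring.
rewrite ler_wpM2l ?(ltW k0)//.
rewrite -mulrBl normrM [X in _ * X]ger0_norm// invrK.
have := smooth_step_lip (- c + a * x) (- c + a * y).
rewrite (_ : - c + a * x - (- c + a * y) = a * (x - y)); last by ring.
by rewrite normrM (gtr0_norm a0); lra.
Qed.

Lemma normal_limit : cvg_in_dist P0 X gam.
Proof.
move=> h ch [M hM].
have N0 : \forall t \near +oo, 0 <= t :> R by exact: nbhs_pinfty_ge.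
have mX : \forall t \near +oo, measurable_fun [set: Om0] (X t).
  apply: filterS N0 => t t0; apply: measurable_funM => //.
  by apply: measurable_funB => //; exact: mYt.
have [_ _ E] := mean_cvg_of_steps P0 X gam mX smooth_step_mean_cvg
  integrable_gauss_sqr h M ch hM.
have fin (d1 : measure_display) (U : measurableType d1) (Q : probability U R) (Z : U -> R) :
    measurable_fun [set: U] Z ->
    (\int[Q]_w (h (Z w))%:E = (\int[Q]_w h (Z w))%:E)%E.
  move=> mZ; rewrite /Rintegral fineK//; apply: integrable_fin_num => //.
  exact: (bounded_continuous_integrable Q Z h M).
have mid : measurable_fun [set: measurableTypeR R] (fun y : measurableTypeR R => y : R).
  exact: measurable_id.
rewrite (fin _ _ gam _ mid).
apply: cvg_EFin.
  by apply: filterS mX => t mt; rewrite unlock fin.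
apply/cvgrPdist_le => e e0; apply: filterS2 mX (E e e0) => t mt.
by rewrite distrC /= unlock fin.
Qed.
End normal_limit.

(** * The contraction *)

(** The orbit of l |-> xi l + c converges geometrically to the fixed point c / (1 - xi), and every
    point of it satisfies [Q]. *)
Lemma affine_iteration {R : realType} (Q : R -> Prop) (xi c l0 : R) :
  0 <= xi < 1 -> 0 <= c -> (forall l, 0 <= l -> Q l -> Q (xi * l + c)) ->
  0 <= l0 -> Q l0 -> forall eps, 0 < eps ->
  exists l, [/\ 0 <= l, Q l & l <= c / (1 - xi) + eps].
Proof.
move=> /andP[xi0 xi1] c0 QS l00 Ql0 eps eps0.
have x1 : 0 < 1 - xi by lra.
pose l n := iter n (fun l => xi * l + c) l0.
have lQ n : 0 <= l n /\ Q (l n).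
  elim: n => [//|n [IH1 IH2]]; split; last exact: QS.
  by rewrite /l /= addr_ge0// mulr_ge0.
have lE n : l n = c / (1 - xi) + xi ^+ n * (l0 - c / (1 - xi)).
  elim: n => [|n IH]; first by rewrite expr0 mul1r addrC subrK.
  have -> : l n.+1 = xi * l n + c by [].
  rewrite IH exprS; have : c / (1 - xi) * (1 - xi) = c by rewrite divfK// gt_eqF.
  by set q := c / _ => qE; rewrite -[X in _ + X = _]qE; ring.
set D := l0 - c / (1 - xi) in lE.
have : (fun n => xi ^+ n * D) @ \oo --> (0 : R).
  rewrite -[X in _ --> X](mul0r D); apply: cvgMl.
  by apply: cvg_expr; rewrite ger0_norm.
move=> /cvgrPdist_le /(_ eps eps0)[N _ /(_ N (leqnn N))].
rewrite sub0r normrN => hN; have [h1 h2] := lQ N.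
exists (l N); split => //; rewrite lE lerD2l.
exact: le_trans (ler_norm _) hN.
Qed.

Section contraction.
Context {R : realType} {K : nat} (tau0 s : R).
Context {d0 : measure_display} {Om0 : measurableType d0} (P0 : probability Om0 R).
Context (Y : R -> Om0 -> R).
Context {d : measure_display} {Om : measurableType d} (P : probability Om R).
Context (Yc : 'I_K -> R -> Om -> R) (b : R -> Om -> R) (T : 'I_K -> R -> Om -> R).
Context {dA : measure_display} {OmA : measurableType dA} (PA : probability OmA R).
Context (A : 'I_K -> {RV PA >-> R}) (f g : R -> R) (Cg : R).
Local Notation gam := (normal_prob (0 : R) 1).
Local Notation m := (pmean P0 Y).
Local Notation v := (pvar P0 Y).

Hypotheses (s2 : 2 < s) (s3 : s <= 3) (K0 : (0 < K)%N).
Hypothesis mY : measurable_family Y.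
Hypothesis mYc : forall r, measurable_family (Yc r).
Hypothesis Tt : forall r t w, 0 <= t -> 0 <= T r t w <= t.
Hypothesis indf : independent_families P Yc b T.
Hypothesis YcY : forall r t, 0 <= t -> eq_dist P (Yc r t) P0 (Y t).
Hypothesis iY : forall t, 0 <= t ->
  P0.-integrable setT (fun w => (`|Y t w| `^ s)%:E).
Hypothesis rec : forall t, tau0 <= t ->
  eq_dist P0 (Y t) P (fun w => \sum_(r < K) Yc r (T r t w) w + b t w).
Hypothesis supY : forall t, 0 <= t ->
  (ereal_sup [set 'E_P0[fun w => (`|Y u w| `^ s)%R] | u in `[0%R, t]] < +oo)%E.
Hypothesis EY : forall t,
  fine 'E_P0[Y t] = f t +o_(t \near +oo_R) Num.sqrt (g t).
Hypothesis VY : forall t, fine 'V_P0[Y t] = g t +o_(t \near +oo_R) g t.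
Hypothesis bf : forall t, 0 < t -> has_ubound [set `|f u| | u in `[0, t]].
Hypothesis g0 : forall t, 0 <= t -> 0 <= g t.
Hypothesis goo : g t @[t --> +oo] --> +oo.
Hypothesis Cg1 : 1 <= Cg.
Hypothesis gC : forall u t, 0 <= u <= t -> g u <= Cg * g t.
Hypothesis XA : ell_cvg s P
  (fun t w => [tuple Num.sqrt (g (T r t w) / g t) | r < K])
  PA (fun w => [tuple A r w | r < K]).
Hypothesis b0 : ell_cvg s P
  (fun t w => [tuple (b t w - f t + \sum_(r < K) f (T r t w)) / Num.sqrt (g t)])
  P (fun=> [tuple 0]).
Hypothesis A1 : {ae PA, forall w, \sum_(r < K) A r w ^+ 2 = 1}.
Hypothesis Alt1 : (PA [set w | exists r, A r w = 1%R] < 1)%E.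

Local Notation zdist u a :=
  (zdist_le s P0 (fun w => Y u w - m u) (Num.sqrt (v u)) a).
Local Notation gs u := (Num.sqrt (g u) `^ s).

(** [gaussian_comparison] after division by g(t)^(1/2): normalized conditional variances are close
    to 1 in mean, the normalized toll is small in L^s, and rescaling the test function produces the
    factor g(t)^(s/2). *)
Lemma toll_comparison (eta : R) : 0 < eta -> \forall t \near +oo,
  forall h, zclass s h ->
  (\int[P]_w \int[gam]_n (h (toll P0 Y b T t w +
      Num.sqrt (mixvar P0 Y T t w) * n)%R)%:E <=
   \int[gam]_n (h (Num.sqrt (v t) * n)%R)%:E + (eta * gs t)%:E)%E.
Proof.
move=> eta0; have [s2' s3'] := (s2, s3).
have cg1 := Cg1; have k1 : 1 <= K%:R :> R by rewrite ler1n.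
pose c : R := ctrunc (K := K) Cg.
have c1 : 1 <= c by apply: ctrunc_ge1.
have c2 : 2 <= c by rewrite /c /ctrunc; nra.
pose k : R := 4 * c ^+ 2 * gauss3.
have k0 : 0 <= k by rewrite !mulr_ge0 ?gauss3_ge0 ?exprn_ge0//; lra.
(* Makes [k * 4 * rho] at most eta / 2; being fixed before [e], [rho] may enter the large constant
   [L]. *)
pose rho := eta / (8 * (k + 1)).
have k10 : 0 < 8 * (k + 1) by lra.
have rho0 : 0 < rho by rewrite divr_gt0.
pose L := 4 * rho `^ (- s) + 8 * c + 4.
have L0 : 0 <= L by have := powR_ge0 rho (- s); rewrite /L; lra.
(* Makes [k * (8 + L) * e] at most eta / 2; the bound 1 keeps the normalized standard deviation
   below [c]. *)
pose e := Num.min 1 (eta / (2 * (k + 1) * (8 + L))).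
have kL : 0 < 2 * (k + 1) * (8 + L) by rewrite !mulr_gt0//; lra.
have e0 : 0 < e by rewrite lt_min ltr01 divr_gt0.
have e1 : e <= 1 by rewrite ge_min lexx.
have eL : e * (2 * (k + 1) * (8 + L)) <= eta.
  by rewrite -ler_pdivlMr// ge_min lexx orbT.
have kbound (x y z : R) : 0 <= x -> x <= e -> 0 <= y -> y <= e -> 0 <= z -> z <= e ->
    k * (4 * (x + y) + 4 * rho + L * z) <= eta.
  move=> x0 xe y0 ye z0 ze.
  have h1 : L * z <= L * e by exact: ler_wpM2l.
  have h2 : 4 * (x + y) + 4 * rho + L * z <= (8 + L) * e + 4 * rho by lra.
  apply: (le_trans (ler_wpM2l k0 h2)).
  have h3 : rho * (8 * (k + 1)) = eta by rewrite /rho divfK// gt_eqF.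
  have h4 : 0 <= (8 + L) * e by rewrite mulr_ge0//; lra.
  lra.
have N0 : \forall t \near +oo, 0 <= t :> R by exact: nbhs_pinfty_ge.
have Nt : \forall t \near +oo, tau0 <= t by apply: nbhs_pinfty_ge; exact: num_real.
have M1 : \forall t \near +oo, [/\ 0 <= t, tau0 <= t & 1 <= g t].
  by apply: filterS3 N0 Nt (near_ge g goo 1).
have M2 : \forall t \near +oo, [/\ `|v t - g t| <= e * g t,
    forall w, `|mixvar P0 Y T t w / g t - \sum_(r < K) g (T r t w) / g t| <= 1 &
    (\int[P]_w (`|mixvar P0 Y T t w / g t - 1|)%:E <= e%:E)%E].
  apply: filterS3 (near_mean_var P0 Y f g EY VY g0 e e0)
    (near_mixvar s P0 Y T f g Cg s2 s3 K0 mY Tt iY supY EY VY bf g0 goo Cg1 gC 1 ltr01)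
    (near_mixvar_mean s P0 Y P T PA A f g Cg s2 s3 K0 mY Tt iY supY EY VY bf g0
      goo Cg1 gC XA A1 e e0).
  by move=> t [_ ?].
have M3 := near_toll_moment s P0 Y P b T f g Cg s2 s3 K0 mY Tt iY supY EY VY bf g0
      goo Cg1 gC b0 e e0.
apply: filterS3 M1 M2 M3 => t [t0 tau0t g1] [vg mixg mix1] tollm h hh.
have gt0 : 0 < g t by lra.
have sg0 : 0 < Num.sqrt (g t) by rewrite sqrtr_gt0.
have sgn0 : Num.sqrt (g t) != 0 by rewrite gt_eqF.
have gn0 : g t != 0 by rewrite gt_eqF.
have g2 : Num.sqrt (g t) ^+ 2 = g t by rewrite sqr_sqrtr// ltW.
have [mtoll mmix _] := measurable_rec P0 Y P Yc b T mY indf t t0.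
have [iB2 EB EVB] := rec_moments s P0 Y P Yc b T s2 s3 mY mYc Tt indf YcY iY t t0
  (rec t tau0t).
have mix0 w : 0 <= mixvar P0 Y T t w by apply: sumr_ge0 => r _; exact: pvar_ge0.
pose V w := mixvar P0 Y T t w / g t.
pose B w := toll P0 Y b T t w / Num.sqrt (g t).
pose x := Num.sqrt (v t / g t).
have vg0 : 0 <= v t / g t by rewrite divr_ge0 ?pvar_ge0// ltW.
have x2 : x ^+ 2 = v t / g t by rewrite sqr_sqrtr.
have xe : `|x ^+ 2 - 1| <= e.
  rewrite x2 (_ : v t / g t - 1 = (v t - g t) / g t); last by field.
  by rewrite normrM (gtr0_norm (_ : 0 < (g t)^-1)) ?invr_gt0// ler_pdivrMr.
have x0 : 0 <= x by exact: sqrtr_ge0.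
have xc : x <= c.
  by move: xe; rewrite ler_norml => /andP[_ xe']; nra.
have Vc w : 0 <= V w <= c ^+ 2.
  rewrite divr_ge0 ?(ltW gt0)//=.
  have := mixg w; rewrite ler_norml => /andP[_ h1].
  have h2 : \sum_(r < K) g (T r t w) / g t <= K%:R * Cg.
    have -> : K%:R * Cg = \sum_(r < K) Cg by rewrite sumr_const card_ord mulr_natl.
    by apply: ler_sum => r _; exact: (ratio_le T g Cg Tt gC r t w t0 gt0).
  rewrite /V; have : K%:R * Cg + 1 <= c ^+ 2.
    have : 0 <= K%:R * Cg by apply: mulr_ge0; lra.
    by rewrite /c /ctrunc; set a := K%:R * Cg => a0; have := sqr_ge0 a; nra.
  lra.
have mV : measurable_fun [set: Om] V by exact: measurable_funM.
have mB : measurable_fun [set: Om] B by exact: measurable_funM.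
have mBs : measurable_fun [set: Om] (fun w => `|B w| `^ s) by exact: measurable_abs_powR.
have iBs : P.-integrable [set: Om] (EFin \o (fun w => `|B w| `^ s)).
  apply/integrableP; split; first exact/measurable_EFinP.
  apply: (@le_lt_trans _ _ e%:E); last by rewrite ltry.
  apply: le_trans tollm; rewrite le_eqVlt; apply/orP; left; apply/eqP.
  by apply: eq_integral => w _; rewrite /= ger0_norm ?powR_ge0.
have iB : P.-integrable [set: Om] (EFin \o toll P0 Y b T t).
  have i1 : P.-integrable [set: Om] (EFin \o (fun w => 1 + toll P0 Y b T t w ^+ 2)).
    by apply: integrable_realD => //; exact: integrable_cst_prob.
  apply: le_integrable_real i1 => // w.
  rewrite -[_ ^+ 2]real_normK ?num_real//; have := normr_ge0 (toll P0 Y b T t w).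
  by set a := `|_| => a0; have := sqr_ge0 (a - 1); nra.
have imix : P.-integrable [set: Om] (EFin \o mixvar P0 Y T t).
  apply: (integrable_bounded P _ (c ^+ 2 * g t)) => // w.
  by have /andP[_] := Vc w; rewrite ler_pdivrMr// ger0_norm.
have EB0 : \int[P]_w B w = 0 by rewrite /B RintegralZr// EB mul0r.
have EV : \int[P]_w V w + \int[P]_w (B w ^+ 2) = x ^+ 2.
  rewrite /V RintegralZr// x2 -EVB mulrDl; congr (_ + _).
  under eq_Rintegral do rewrite expr_div_n g2.
  by rewrite RintegralZr.
(* The test function at unit scale, normalized so as to remain in the class. *)
pose h' y := (Num.sqrt (g t))^-1 `^ s * h ((Num.sqrt (g t))^-1^-1 * y).
have hh' : zclass s h' by apply: zclass_scale => //; rewrite invr_gt0.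
have kh' y : gs t * h' y = h (Num.sqrt (g t) * y).
  rewrite /h' invrK mulrA -powRM ?invr_ge0 ?(ltW sg0)// divff//.
  by rewrite powR1 mul1r.
have := gaussian_comparison P s c rho x h' V B s2 s3 hh' c1 rho0 mV Vc mB iBs
  x0 xc EB0 EV.
rewrite -/k -/L => cmp.
have h0 z : 0 <= h z := zclass_ge0 s h z hh.
have h'0 z : 0 <= h' z := zclass_ge0 s h' z hh'.
have mh' := zclass_measurable s h' hh'.
have gs0 : (0 <= (gs t)%:E)%E by rewrite lee_fin powR_ge0.
have [ch' _ _] := hh'.
have e3 : (\int[P]_w \int[gam]_n (h (toll P0 Y b T t w +
      Num.sqrt (mixvar P0 Y T t w) * n)%R)%:E = (gs t)%:E *
    \int[P]_w \int[gam]_y (h' (B w + Num.sqrt (V w) * y)%R)%:E)%E.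
  rewrite -ge0_integralZl//; last 2 first.
  - have mF := measurable_gauss_smooth h' ch' h'0.
    exact: (measurableT_comp mF (measurable_fun_pair mB mV)).
  - by move=> w _; apply: integral_ge0 => y _; rewrite lee_fin.
  apply: eq_integral => w _; rewrite -ge0_integralZl//; last 2 first.
  - apply/measurable_EFinP; apply: (measurableT_comp mh').
    by apply: measurable_funD => //; exact: measurable_funM.
  - by move=> y _; rewrite lee_fin.
  apply: eq_integral => y _; rewrite -EFinM kh'; congr (h _)%:E.
  rewrite /B /V sqrtrM// sqrtrV ?(ltW gt0)//.
  by rewrite mulrDr mulrCA divff// mulr1 mulrA mulrCA divff// mulr1.
have e4 : (\int[gam]_n (h (Num.sqrt (v t) * n)%R)%:E = (gs t)%:E *
    \int[gam]_y (h' (x * y)%R)%:E)%E.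
  rewrite -ge0_integralZl//; last 2 first.
  - apply/measurable_EFinP; apply: (measurableT_comp mh').
    exact: measurable_funM.
  - by move=> y _; rewrite lee_fin.
  apply: eq_integral => y _; rewrite -EFinM kh'; congr (h _)%:E.
  rewrite /x sqrtrM ?pvar_ge0// sqrtrV ?(ltW gt0)//.
  by rewrite mulrA mulrCA divff// mulr1.
rewrite e3 e4.
apply: (@le_trans _ _ ((gs t)%:E * (\int[gam]_y (h' (x * y)%R)%:E + eta%:E))%E).
  apply: lee_wpmul2l => //; apply: (le_trans cmp); apply: leeD => //.
  rewrite lee_fin; apply: kbound => //.
  - by apply: Rintegral_ge0.
  - rewrite -lee_fin /Rintegral fineK//.
    apply: integrable_fin_num => //.
    have : P.-integrable [set: Om] (EFin \o (fun w => V w - 1)).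
      apply: integrable_realB; last exact: integrable_cst_prob.
      by apply: (integrable_bounded P _ (c ^+ 2)) => // w; have /andP[V0 V1] := Vc w; rewrite ger0_norm.
    exact: integrable_norm.
  - by apply: Rintegral_ge0 => w _; exact: powR_ge0.
  - by rewrite -lee_fin /Rintegral fineK//; exact: integrable_fin_num iBs.
rewrite ge0_muleDr//; last 2 first.
- by apply: integral_ge0 => y _; rewrite lee_fin.
- by rewrite lee_fin ltW.
by rewrite -EFinM [(gs t * eta)%R]mulrC.
Qed.

(** The replacement costs average to [K * C + xi * l * g(t)^(s/2)] at most, and the normal mixture
    adds [eta * g(t)^(s/2)]. The threshold on [t] depends on [eta] alone and not on [C] or [l],
    which is what permits iteration. *)
Lemma zdist_contraction : exists2 xi : R, 0 <= xi < 1 &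
  forall eta, 0 < eta -> \forall t \near +oo, forall C l, 0 <= C -> 0 <= l ->
    (forall u, 0 <= u <= t -> zdist u (C + l * gs u)) ->
    zdist t (K%:R * C + (xi * l + eta) * gs t).
Proof.
have [xi xi01 Nw] := near_weights s P T PA A g Cg s2 s3 K0 Tt goo Cg1 gC XA A1 Alt1.
exists xi => // eta eta0.
have N0 : \forall t \near +oo, 0 <= t :> R by exact: nbhs_pinfty_ge.
have Nt : \forall t \near +oo, tau0 <= t by apply: nbhs_pinfty_ge; exact: num_real.
have M1 : \forall t \near +oo, 0 <= t /\ tau0 <= t by apply: filterS2 N0 Nt.
apply: filterS3 M1 Nw (toll_comparison eta eta0).
move=> t [t0 taut] [mw Ew] cmp C l C0 l0 H h hh.
have gs0 u : 0 <= gs u by exact: powR_ge0.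
have d0' u : 0 <= u <= t -> 0 <= C + l * gs u by rewrite addr_ge0// mulr_ge0.
have md r : measurable_fun [set: Om] (fun w => C + l * gs (T r t w)).
  by apply: measurable_funD => //; apply: measurable_funM.
apply: (le_trans (rec_zdist s P0 Y P Yc b T mY mYc Tt indf YcY t t0 (rec t taut)
  (fun u => C + l * gs u) h H d0' md hh)).
apply: (le_trans (leeD (cmp h hh) (lexx _))).
rewrite -addeA; apply: leeD => //.
have mE r : measurable_fun [set: Om] (fun w => (gs (T r t w))%:E).
  exact/measurable_EFinP.
have dE r : (\int[P]_w (C + l * gs (T r t w))%:E =
    C%:E + l%:E * \int[P]_w (gs (T r t w))%:E)%E.
  under eq_integral do rewrite EFinD EFinM.
  rewrite ge0_integralD//; last 2 first.
  - by move=> w _; rewrite mule_ge0// lee_fin.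
  - exact: measurable_funeM.
  rewrite integral_cst//= probability_setT mule1 ge0_integralZl//.
have sE : (\sum_(r < K) \int[P]_w (C + l * gs (T r t w))%:E =
    (K%:R * C)%:E + l%:E * \int[P]_w (\sum_(r < K) gs (T r t w))%:E)%E.
  under eq_bigr do rewrite dE.
  rewrite big_split/=; congr (_ + _)%E.
    by rewrite sumEFin sumr_const card_ord mulr_natl.
  rewrite -ge0_sume_distrr; last first.
    by move=> r _; apply: integral_ge0 => w _; rewrite lee_fin.
  congr (_ * _)%E; rewrite -ge0_integral_sum//.
    by apply: eq_integral => w _; rewrite sumEFin.
rewrite sE.
have El : (l%:E * \int[P]_w (\sum_(r < K) gs (T r t w))%:E <= (l * (xi * gs t))%:E)%E.
  by rewrite EFinM; apply: lee_wpmul2l.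
apply: (le_trans (leeD2l _ (leeD2l _ El))).
by rewrite -!EFinD lee_fin le_eqVlt; apply/orP; left; apply/eqP; ring.
Qed.

(** Two iterations: one over bounds on a fixed interval [0, u], to obtain a coefficient [l1]
    independent of [u]; one over bounds valid at all times, to push the coefficient below [eps]. *)
Lemma zdist_small (eps : R) : 0 < eps ->
  exists2 C, 0 <= C & forall u, 0 <= u -> zdist u (C + eps * gs u).
Proof.
move=> eps0; have [xi xi01 Hxi] := zdist_contraction.
have gs0 u : 0 <= gs u by exact: powR_ge0.
have k0 : 0 <= K%:R :> R by exact: ler0n.
have local t : 0 <= t -> exists2 C, 0 <= C & forall u, 0 <= u <= t -> zdist u C.
  move=> t0.
  have [C C0 HC] := local_moment_bound P0 Y s s2 s3 mY iY supY t t0.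
  by exists C => // u /HC[].
have step eta : 0 < eta -> exists2 t1, 0 <= t1 & forall t, t1 <= t -> 1 <= gs t /\
    forall C l, 0 <= C -> 0 <= l ->
      (forall u, 0 <= u <= t -> zdist u (C + l * gs u)) ->
      zdist t (K%:R * C + (xi * l + eta) * gs t).
  move=> eta0.
  have N : \forall t \near +oo, 1 <= gs t /\
    forall C l, 0 <= C -> 0 <= l ->
      (forall u, 0 <= u <= t -> zdist u (C + l * gs u)) ->
      zdist t (K%:R * C + (xi * l + eta) * gs t).
    apply: filterS2 (near_ge g goo 1) (Hxi eta eta0) => t g1 Ht; split => //.
    have <- : 1 `^ s = 1 :> R by rewrite powR1.
    apply: ge0_ler_powR; rewrite ?nnegrE ?sqrtr_ge0//.
      by move: s2; lra.
    by rewrite -sqrtr1; exact: ler_wsqrtr.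
  by have [t1 /ltW t10 Ht1] := near_pinftyP _ N; exists t1.
have [t1 t10 S1] := step 1 ltr01.
have [C0 C00 L1] := local t1 t10.
(* Past [t1], where g(u)^(s/2) >= 1, the constant [K * C0] is moved into the coefficient; the 1 is
   the value of [eta] in [S1]. *)
pose k := K%:R * C0 + 1.
have kk0 : 0 <= k by rewrite addr_ge0// mulr_ge0.
pose l1 := k / (1 - xi) + 1.
have l10 : 0 <= l1.
  by case/andP: xi01 => *; rewrite addr_ge0// divr_ge0// subr_ge0 ltW.
have B1 u : 0 <= u -> zdist u (C0 + l1 * gs u).
  move=> u0.
  pose Q l := forall u', 0 <= u' <= u -> zdist u' (C0 + l * gs u').
  (* The starting coefficient [C] depends on [u], but the limit of the iteration does not. *)
  have [C C_ge0 HC] := local u u0.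
  have QC : Q C.
    move=> u' /[dup] /HC Hu' /andP[u'0 _]; have [u't|tu'] := leP u' t1.
      apply: (zdist_leW _ _ _ _ C0); last by apply: L1; rewrite u'0.
      by rewrite lerDl mulr_ge0.
    apply: (zdist_leW _ _ _ _ C) => //.
    have [g1 _] := S1 u' (ltW tu'); have : C * 1 <= C * gs u' by exact: ler_wpM2l.
    by lra.
  have QS l : 0 <= l -> Q l -> Q (xi * l + k).
    move=> l0 Ql u' /andP[u'0 u'u]; have [u't|tu'] := leP u' t1.
      apply: (zdist_leW _ _ _ _ C0); last by apply: L1; rewrite u'0.
      by case/andP: xi01 => xi0 _; rewrite lerDl mulr_ge0// addr_ge0// mulr_ge0.
    have [g1 Hu'] := S1 u' (ltW tu').
    have Ql' u'' : 0 <= u'' <= u' -> zdist u'' (C0 + l * gs u'').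
      by move=> /andP[u''0 u''u']; apply: Ql; rewrite u''0 (le_trans u''u').
    apply: (zdist_leW _ _ _ _ _ _ _ (Hu' C0 l C00 l0 Ql')).
    have : K%:R * C0 * 1 <= K%:R * C0 * gs u' by rewrite ler_wpM2l// mulr_ge0.
    by rewrite /k; lra.
  have [l [l0 Ql ll1]] := affine_iteration Q xi k C xi01 kk0 QS C_ge0 QC 1 ltr01.
  have Hu : zdist u (C0 + l * gs u) by apply: Ql; rewrite u0 lexx.
  by apply: (zdist_leW _ _ _ _ _ _ _ Hu); rewrite lerD2l ler_wpM2r.
(* Places the fixed point eta / (1 - xi) at eps / 2, leaving eps / 2 for the distance of the iterate
   to it. *)
pose eta := (1 - xi) * (eps / 2).
have eta0 : 0 < eta by case/andP: xi01 => *; rewrite mulr_gt0 ?divr_gt0 ?subr_gt0.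
have [t2 t20 S2] := step eta eta0.
have [C2 C20 L2] := local t2 t20.
(* The additive constant is now quantified after [l]: it may grow at each pass, since only finitely
   many passes are made. *)
pose Q l := exists2 C, 0 <= C & forall u, 0 <= u -> zdist u (C + l * gs u).
have QS l : 0 <= l -> Q l -> Q (xi * l + eta).
  move=> l0 [C C_ge0 HC]; exists (K%:R * C + C2); first by rewrite addr_ge0 ?mulr_ge0.
  have le0 : 0 <= xi * l + eta.
    by case/andP: xi01 => xi0 _; exact: (addr_ge0 (mulr_ge0 xi0 l0) (ltW eta0)).
  move=> u u0; have [ut|tu] := leP u t2.
    apply: (zdist_leW _ _ _ _ C2); last by apply: L2; rewrite u0.
    by rewrite addrAC lerDr addr_ge0 ?mulr_ge0.
  have [_ Hu] := S2 u (ltW tu).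
  have HC' u' : 0 <= u' <= u -> zdist u' (C + l * gs u').
    by move=> /andP[u'0 _]; exact: HC.
  apply: (zdist_leW _ _ _ _ _ _ _ (Hu C l C_ge0 l0 HC')).
  by rewrite lerD2r lerDl.
have eps20 : 0 < eps / 2 by rewrite divr_gt0.
have [l [l0 [C C_ge0 HC] le]] :=
  affine_iteration Q xi eta l1 xi01 (ltW eta0) QS l10 (ex_intro2 _ _ C0 C00 B1) _ eps20.
exists C => // u u0; apply: (zdist_leW _ _ _ _ _ _ _ (HC u u0)).
rewrite lerD2l ler_wpM2r// (le_trans le)//.
case/andP: xi01 => xi0 xi1; rewrite /eta mulrAC divff ?subr_eq0 ?(gt_eqF xi1)//.
by lra.
Qed.

End contraction.

Theorem corollary5p2 (R : realType) (K : nat) (tau0 s : R)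
  (* space carrying the Y_t *)
  (d0 : measure_display) (Om0 : measurableType d0) (P0 : probability Om0 R)
  (Y : R -> Om0 -> R)
  (* space carrying the copies Y_t^(r), the b_t and the T^(t) *)
  (d : measure_display) (Om : measurableType d) (P : probability Om R)
  (Yc : 'I_K -> R -> Om -> R) (b : R -> Om -> R) (T : 'I_K -> R -> Om -> R)
  (* space carrying the A_r^* *)
  (dA : measure_display) (OmA : measurableType dA) (PA : probability OmA R)
  (A : 'I_K -> {RV PA >-> R})
  (f g : R -> R) :
  (0 < K)%N -> 0 <= tau0 -> 2 < s -> s <= 3 ->
  measurable_family Y ->
  (forall r, measurable_family (Yc r)) ->
  measurable_family b ->
  (forall r, measurable_family (T r)) ->
  (forall r t w, 0 <= t -> 0 <= T r t w <= t) ->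
  independent_families P Yc b T ->
  (forall r t, 0 <= t -> eq_dist P (Yc r t) P0 (Y t)) ->
  (forall t, 0 <= t -> P0.-integrable setT (fun w => (`|Y t w| `^ s)%:E)) ->
  (forall t, tau0 <= t ->
    eq_dist P0 (Y t) P (fun w => \sum_(r < K) Yc r (T r t w) w + b t w)) ->
  (forall t, 0 <= t ->
    (ereal_sup [set 'E_P0[fun w => (`|Y u w| `^ s)%R] | u in `[0%R, t]] < +oo)%E) ->
  (forall t, fine 'E_P0[Y t] = f t +o_(t \near +oo_R) Num.sqrt (g t)) ->
  (forall t, fine 'V_P0[Y t] = g t +o_(t \near +oo_R) g t) ->
  (forall t, 0 < t -> has_ubound [set `|f u| | u in `[0, t]]) ->
  (forall t, 0 <= t -> 0 <= g t) ->
  g t @[t --> +oo] --> +oo ->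
  (exists2 C : R, 1 <= C & forall u t, 0 <= u <= t -> g u <= C * g t) ->
  ell_cvg s P (fun t w => [tuple Num.sqrt (g (T r t w) / g t) | r < K])
    PA (fun w => [tuple A r w | r < K]) ->
  ell_cvg s P
    (fun t w => [tuple (b t w - f t + \sum_(r < K) f (T r t w)) / Num.sqrt (g t)])
    P (fun=> [tuple 0]) ->
  {ae PA, forall w, \sum_(r < K) A r w ^+ 2 = 1} ->
  (PA [set w | exists r, A r w = 1%R] < 1)%E ->
  cvg_in_dist P0 (fun t w => (Y t w - f t) / Num.sqrt (g t)) (normal_prob 0 1).
Proof.
move=> K0 _ s2 s3 mY mYc _ _ Tt indf YcY iY rec supY EY VY bf g0 goo [Cg Cg1 gC] XA b0 A1 Alt1.
apply: (normal_limit s P0 Y f g s2 s3 mY EY VY g0 goo).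
exact: (zdist_small tau0 s P0 Y P Yc b T PA A f g Cg s2 s3 K0 mY mYc Tt indf YcY iY rec
  supY EY VY bf g0 goo Cg1 gC XA b0 A1 Alt1).
Qed.
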